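(* Let $0\le\rho<R\le\infty$. Let $\mu$ be a pseudo-positive signed moment measure on $\mathbb{R}^d$ with support in the closed annulus $A_{\rho,R}$ such that $$\sum_{k=0}^{\infty}\sum_{l=1}^{a_k}\int_{\mathbb{R}^d}Y_{k,l}\Big(\frac{x}{|x|}\Big)\,d\mu(x)<\infty ,$$ and, in the case $R=\infty$, such that moreover $\sum_{k=0}^{\infty}\sum_{l=1}^{a_k}\int_{\mathbb{R}^d}|x|^N\,Y_{k,l}(x/|x|)\,d\mu(x)<\infty$ for every $N\in\mathbb{N}_0$. Then for each natural number $s\geq 1$ there exists a unique pseudo-positive, signed moment measure $\sigma^{(s)}$ with support in $A_{\rho,R}$ such that (i) the support of each component measure $\sigma^{(s)}_{k,l}$ of $\sigma^{(s)}$ ($k\in\mathbb{N}_0$, $l=1,\dots,a_k$) has cardinality $\le s$; (ii) $\int P\,d\mu=\int P\,d\sigma^{(s)}$ for all polynomials $P$ with $\Delta^{2s}P=0$.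
   Context: Fix an integer $d\ge 2$. $|x|$ is the Euclidean norm, $\Delta$ the Laplace operator on $\mathbb{R}^d$ and $\Delta^{2s}$ its $2s$-th iterate, $A_{\rho,R}=\{x\in\mathbb{R}^d:\rho\le|x|\le R\}$, and $\mathbb{S}^{d-1}$ the unit sphere with surface measure $d\theta$. For each $k\in\mathbb{N}_0=\{0,1,2,\dots\}$, $Y_{k,1},\dots,Y_{k,a_k}:\mathbb{R}^d\to\mathbb{R}$ is a fixed basis of the space of harmonic homogeneous polynomials of degree $k$, orthonormal with respect to $\langle f,g\rangle=\int_{\mathbb{S}^{d-1}}f(\theta)\overline{g(\theta)}\,d\theta$. At $x=0$, $Y_{k,l}(x/|x|)$ is read as $0$ for $k\ge1$ and as the constant value of $Y_{0,1}$ for $k=0$. A signed measure on $\mathbb{R}^d$ is a real-valued $\sigma$-additive set function on the Borel sets; it is a moment measure if all polynomials are integrable with respect to its total variation (automatic for compact support). Its support is the support of its total variation. A signed measure $\mu$ is pseudo-positive if $\int_{\mathbb{R}^d}h(|x|)Y_{k,l}(x)\,d\mu(x)\ge0$ for every continuous compactly supported $h:[0,\infty)\to[0,\infty)$ and all $k,l$. The component measures of a pseudo-positive moment measure $\mu$ are the unique (non-negative) measures $\mu_{k,l}$ on $[0,\infty)$ with all moments finite such that $\int_0^\infty h\,d\mu_{k,l}=\int_{\mathbb{R}^d}h(|x|)Y_{k,l}(x)\,d\mu(x)$ for all continuous polynomially bounded $h:[0,\infty)\to\mathbb{C}$. The support of the zero measure is empty. *)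

(* Defs.v *)
From HB Require Import structures.
From mathcomp Require Import all_boot all_order all_algebra.
From mathcomp Require Import all_classical all_reals all_analysis.
From mathcomp Require Import measurable_realfun.
(* The notations of mpoly clash with those of MathComp-Analysis. *)
From mathcomp.multinomials Require Import -(notations) mpoly.

Set Implicit Arguments.
Unset Strict Implicit.
Unset Printing Implicit Defensive.

Import Order.TTheory GRing.Theory Num.Theory.
Import numFieldNormedType.Exports.

Local Open Scope classical_set_scope.
Local Open Scope ring_scope.

(* R^d is 'rV[R]_d with its Borel sigma-algebra. The library topology on
   matrices is the product topology, i.e. the Euclidean one, but the library
   norm `|x| is the sup norm; the Euclidean norm is enorm below. *)
HB.instance Definition _ (R : realType) m n :=
  Measurable.copy 'M[R]_(m, n) (g_sigma_algebraType (@open 'M[R]_(m, n))).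

Section euclidean.
Context {R : realType}.

Lemma measurable_coord m n (i : 'I_m) (j : 'I_n) :
  measurable_fun [set: 'M[R]_(m, n)] (fun x : 'M[R]_(m, n) => x i j).
Proof.
apply: (measurability _ (RGenOInfty.measurableE R)).
move=> _ [_ [a ->] <-]; rewrite setTI; apply: sub_sigma_algebra.
apply: (@open_comp _ _ _ `]a, +oo[%classic) => // x _.
exact: coord_continuous.
Qed.

Lemma measurable_fun_rVP dT (T : measurableType dT) n (f : T -> 'rV[R]_n) :
  (forall j, measurable_fun setT (fun t => f t ord0 j)) -> measurable_fun setT f.
Proof.
move=> mf; apply: (@measurability _ _ _ _ _ _ (@open 'rV[R]_n)) => //.
move=> _ [U oU <-]; rewrite setTI.
pose c (q : 'rV[rat]_n * nat) : set 'rV[R]_n :=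
  ball (map_mx ratr q.1 : 'rV[R]_n) (q.2.+1%:R^-1 : R).
have -> : U = \bigcup_q (if `[< c q `<=` U >] then c q else set0).
  apply/seteqP; split => [x Ux|x [q _]]; last by case: asboolP => // + cx; exact.
  have /nbhs_ballP[e /= e0 xeU] := open_nbhs_nbhs (conj oU Ux).
  have [k ke] : exists k, k.+1%:R^-1 < e / 2.
    have e20 : 0 < e / 2 by rewrite divr_gt0.
    have [k _ /(_ k (leqnn k)) ke] := near_infty_natSinv_lt (PosNum e20).
    by exists k.
  have qP j : exists q : rat, ball (x ord0 j) (k.+1%:R^-1) (ratr q : R).
    have k0 : 0 < k.+1%:R^-1 :> R by rewrite invr_gt0.
    have [||y [By [q _ qy]]] := @dense_rat R (ball (x ord0 j) k.+1%:R^-1).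
    - by exists (x ord0 j); exact: ballxx.
    - exact: ball_open.
    by exists q; rewrite qy.
  have [q qxP] := choice qP.
  exists (\row_j q j, k) => //.
  have xc : c (\row_j q j, k) x.
    split=> [|i j]; first by rewrite /= invr_gt0.
    by rewrite !mxE ord1; exact/ball_sym.
  case: asboolP => // ncU; exfalso; apply: ncU => y cy; apply: xeU.
  rewrite (splitr e); apply: ball_triangle.
    by apply/ball_sym; apply: le_ball xc; exact: ltW.
  by apply: le_ball cy; exact: ltW.
rewrite preimage_bigcup; apply: countable_bigcupT_measurable.
  exact: countableP.
move=> q; case: asboolP => _; last by rewrite preimage_set0.
rewrite (_ : _ @^-1` _ = \bigcap_(j in [set: 'I_n])
    ((fun t => f t ord0 j) @^-1`
      ball (ratr (q.1 ord0 j) : R) (q.2.+1%:R^-1 : R))).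
  apply: fin_bigcap_measurable => // j _; rewrite -[X in measurable X]setTI.
  by apply: mf => //; exact: measurable_ball.
apply/seteqP; split => [t [_ ct] j _|t ct] /=.
  by have := ct ord0 j; rewrite mxE.
split=> [|i j]; first by rewrite invr_gt0.
by rewrite mxE ord1; exact: ct.
Qed.

Definition enorm n (x : 'rV[R]_n) : R := Num.sqrt (\sum_i x ord0 i ^+ 2).

Lemma measurable_enorm n : measurable_fun [set: 'rV[R]_n] (@enorm n).
Proof.
apply: measurableT_comp.
  by apply: continuous_measurable_fun; exact: sqrt_continuous.
apply: measurable_sum => i; apply: measurable_funX; exact: measurable_coord.
Qed.

(* x / |x|, equal to 0 at x = 0 since 0^-1 = 0. A homogeneous polynomial of
   degree k >= 1 (resp. 0) composed with it is thus 0 (resp. its constant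
   value) at x = 0. *)
Definition radial n (x : 'rV[R]_n) : 'rV[R]_n := (enorm x)^-1 *: x.

Lemma measurable_radial n : measurable_fun setT (@radial n).
Proof.
apply: measurable_fun_rVP => j.
under eq_fun do rewrite mxE.
apply: measurable_funM; last exact: measurable_coord.
rewrite (_ : (fun _ => _) = (@powR R ^~ (-1)) \o @enorm n).
  by apply: measurableT_comp; [exact: measurable_powR|exact: measurable_enorm].
by apply/funext => x /=; rewrite powR_inv1// sqrtr_ge0.
Qed.

Definition image_measure d d' (T : measurableType d) (T' : measurableType d')
    (m : {measure set T -> \bar R}) (f : T -> T')
    (mf : measurable_fun [set: T] f) : {measure set T' -> \bar R} :=
  measure_function_pushforward__canonical__measure_function_Measure m mf.

Definition rV_cons n (p : 'rV[R]_n * measurableTypeR R) : 'rV[R]_n.+1 :=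
  \row_i if unlift ord0 i is Some j then p.1 ord0 j else p.2.

Lemma measurable_rV_cons n : measurable_fun setT (@rV_cons n).
Proof.
apply: measurable_fun_rVP => i.
under eq_fun do rewrite mxE.
case: (unlift ord0 i) => [j|]; last exact: measurable_snd.
exact: (measurableT_comp (measurable_coord _ _)).
Qed.

(* Lebesgue measure on R^n, as an iterated product of lebesgue_measure. *)
Fixpoint lebesgue_rV n : {measure set 'rV[R]_n -> \bar R} :=
  if n is m.+1 return {measure set 'rV[R]_n -> \bar R} then
    image_measure (lebesgue_rV m \x lebesgue_measure)%E (@measurable_rV_cons m)
  else dirac (0 : 'rV[R]_0).

Lemma measurable_punctured_ball n :
  measurable [set x : 'rV[R]_n | 0 < enorm x <= 1].
Proof.
rewrite (_ : mkset _ = @enorm n @^-1` `]0, 1]%classic); last first.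
  by apply/seteqP; split => x /=; rewrite in_itv.
by rewrite -[X in measurable X]setTI; exact: measurable_enorm.
Qed.

Definition sphere n : set 'rV[R]_n := [set x | enorm x = 1].

(* Surface measure of the unit sphere, by integration in polar coordinates:
   the cone {t y | 0 < t <= 1, y in A} over a part A of the sphere has volume
   \int_0^1 t^(n-1) dt = 1/n times the surface measure of A. *)
Definition surface_measure n : {measure set 'rV[R]_n -> \bar R} :=
  mscale n%:R%:nng
    (image_measure (mrestr (lebesgue_rV n) (@measurable_punctured_ball n))
                   (@measurable_radial n)).

Definition annulus n (rho : R) (r : \bar R) : set 'rV[R]_n :=
  [set x | (rho%:E <= (enorm x)%:E <= r)%E].

End euclidean.

Definition measure_support (R : realType) (T : topologicalType)
    (m : set T -> \bar R) : set T :=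
  [set x | forall U, open_nbhs x U -> (0 < m U)%E].

Section charge_integral.
Context d (T : measurableType d) (R : realType).
Implicit Type nu : {charge set T -> \bar R}.

Lemma hahn_ex nu :
  exists PN : set T * set T, hahn_decomposition nu PN.1 PN.2.
Proof. by have [P [N PN]] := Hahn_decomposition nu; exists (P, N). Qed.

Definition hahn nu : set T * set T := sval (cid (hahn_ex nu)).

Lemma hahnP nu : hahn_decomposition nu (hahn nu).1 (hahn nu).2.
Proof. exact: svalP (cid (hahn_ex nu)). Qed.

(* By Hahn_decomposition_uniq, these do not depend on the chosen Hahn
   decomposition (on measurable sets). *)
Definition charge_pos nu : {finite_measure set T -> \bar R} :=
  jordan_pos (hahnP nu).
Definition charge_neg nu : {finite_measure set T -> \bar R} :=
  jordan_neg (hahnP nu).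
Definition charge_total_variation nu : {measure set T -> \bar R} :=
  charge_variation (hahnP nu).

Definition cintegral nu (f : T -> R) : R :=
  \int[charge_pos nu]_x f x - \int[charge_neg nu]_x f x.

End charge_integral.

Section polynomials.
Context {R : realType} {d : nat}.

Definition peval (P : mpoly d R) (x : 'rV[R]_d) : R := meval (x ord0) P.

Definition laplacian (P : mpoly d R) : mpoly d R :=
  \sum_(i < d) mderiv i (mderiv i P).

Definition harmonic_homogeneous (k : nat) (P : mpoly d R) :=
  P \is ishomog1 k mdeg /\ laplacian P = 0.

(* For each k, Y k is a basis (every element of the space is a unique linear
   combination), orthonormal in L^2 of the unit sphere. *)
Definition orthonormal_harmonic_basis (a : nat -> nat)
    (Y : forall k, 'I_(a k) -> mpoly d R) :=
  forall k,
    [/\ forall l, harmonic_homogeneous k (Y k l),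
        forall P, harmonic_homogeneous k P ->
          exists! c : 'rV[R]_(a k), P = \sum_l c ord0 l *: Y k l
      & forall l l', \int[surface_measure d]_(x in @sphere R d)
          (peval (Y k l) x * peval (Y k l') x) = (l == l')%:R].

End polynomials.

Section pseudo_positive.
Context {R : realType} {d : nat} {a : nat -> nat}.
Variable Y : forall k, 'I_(a k) -> mpoly d R.
Implicit Types mu : {charge set 'rV[R]_d -> \bar R}.

Definition moment_measure mu :=
  forall P : mpoly d R,
    (charge_total_variation mu).-integrable setT (fun x => (peval P x)%:E).

(* Functions on [0, oo[ are functions on R considered on `[0, +oo[ only. *)
Definition pseudo_positive mu :=
  forall h : R -> R,
    {within `[0, +oo[, continuous h} ->
    (forall t, 0 <= t -> 0 <= h t) ->
    compact (closure (`[0, +oo[ `&` [set t | h t != 0])) ->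
    forall k (l : 'I_(a k)),
      0 <= cintegral mu (fun x => h (enorm x) * peval (Y l) x).

Definition polynomially_bounded (h : R -> R) :=
  exists (C : R) (N : nat), forall t, 0 <= t -> `|h t| <= C * (1 + t ^+ N).

(* A measure on [0, oo[ is a Borel measure m on R with m(]-oo, 0[) = 0. *)
Definition component_measure mu k (l : 'I_(a k))
    (m : {measure set R -> \bar R}) :=
  [/\ m `]-oo, 0[%classic = 0%E,
      forall n : nat, (\int[m]_(t in `[0%R, +oo[) (t ^+ n)%:E < +oo)%E
    & forall h : R -> R,
        {within `[0, +oo[, continuous h} -> polynomially_bounded h ->
        \int[m]_(t in `[0, +oo[) h t =
        cintegral mu (fun x => h (enorm x) * peval (Y l) x)].

End pseudo_positive.

(* Main.v *)
(* The Laplace-Fourier coefficients h |-> \int h(|x|) Y_{k,l}(x) dmu of mu are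
   integrals against positive measures m_{k,l} on the half line.  In the variable
   u = t^2, Gauss quadrature with s nodes replaces each m_{k,l} by at most s atoms
   w_t delta_t with the same moments of t^{2j}, j < 2s; by Almansi's expansion
   P = \sum_j |x|^{2j} H_j this preserves all integrals of polynomials with
   Delta^{2s} P = 0.  Since t^{-k} has divided differences of alternating sign in
   t^2, the quadrature of t^{-k} is at most \int t^{-k} dm_{k,l}, so the hypotheses
   on mu make the sum of the shells w_t t^{-k} Y_{k,l} dtheta on |x| = t converge:
   this is sigma, whose components are read off the orthonormality of the Y_{k,l}.
   Uniqueness: at most s + s atoms are determined by 2s moments, hence two solutions
   agree on all h(|x|) P(x), and these functions approximate indicators of boxes. *)
Require Import Defs.
From HB Require Import structures.
From mathcomp Require Import all_boot all_order all_algebra.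
From mathcomp Require Import all_classical all_reals all_analysis.
From mathcomp Require Import measurable_realfun.
From mathcomp.multinomials Require Import -(notations) mpoly.
From mathcomp Require Import ring lra zify.

Set Implicit Arguments.
Unset Strict Implicit.
Unset Printing Implicit Defensive.

Import Order.TTheory GRing.Theory Num.Theory.
Import numFieldNormedType.Exports.

Local Open Scope classical_set_scope.
Local Open Scope ring_scope.

(** * Integrals against measures and charges *)

(** Three points shape the construction. The [Y_{k,l}] change sign, so each shell has to be
    dominated in total variation: [|y| <= 1 + y^2] and the normalisation in L^2 bound
    [\int |Y_{k,l}| dtheta] independently of k and l, after which only the series of the numbers
    [w_t t^(N-k)] matters. For N < k the factor [t^(N-k)] is again an inverse power and the
    quadrature bound applies to it; for each N this leaves out finitely many degrees, and a bounded
    annulus asks for N = 0 only. The quadrature error has a sign because s Gauss nodes are exact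
    below degree 2s in u, hence on the interpolant of [t^-k] with every node doubled, whose error is
    a square times a nonnegative function. Finally, the basis is assumed orthonormal inside each
    degree; across degrees orthogonality comes from Green's identity. To stay with polynomials and
    Lebesgue measure, the identity is proved on the ball with the weight [(1 - |x|^2)^2], which
    leaves no boundary term, and is carried to the sphere by the independence of radius and
    direction. *)

Section measures.
Context d (T : measurableType d) (R : realType).
Implicit Types m : {measure set T -> \bar R}.
Local Open Scope ereal_scope.

Lemma le_measure_integrable m1 m2 (f : T -> \bar R) :
  (forall A, measurable A -> m1 A <= m2 A) ->
  m2.-integrable setT f -> m1.-integrable setT f.
Proof.
move=> m12 /integrableP[mf foo]; apply/integrableP; split=> //.
apply: le_lt_trans foo; apply: ge0_le_measure_integral => //.
exact: measurableT_comp.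
Qed.

Lemma integrable_measure_add m1 m2 (f : T -> \bar R) :
  m1.-integrable setT f -> m2.-integrable setT f ->
  (measure_add m1 m2).-integrable setT f.
Proof.
move=> /integrableP[mf foo1] /integrableP[_ foo2]; apply/integrableP; split=> //.
rewrite ge0_integral_measure_add//; last exact: measurableT_comp.
exact: lte_add_pinfty.
Qed.

Lemma measure_addE' m1 m2 A : measure_add m1 m2 A = m1 A + m2 A.
Proof. by rewrite /measure_add /msum 2!big_ord_recl big_ord0 adde0. Qed.

Lemma le_integrableR m (f g : T -> R) : measurable_fun setT f ->
  (forall x, `|f x| <= g x)%R -> m.-integrable setT (EFin \o g) ->
  m.-integrable setT (EFin \o f).
Proof.
move=> mf fg; apply: le_integrable => //; first exact/measurable_EFinP.
by move=> x _ /=; rewrite lee_fin (le_trans (fg x))// ler_norm.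
Qed.

Lemma bounded_integrable m (M : R) (f : T -> R) : m setT < +oo ->
  measurable_fun setT f -> (forall x, `|f x| <= M)%R ->
  m.-integrable setT (EFin \o f).
Proof.
move=> moo mf fM; apply: (@le_integrableR _ _ (cst M)) => //.
apply/integrableP; split; first exact/measurable_EFinP.
by rewrite /= integral_cst// lte_mul_pinfty// ?lee_fin.
Qed.

Lemma negligible_Rintegral m (N : set T) (f g : T -> R) : measurable N ->
  m N = 0 -> measurable_fun setT f -> measurable_fun setT g ->
  (forall x, ~ N x -> f x = g x) ->
  (\int[m]_x f x = \int[m]_x g x)%R.
Proof.
move=> mN N0 mf mg fg; congr fine; apply: ae_eq_integral => //.
- exact/measurable_EFinP.
- exact/measurable_EFinP.
exists N; split=> // x /= nfg; apply: contrapT => /fg fgx.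
by apply: nfg => _; rewrite fgx.
Qed.

Lemma negligible_integrable_eq m (N : set T) (f g : T -> R) : measurable N ->
  m N = 0 -> measurable_fun setT f -> measurable_fun setT g ->
  (forall x, ~ N x -> f x = g x) ->
  m.-integrable setT (EFin \o g) -> m.-integrable setT (EFin \o f).
Proof.
move=> mN N0 mf mg fg /integrableP[mg' goo].
apply/integrableP; split; first exact/measurable_EFinP.
rewrite (@ae_eq_integral _ _ _ m setT (abse \o (EFin \o g)))//.
- exact/measurableT_comp/measurable_EFinP.
- exact/measurableT_comp/measurable_EFinP.
exists N; split=> // x /= nfg; apply: contrapT => /fg fgx.
by apply: nfg => _; rewrite fgx.
Qed.

Lemma integrableRZ m (c : R) (f : T -> R) : m.-integrable setT (EFin \o f) ->
  m.-integrable setT (EFin \o (fun x => c * f x)%R).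
Proof. exact: integrableZl. Qed.

Lemma integrableRD m (f g : T -> R) : m.-integrable setT (EFin \o f) ->
  m.-integrable setT (EFin \o g) ->
  m.-integrable setT (EFin \o (fun x => f x + g x)%R).
Proof. exact: integrableD. Qed.

Lemma integrableR_sum m (I : Type) (s : seq I) (f : I -> T -> R) :
  (forall i, m.-integrable setT (EFin \o f i)) ->
  m.-integrable setT (EFin \o (fun x => \sum_(i <- s) f i x)%R).
Proof.
move=> fi; rewrite (_ : _ \o _ = (fun x => \sum_(j <- s) (f j x)%:E)).
  by apply: integrable_sum => // j _; exact: fi.
by apply/funext => x /=; rewrite sumEFin.
Qed.

Lemma Rintegral_sum m (I : Type) (s : seq I) (f : I -> T -> R) :
  (forall i, m.-integrable setT (EFin \o f i)) ->
  (\int[m]_x (\sum_(i <- s) f i x) = \sum_(i <- s) \int[m]_x f i x)%R.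
Proof.
move=> fi; elim: s => [|i s IH].
  by under eq_Rintegral do rewrite big_nil; rewrite Rintegral_cst// mul0r big_nil.
under eq_Rintegral do rewrite big_cons.
rewrite RintegralD//; first by rewrite IH big_cons.
exact: integrableR_sum.
Qed.

Lemma dominated_Rintegral m (f_ : nat -> T -> R) (f g : T -> R) :
  (forall n, measurable_fun setT (f_ n)) -> measurable_fun setT f ->
  (forall x, f_ ^~ x @ \oo --> f x) -> m.-integrable setT (EFin \o g) ->
  (forall n x, `|f_ n x| <= g x)%R ->
  (\int[m]_x f_ n x)%R @[n --> \oo] --> (\int[m]_x f x)%R.
Proof.
move=> mf_ mf cf ig fg.
have c x : (f_ n x)%:E @[n --> \oo] --> (f x)%:E by exact/cvg_EFin/cf/nearW.
have [fi _ ci] := @dominated_convergence _ _ _ m setT measurableT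
  (fun n x => (f_ n x)%:E) (EFin \o f) (EFin \o g)
  (fun n => (measurable_EFinP _ _).2 (mf_ n)) ((measurable_EFinP _ _).2 mf)
  (aeW _ (fun x _ => c x)) ig (aeW _ (fun x n _ => fg n x)).
apply: fine_cvg; rewrite fineK//.
exact: integrable_fin_num fi.
Qed.

End measures.

(** Turns an equality of differences into one of sums, which can be read as an identity between
    measures. *)
Lemma fin_num_subCA (R : realDomainType) (a b p n : \bar R) :
  a \is a fin_num -> b \is a fin_num -> p \is a fin_num -> n \is a fin_num ->
  (a - b = p - n -> p + b = a + n)%E.
Proof.
case: a => // a; case: b => // b; case: p => // p; case: n => // n _ _ _ _ [E].
by congr (_%:E); lra.
Qed.

Lemma ge0_sube_eq0 (R : realDomainType) (u v : \bar R) :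
  (0 <= u -> 0 <= v -> u - v = 0 -> u = v)%E.
Proof.
case: u => // [u|]; case: v => // v _ _ [uv]; congr (_%:E).
by apply/eqP; rewrite -subr_eq0 uv.
Qed.

Section charge_integrals.
Context d (T : measurableType d) (R : realType).
Implicit Types (nu : {charge set T -> \bar R}) (f g : T -> R).

Definition cintegrable nu f :=
  (charge_total_variation nu).-integrable setT (EFin \o f).

Lemma charge_total_variationE nu A :
  charge_total_variation nu A = (charge_pos nu A + charge_neg nu A)%E.
Proof. by []. Qed.

Lemma cintegrableP nu f : cintegrable nu f <->
  (charge_pos nu).-integrable setT (EFin \o f) /\
  (charge_neg nu).-integrable setT (EFin \o f).
Proof.
split=> [ifnu|[fp fn]].
  split; apply: (le_measure_integrable _ ifnu) => A _;
    rewrite charge_total_variationE.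
    exact: leeDl.
  exact: leeDr.
apply: (le_measure_integrable _ (integrable_measure_add fp fn)) => A mA.
by rewrite -[leRHS]/(measure_add (charge_pos nu) (charge_neg nu) A) measure_addE'.
Qed.

Lemma charge_decomp nu A : measurable A ->
  nu A = (charge_pos nu A - charge_neg nu A)%E.
Proof. by move=> mA; rewrite (jordan_decomp (hahnP nu) mA) /cadd/= cscaleN1. Qed.

Lemma cintegralD nu f g : cintegrable nu f -> cintegrable nu g ->
  cintegral nu (fun x => f x + g x) = cintegral nu f + cintegral nu g.
Proof.
move=> /cintegrableP[fp fn] /cintegrableP[gp gn].
by rewrite /cintegral !RintegralD// opprD addrACA.
Qed.

Lemma cintegralZ nu c f : cintegrable nu f ->
  cintegral nu (fun x => c * f x) = c * cintegral nu f.
Proof.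
by move=> /cintegrableP[fp fn]; rewrite /cintegral !RintegralZl// mulrBr.
Qed.

Lemma cintegrableZ nu c f : cintegrable nu f -> cintegrable nu (fun x => c * f x).
Proof. exact: integrableZl. Qed.

Lemma bounded_cintegrable nu (M : R) f : measurable_fun setT f ->
  (forall x, `|f x| <= M) -> cintegrable nu f.
Proof.
move=> mf fM; apply: (bounded_integrable _ mf fM).
by rewrite charge_total_variationE lte_add_pinfty// ltey_eq fin_num_measure.
Qed.

Section difference.
Variables (m1 m2 : {finite_measure set T -> \bar R}).

Definition charge_diff : {charge set T -> \bar R} :=
  cadd (charge_of_finite_measure m1) (copp (charge_of_finite_measure m2)).

Lemma charge_diffE A : charge_diff A = (m1 A - m2 A)%E.
Proof. by []. Qed.

Variable nu : {charge set T -> \bar R}.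
Hypothesis nuE : forall A, measurable A -> nu A = (m1 A - m2 A)%E.

(** The Jordan decomposition is the smallest one: on the positive Hahn set the charge is at most
    [m1], because [m2] is nonnegative. *)
Lemma charge_pos_le A : measurable A -> (charge_pos nu A <= m1 A)%E.
Proof.
move=> mA; have [[mP _] _ _ _] := hahnP nu.
have -> : charge_pos nu A = nu (A `&` (hahn nu).1).
  by rewrite /= /charge_pos jordan_posE /= /crestr0 mem_set.
have mAP : measurable (A `&` (hahn nu).1) by exact: measurableI.
rewrite nuE// (@le_trans _ _ (m1 (A `&` (hahn nu).1)))//.
  by rewrite leeBlDr ?leeDl// fin_num_measure.
by rewrite le_measure ?inE.
Qed.

Lemma charge_neg_le A : measurable A -> (charge_neg nu A <= m2 A)%E.
Proof.
move=> mA.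
have := charge_decomp nu mA; rewrite nuE// => E.
have := charge_pos_le mA.
have : charge_neg nu A \is a fin_num by exact: fin_num_measure.
have : charge_pos nu A \is a fin_num by exact: fin_num_measure.
have : m1 A \is a fin_num by exact: fin_num_measure.
have : m2 A \is a fin_num by exact: fin_num_measure.
move: E; case: (m1 A) => // a1; case: (m2 A) => // a2.
case: (charge_pos nu A) => // p; case: (charge_neg nu A) => // n.
by move=> [E] _ _ _ _; rewrite !lee_fin; lra.
Qed.

Lemma charge_diff_cintegrable f : m1.-integrable setT (EFin \o f) ->
  m2.-integrable setT (EFin \o f) -> cintegrable nu f.
Proof.
move=> f1 f2; apply/cintegrableP; split.
  by apply: le_measure_integrable f1 => A; exact: charge_pos_le.
by apply: le_measure_integrable f2 => A; exact: charge_neg_le.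
Qed.

(** The integral may be computed from any decomposition, not only the Jordan one:
    [charge_pos nu + m2] and [m1 + charge_neg nu] are the same measure, and all four integrals are
    finite. *)
Lemma cintegral_diff f : m1.-integrable setT (EFin \o f) ->
  m2.-integrable setT (EFin \o f) ->
  cintegral nu f = \int[m1]_x f x - \int[m2]_x f x.
Proof.
move=> f1 f2; have /cintegrableP[fp fn] := charge_diff_cintegrable f1 f2.
rewrite /cintegral.
have : (\int[measure_add (charge_pos nu) m2]_x (f x)%:E =
        \int[measure_add m1 (charge_neg nu)]_x (f x)%:E)%E.
  apply: eq_measure_integral => A mA _.
  change (measure_add (charge_pos nu) m2 A = measure_add m1 (charge_neg nu) A).
  rewrite !measure_addE'; apply: fin_num_subCA; try exact: fin_num_measure.
  by rewrite -nuE// charge_decomp.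
rewrite !integral_measure_add// /Rintegral.
have := integrable_fin_num measurableT fp.
have := integrable_fin_num measurableT fn.
have := integrable_fin_num measurableT f1.
have := integrable_fin_num measurableT f2.
rewrite /comp.
case: (\int[charge_pos nu]_x (f x)%:E)%E => // p.
case: (\int[charge_neg nu]_x (f x)%:E)%E => // n.
case: (\int[m1]_x (f x)%:E)%E => // a1; case: (\int[m2]_x (f x)%:E)%E => // a2.
by move=> _ _ _ _ [E] /=; lra.
Qed.

End difference.
End charge_integrals.

(** * Measures with a density *)

Section density.
Context d (T : measurableType d) (R : realType).
Variables (m : {measure set T -> \bar R}) (g : T -> R).
Hypotheses (mg : measurable_fun setT g) (g0 : forall x, 0 <= g x).
Local Open Scope ereal_scope.

(** The two proofs are arguments because the measure structure below is declared on this term. *)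
Definition density of measurable_fun setT g & (forall x, (0 <= g x)%R) :=
  fun A : set T => \int[m]_(x in A) (g x)%:E.

Local Notation nu := (density mg g0).

Let density0 : nu set0 = 0. Proof. exact: integral_set0. Qed.

Let density_ge0 A : 0 <= nu A.
Proof. by apply: integral_ge0 => x _; rewrite lee_fin. Qed.

Let mEg : measurable_fun setT (EFin \o g). Proof. exact/measurable_EFinP. Qed.

Let density_additive : semi_sigma_additive nu.
Proof. by apply: (semi_sigma_additive_nng_induced mEg) => x; rewrite lee_fin. Qed.

HB.instance Definition _ := measure_function.isMeasure.Build _ _ _ nu
  density0 density_ge0 density_additive.

Import HBNNSimple.

(** Both sides are monotone limits along an approximation of [f] by simple functions, which reduces
    the identity to indicators. *)
Lemma ge0_integral_density (f : T -> \bar R) : (forall x, 0 <= f x) ->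
  measurable_fun setT f -> \int[nu]_x f x = \int[m]_x (f x * (g x)%:E).
Proof.
move=> f0 mf; pose h := nnsfun_approx measurableT mf.
have hnd x : nondecreasing_seq ((EFin \o h ^~ x) : nat -> \bar R).
  by move=> a b ab; rewrite lee_fin; exact/lefP/nd_nnsfun_approx.
have hf x : (h n x)%:E @[n --> \oo] --> f x by exact: cvg_nnsfun_approx.
have mh n : measurable_fun setT (EFin \o h n) by exact/measurable_EFinP.
transitivity (limn (fun n => \int[nu]_x (h n x)%:E)).
  rewrite -monotone_convergence//; last 2 first.
  - by move=> n x _; rewrite lee_fin.
  - by move=> x _; exact: hnd.
  by apply: eq_integral => x _; apply/esym/cvg_lim => //; exact: hf.
transitivity (limn (fun n => \int[m]_x ((h n x)%:E * (g x)%:E))); last first.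
  rewrite -monotone_convergence//; last 3 first.
  - by move=> n; apply: emeasurable_funM; [exact: mh|exact: mEg].
  - by move=> n x _; rewrite mule_ge0 ?lee_fin.
  - by move=> x _ a b ab; rewrite lee_wpmul2r ?lee_fin//; exact: hnd.
  apply: eq_integral => x _; apply/cvg_lim => //.
  by apply: cvgeZr => //; exact: hf.
congr (limn _); apply/funext => n.
have hE x : (h n x)%:E = \sum_(y \in range (h n)) (y * \1_(h n @^-1` [set y]) x)%:E.
  by rewrite fsumEFin// -fimfunE.
transitivity (\int[nu]_x
    (\sum_(y \in range (h n)) (y * \1_(h n @^-1` [set y]) x)%:E)).
  by apply: eq_integral => x _; exact: hE.
transitivity (\int[m]_x
    (\sum_(y \in range (h n)) (y * \1_(h n @^-1` [set y]) x)%:E * (g x)%:E));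
    last first.
  apply: eq_integral => x _; rewrite hE ge0_mule_fsuml// => y.
  exact: nnfun_muleindic_ge0.
have mi y : measurable_fun setT (fun x => (y * \1_(h n @^-1` [set y]) x)%:E).
  exact/measurable_EFinP/measurable_funM.
rewrite !ge0_integral_fsum//; last 3 first.
- by move=> y; apply: emeasurable_funM; [exact: mi|exact: mEg].
- by move=> y x _; rewrite mule_ge0 ?nnfun_muleindic_ge0 ?lee_fin.
- by move=> y x _; exact: nnfun_muleindic_ge0.
apply: eq_fsbigr => y /set_mem[x0 _ yE].
have y0 : (0 <= y)%R by rewrite -yE.
have mA : measurable (h n @^-1` [set y]) by [].
under eq_integral do rewrite EFinM.
under [RHS]eq_integral do rewrite EFinM -muleA.
have mI : measurable_fun setT (fun x => (\1_(h n @^-1` [set y]) x : R)%:E).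
  exact/measurable_EFinP.
rewrite !ge0_integralZl//; last 2 first.
- by apply: emeasurable_funM; [exact: mI|exact: mEg].
- by move=> x _; rewrite mule_ge0 ?lee_fin.
rewrite integral_indic// setIT; congr (_ * _); rewrite [LHS]integral_mkcond.
by apply: eq_integral => x _; rewrite epatch_indic muleC.
Qed.

Lemma integrable_density (f : T -> R) : measurable_fun setT f ->
  m.-integrable setT (EFin \o (fun x => f x * g x)%R) ->
  nu.-integrable setT (EFin \o f).
Proof.
move=> mf /integrableP[_ fgoo]; apply/integrableP; split; first exact/measurable_EFinP.
rewrite ge0_integral_density//; last exact/measurableT_comp/measurable_EFinP.
move: fgoo; congr (_ < _); apply: eq_integral => x _ /=.
by rewrite -EFinM normrM (ger0_norm (g0 x)).
Qed.

(** Multiplication by [g >= 0] commutes with taking positive and negative parts, so the nonnegative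
    case applies to each. *)
Lemma Rintegral_density (f : T -> R) : measurable_fun setT f ->
  m.-integrable setT (EFin \o (fun x => f x * g x)%R) ->
  (\int[nu]_x f x = \int[m]_x (f x * g x))%R.
Proof.
move=> mf ifg; have inf := integrable_density mf ifg.
rewrite /Rintegral; congr fine; rewrite [LHS]integralE [RHS]integralE.
have mEf : measurable_fun setT (EFin \o f) by exact/measurable_EFinP.
rewrite !ge0_integral_density//; [|exact: measurable_funeneg|exact: measurable_funepos].
congr (_ - _); apply: eq_integral => x _.
  rewrite !funeposE /= -EFin_max -EFinM -EFin_max; congr (_%:E).
  by rewrite maxr_pMl// mul0r.
rewrite !funenegE /= -EFin_max -EFinM -EFin_max; congr (_%:E).
by rewrite maxr_pMl// mul0r mulNr.
Qed.

End density.

Section measure_images.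

Lemma Rintegral_image_measure d d' (T : measurableType d) (T' : measurableType d')
    (R : realType) (m : {measure set T -> \bar R}) (phi : T -> T')
    (mphi : measurable_fun setT phi) (f : T' -> R) :
  measurable_fun setT f -> m.-integrable setT (EFin \o (f \o phi)) ->
  (image_measure m mphi).-integrable setT (EFin \o f) /\
  \int[image_measure m mphi]_x f x = \int[m]_x f (phi x).
Proof.
move=> mf fi; have mEf : measurable_fun setT (EFin \o f) by exact/measurable_EFinP.
split; first exact: integrable_pushforward.
by congr fine; rewrite integral_pushforward.
Qed.

Lemma Rintegral_mscale d (T : measurableType d) (R : realType)
    (m : {measure set T -> \bar R}) (k : {nonneg R}) (f : T -> R) :
  m.-integrable setT (EFin \o f) ->
  (mscale k m).-integrable setT (EFin \o f) /\
  \int[mscale k m]_x f x = k%:num * \int[m]_x f x.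
Proof.
move=> fi; have /integrableP[mf foo] := fi.
have kfi : (mscale k m).-integrable setT (EFin \o f).
  apply/integrableP; split=> //; rewrite ge0_integral_mscale//.
    by rewrite lte_mul_pinfty.
  exact: measurableT_comp.
split=> //; rewrite /Rintegral integralE [X in _ = _ * fine X]integralE.
rewrite !ge0_integral_mscale//; last 2 first.
- exact: measurable_funeneg.
- exact: measurable_funepos.
have := integrable_pos_fin_num measurableT fi.
have := integrable_neg_fin_num measurableT fi.
rewrite /comp; set A := integral _ _ _; set B := integral _ _ _.
by case: A => // A; case: B => // B _ _ /=; rewrite mulrBr.
Qed.

End measure_images.

(** * Polyharmonic polynomials *)

Section almansi.
Context {R : realType} {d : nat}.
Implicit Types P Q H : mpoly d R.

Lemma laplacian_is_linear : linear (@laplacian R d).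
Proof.
move=> c P Q; rewrite /laplacian scaler_sumr -big_split /=.
by apply: eq_bigr => i _; rewrite !(linearP, linearD, linearZ).
Qed.

HB.instance Definition _ := GRing.isLinear.Build R (mpoly d R) (mpoly d R) _
  (@laplacian R d) laplacian_is_linear.

Lemma iter_laplacian_is_linear n : linear (iter n (@laplacian R d)).
Proof. by move=> c P Q; elim: n => //= n ->; rewrite linearP. Qed.

HB.instance Definition _ n := GRing.isLinear.Build R (mpoly d R) (mpoly d R) _
  (iter n (@laplacian R d)) (iter_laplacian_is_linear n).

Definition norm_sq_poly : mpoly d R := \sum_(i < d) mpolyX R (mnm1 i) ^+ 2.

Lemma mderiv_var (i j : 'I_d) : mderiv i (mpolyX R (mnm1 j)) = (i == j)%:R.
Proof.
rewrite mderivX mnm1E eq_sym; case: eqVneq => [->|_]; last by rewrite scale0r.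
rewrite scale1r (_ : mnm_sub _ _ = mnm0) ?mpolyX0//.
by apply/mnmP => k; rewrite !mnmE subnn.
Qed.

Lemma mderiv_norm_sq i : mderiv i norm_sq_poly = mpolyX R (mnm1 i) *+ 2.
Proof.
rewrite linear_sum /= (bigD1 i)//= big1 => [|j ji].
  by rewrite expr2 mderivM mderiv_var eqxx mulr1 mul1r addr0 mulr2n.
by rewrite expr2 mderivM mderiv_var eq_sym (negbTE ji) mul0r mulr0 addr0.
Qed.

Lemma msupp_homog k P : P \is ishomog1 k mdeg ->
  {in msupp P, forall m : multinom d, (\sum_i m i)%N = k}.
Proof. by move=> /dhomogP hP m /hP <-; rewrite -mdegE. Qed.

Lemma euler k P : P \is ishomog1 k mdeg ->
  \sum_(i < d) mpolyX R (mnm1 i) * mderiv i P = k%:R *: P.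
Proof.
move=> /msupp_homog hP; rewrite [in RHS](mpolyE P) scaler_sumr.
rewrite [X in \sum_(i < d) _ * mderiv i X](mpolyE P).
under eq_bigr do rewrite linear_sum mulr_sumr.
rewrite exchange_big /=; apply: eq_big_seq => m /hP <-.
under eq_bigr do rewrite linearZ/= mderivX -!scalerAr.
rewrite -scaler_sumr scalerA mulrC -scalerA; congr (_ *: _).
rewrite natr_sum scaler_suml; apply: eq_bigr => i _.
(* The exponent [m i - 1] is truncated at [m i = 0], where the coefficient vanishes anyway. *)
case: (posnP (m i)) => [->|mi0]; first by rewrite !scale0r.
rewrite -mpolyXD (_ : mnm_add _ _ = m)//.
apply/mnmP => j; rewrite !mnmE; case: eqVneq => [<-|_]; last by rewrite subn0.
by rewrite addnC subnK.
Qed.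

(** The cross term of the product rule is four times the Euler field applied to [P], which
    multiplies a homogeneous polynomial by its degree. *)
Lemma laplacianM_norm_sq k P : P \is ishomog1 k mdeg ->
  laplacian (norm_sq_poly * P) =
  (2 * d + 4 * k)%:R *: P + norm_sq_poly * laplacian P.
Proof.
move=> hP.
transitivity (\sum_(i < d) (2%:R *: P +
    4%:R *: (mpolyX R (mnm1 i) * mderiv i P) +
    norm_sq_poly * mderiv i (mderiv i P))).
  apply: eq_bigr => i _; rewrite mderivM mderiv_norm_sq linearD/= !mderivM.
  rewrite mderiv_norm_sq.
  rewrite !mulrnAl !scaler_nat.
  rewrite linearMn/= mderiv_var eqxx mulrnAl mul1r.
  rewrite -!addrA; congr (_ + _); rewrite !addrA.
transitivity (\sum_(i < d) 2%:R *: P +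
    \sum_(i < d) 4%:R *: (mpolyX R (mnm1 i) * mderiv i P) +
    \sum_(i < d) norm_sq_poly * mderiv i (mderiv i P)).
  by rewrite !big_split.
rewrite -mulr_sumr sumr_const card_ord -scaler_sumr (euler hP) scalerA -natrM.
have -> : (2 * d + 4 * k)%:R *: P = 2%:R *: P *+ d + (4 * k)%:R *: P.
  by rewrite natrD scalerDl; congr (_ + _); rewrite natrM mulrC -scalerA scaler_nat.
by [].
Qed.

Lemma norm_sq_homog : norm_sq_poly \is ishomog1 2 mdeg.
Proof.
apply: rpred_sum => i _; rewrite expr2.
by apply: (@dhomogM _ _ _ 1 _ 1); rewrite dhomogX; apply/eqP/mdeg1.
Qed.

Lemma norm_sq_powM_homog j k P : P \is ishomog1 k mdeg ->
  norm_sq_poly ^+ j * P \is ishomog1 (2 * j + k) mdeg.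
Proof. by move=> hP; apply: dhomogM => //; apply/dhomogMn/norm_sq_homog. Qed.

(* Only the value [c 0 = 0] and the positivity of the other constants matter. *)
Lemma laplacian_norm_sq_pow (k : nat) : (0 < d)%N ->
  exists c : nat -> R, [/\ c 0%N = 0, forall j, 0 < c j.+1 &
   forall j P, harmonic_homogeneous k P ->
    laplacian (norm_sq_poly ^+ j * P) =
    c j *: (norm_sq_poly ^+ j.-1 * P)].
Proof.
(* The i-th summand is the factor picked up when one more |x|^2 multiplies a polynomial of degree 2i
   + k; the sum is 2j(2j + 2k + d - 2). *)
move=> d0; exists (fun j => \sum_(i < j) (2 * d + 4 * (2 * i + k))%:R).
split=> [|j|j P [hP lP]]; first by rewrite big_ord0.
  by rewrite -natr_sum ltr0n big_ord_recr /=; case: (d) d0 => // d' _; rewrite !addn_gt0 orbT.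
elim: j => [|j IH]; first by rewrite expr0 mul1r lP big_ord0 scale0r.
rewrite exprS -mulrA (laplacianM_norm_sq (norm_sq_powM_homog _ hP)) IH.
rewrite big_ord_recr /= scalerDl addrC -scalerAr; congr (_ + _).
case: j {IH} => [|j]; first by rewrite big_ord0 !scale0r.
by rewrite mulrA -exprS.
Qed.

Lemma iter_laplacian_norm_sq_pow n j k P : (0 < d)%N ->
  harmonic_homogeneous k P -> (j < n)%N ->
  iter n laplacian (norm_sq_poly ^+ j * P) = 0.
Proof.
move=> d0 hP; have [c [c0 _ cE]] := laplacian_norm_sq_pow k d0.
elim: n j => // n IH j jn; rewrite iterSr cE// linearZ/=.
case: j jn => [|j] jn; first by rewrite c0 scale0r.
by rewrite IH ?scaler0.
Qed.

Lemma laplacian_homog k P : P \is ishomog1 k mdeg ->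
  laplacian P \is ishomog1 k.-2 mdeg.
Proof.
have dh i l Q : Q \is ishomog1 l mdeg -> mderiv i Q \is ishomog1 l.-1 mdeg.
  move=> /dhomogP hQ; rewrite (mpolyE Q) linear_sum big_seq.
  apply: rpred_sum => m /hQ <-; rewrite linearZ/= mderivX scalerA.
  case: (posnP (m i)) => [->|mi0]; first by rewrite mulr0 scale0r rpred0.
  rewrite rpredZ// dhomogX; apply/eqP/succn_inj.
  rewrite prednK; last by rewrite mdegE (bigD1 i)//= addn_gt0 mi0.
  rewrite -addn1 -(mdeg1 i) -mdegD; congr mdeg.
  apply/mnmP => j; rewrite !mnmE; case: eqVneq => [<-|_]; last by rewrite subn0 addn0.
  by rewrite subnK.
by move=> hP; apply: rpred_sum => i _; apply/dh/dh.
Qed.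

Lemma laplacian_homog_lt2 k P : (k < 2)%N -> P \is ishomog1 k mdeg ->
  laplacian P = 0.
Proof.
move=> k2 /msupp_homog hP; rewrite [P]mpolyE linear_sum big1_seq//= => m /hP mk.
rewrite linearZ/= /laplacian big1 ?scaler0// => i _; rewrite mderivX linearZ/=.
rewrite mderivX scalerA.
have mi : (m i <= 1)%N.
  by rewrite -ltnS (leq_trans _ k2)// ltnS -mk (bigD1 i)//= leq_addr.
rewrite !mnmE eqxx -natrM (_ : (_ * _)%N = 0%N) ?scale0r//.
by case: (m i) mi => [|[|]].
Qed.

(** The Laplacian lowers degrees by two, so the part of degree k - 2 of [laplacian P] comes from the
    part of degree k alone. Truncated subtraction merges the degrees 0, 1 and 2, which is why
    degrees below 2 are treated apart. *)
Lemma laplacian_pihomog k P : laplacian P = 0 -> laplacian (pihomog mdeg k P) = 0.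
Proof.
move=> lP; have [k2|k2] := ltnP k 2.
  by rewrite (laplacian_homog_lt2 k2)// pihomogP.
rewrite -(pihomog_dE (laplacian_homog (pihomogP mdeg k P))).
set N := mmeasure mdeg P.
have S : \sum_(e < N) pihomog mdeg k.-2 (laplacian (pihomog mdeg e P)) = 0.
  rewrite -(raddf_sum (pihomog mdeg k.-2)) -(raddf_sum (@laplacian R d)).
  pose F Q := pihomog mdeg k.-2 (laplacian Q).
  apply: etrans (congr1 F (esym (pihomog_partitionE (leqnn N)))) _.
  by rewrite /F lP pihomog0.
have [kN|kN] := ltnP k N; last first.
  suff -> : pihomog mdeg k P = 0 by rewrite (raddf0 (@laplacian R d)) pihomog0.
  rewrite (pihomog_partitionE (leqnn N)) raddf_sum big1// => i _.
  apply: (@pihomog_ne0 _ _ _ i); last exact: pihomogP.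
  by rewrite neq_ltn (leq_trans (ltn_ord i) kN).
move: S; rewrite (bigD1 (Ordinal kN))//= big1 ?addr0// => i ik.
have [i2|i2] := ltnP i 2.
  by rewrite (laplacian_homog_lt2 i2) ?pihomog0// pihomogP.
apply: (@pihomog_ne0 _ _ _ i.-2); last exact/laplacian_homog/pihomogP.
apply: contraNneq ik => ik; apply/eqP/val_inj => /=.
by case: (nat_of_ord i) i2 ik => [|[|]]// ? _; case: (k) k2 => [|[|]]//= ? _ ->.
Qed.

(* Almansi's expansion [P = \sum_(j < n) |x|^2j H_j], as an induction principle. *)
Lemma polyharmonic_ind n (S : mpoly d R -> Prop) : (0 < d)%N ->
  (forall c P Q, S P -> S Q -> S (c *: P + Q)) ->
  (forall j k H, (j < n)%N -> harmonic_homogeneous k H ->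
     S (norm_sq_poly ^+ j * H)) ->
  S 0 -> forall P, iter n laplacian P = 0 -> S P.
Proof.
move=> d0 SD SH S0 P nP.
suff: exists s : seq (R * nat * mpoly d R),
    {in s, forall x, (x.1.2 < n)%N /\ exists k, harmonic_homogeneous k x.2} /\
    P = \sum_(x <- s) x.1.1 *: (norm_sq_poly ^+ x.1.2 * x.2).
  case=> s [hs ->]; elim: s hs => [|x s IH] hs; first by rewrite big_nil.
  rewrite big_cons; apply: SD; last first.
    by apply: IH => y ys; apply: hs; rewrite inE ys orbT.
  by have [xn [k xk]] := hs _ (mem_head _ _); exact: SH xk.
move: nP {SD SH S0 S}; elim: n P => [|n IH] P.
  by move=> /= ->; exists [::]; rewrite big_nil.
rewrite iterSr => /IH[s [hs lP]].
(* A preimage of [laplacian P] under the Laplacian: each exponent j becomes j + 1 and the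
   coefficient is divided by the constant that the Laplacian produces there. [P] minus this preimage
   is harmonic and splits into its homogeneous parts. *)
have [t [ht [tE tP]]] : exists t : seq (R * nat * mpoly d R),
    {in t, forall x, (x.1.2 < n.+1)%N /\ exists k, harmonic_homogeneous k x.2} /\
    laplacian (\sum_(x <- t) x.1.1 *: (norm_sq_poly ^+ x.1.2 * x.2)) = laplacian P /\
    True.
  rewrite {}lP; elim: s hs => [|[[a j] H] s IHs] hs.
    by exists [::]; split=> //; rewrite !big_nil linear0.
  have [|t [ht [tE _]]] := IHs; first by move=> x xs; apply: hs; rewrite inE xs orbT.
  have /= [jn [k hH]] := hs _ (mem_head _ _).
  have [c [_ c0 cE]] := laplacian_norm_sq_pow k d0.
  exists ((a / c j.+1, j.+1, H) :: t); split; last first.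
    rewrite !big_cons linearD/= tE linearZ/= cE// scalerA divfK//.
    by rewrite gt_eqF.
  by move=> x; rewrite inE => /orP[/eqP -> /=|/ht//]; split=> //; exists k.
move: tE {tP}; set T := \sum_(x <- t) _ => tE.
have lQ : laplacian (P - T) = 0 by rewrite linearB/= tE subrr.
exists ([seq (1, 0%N, pihomog mdeg i (P - T)) | i <- iota 0 (mmeasure mdeg (P - T))] ++ t).
split=> [x|].
  rewrite mem_cat => /orP[/mapP[i _ ->]|/ht//] /=; split=> //.
  by exists i; split; [exact: pihomogP|exact: laplacian_pihomog].
rewrite big_cat /= big_map -/T -[X in _ = X + _]/(\sum_(i <- iota 0 _) _).
rewrite -[LHS](subrK T).
congr (_ + _); rewrite [LHS](pihomog_partitionE (leqnn (mmeasure mdeg _))).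
rewrite -[in RHS](subn0 (mmeasure _ _)) big_mkord.
by apply: eq_bigr => i _; rewrite scale1r expr0 mul1r.
Qed.

(** Makes Almansi's expansion available for every polynomial, as the uniqueness proof requires; each
    Laplacian lowers the degree of a homogeneous part by two. *)
Lemma exists_iter_laplacian0 P : exists n, iter n laplacian P = 0.
Proof.
have h k n Q : Q \is ishomog1 k mdeg -> (k < 2 * n)%N -> iter n laplacian Q = 0.
  elim: n k Q => [|n IH] k Q hQ; first by rewrite muln0.
  have [k2 _|k2 kn] := ltnP k 2; rewrite iterSr.
    by rewrite (laplacian_homog_lt2 k2 hQ) linear0.
  apply: (IH k.-2); first exact: laplacian_homog.
  by rewrite mulnS in kn; case: k k2 kn {hQ} => [|[|]].
exists (mmeasure mdeg P); rewrite {2}(pihomog_partitionE (leqnn (mmeasure mdeg P))).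
rewrite linear_sum big1// => i _; apply: (h i); first exact: pihomogP.
by rewrite (leq_trans (ltn_ord i))// leq_pmull.
Qed.

Lemma peval_norm_sq x : peval norm_sq_poly x = enorm x ^+ 2.
Proof.
rewrite sqr_sqrtr; last by apply: sumr_ge0 => i _; exact: sqr_ge0.
rewrite /peval raddf_sum; apply: eq_bigr => i _.
by rewrite /= expr2 mevalM mevalXU.
Qed.

Lemma peval_scale k P (c : R) x : P \is ishomog1 k mdeg ->
  peval P (c *: x) = c ^+ k * peval P x.
Proof.
move=> /msupp_homog hP; rewrite [P]mpolyE /peval !raddf_sum mulr_sumr.
apply: eq_big_seq => m /hP mk; rewrite /= !mevalZ mulrCA; congr (_ * _).
rewrite !mevalX -mk (big_morph (fun n => c ^+ n) (exprD c) (expr0 c)) -big_split.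
by apply: eq_bigr => i _ /=; rewrite mxE exprMn.
Qed.

Lemma pevalD P Q x : peval (P + Q) x = peval P x + peval Q x.
Proof. exact: mevalD. Qed.

Lemma pevalM P Q x : peval (P * Q) x = peval P x * peval Q x.
Proof. exact: mevalM. Qed.

Lemma pevalZ c P x : peval (c *: P) x = c * peval P x.
Proof. exact: mevalZ. Qed.

Lemma pevalXn n P x : peval (P ^+ n) x = peval P x ^+ n.
Proof. exact: (rmorphXn (meval (x ord0))). Qed.

Lemma peval_norm_sq_powM j P x :
  peval (norm_sq_poly ^+ j * P) x = enorm x ^+ (2 * j) * peval P x.
Proof. by rewrite pevalM pevalXn peval_norm_sq -exprM. Qed.

End almansi.

(** * Polar coordinates and orthogonality on the sphere *)

Section euclidean_norm.
Context {R : realType} {n : nat}.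
Implicit Types (x : 'rV[R]_n) (c : R).

Lemma enorm_ge0 x : 0 <= enorm x. Proof. exact: sqrtr_ge0. Qed.

Lemma enorm_sqr x : enorm x ^+ 2 = \sum_i x ord0 i ^+ 2.
Proof. by rewrite sqr_sqrtr// sumr_ge0// => i _; exact: sqr_ge0. Qed.

Lemma coord_le_enorm x i : `|x ord0 i| <= enorm x.
Proof.
rewrite -sqrtr_sqr ler_sqrt; last by rewrite sumr_ge0// => j _; exact: sqr_ge0.
by rewrite (bigD1 i)//= lerDl sumr_ge0// => j _; exact: sqr_ge0.
Qed.

Lemma enorm0 : enorm (0 : 'rV[R]_n) = 0.
Proof. by rewrite /enorm big1 ?sqrtr0// => i _; rewrite mxE expr0n. Qed.

Lemma enorm_eq0 x : (enorm x == 0) = (x == 0).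
Proof.
apply/eqP/eqP => [x0|->]; last exact: enorm0.
apply/rowP => i; rewrite mxE; apply/eqP; rewrite -normr_le0 -x0.
exact: coord_le_enorm.
Qed.

Lemma enorm_gt0 x : (0 < enorm x) = (x != 0).
Proof. by rewrite lt_neqAle enorm_ge0 andbT eq_sym enorm_eq0. Qed.

Lemma enormZ c x : enorm (c *: x) = `|c| * enorm x.
Proof.
rewrite /enorm -sqrtr_sqr -sqrtrM ?sqr_ge0// mulr_sumr; congr Num.sqrt.
by apply: eq_bigr => i _; rewrite mxE exprMn.
Qed.

Lemma enorm_radial x : x != 0 -> enorm (radial x) = 1.
Proof.
by move=> x0; rewrite /radial enormZ normfV ger0_norm ?enorm_ge0// mulVf ?enorm_eq0.
Qed.

Lemma enorm_radial_le1 x : enorm (radial x) <= 1.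
Proof.
have [->|/enorm_radial->//] := eqVneq x 0.
by rewrite /radial scaler0 enorm0.
Qed.

Lemma radialZ c x : 0 < c -> radial (c *: x) = radial x.
Proof.
move=> c0; rewrite /radial enormZ gtr0_norm// scalerA invfM mulrAC.
by rewrite mulVf ?gt_eqF// mul1r.
Qed.

Lemma enorm_radialK x : enorm x *: radial x = x.
Proof.
have [->|x0] := eqVneq x 0; first by rewrite /radial !scaler0.
by rewrite /radial scalerA divff ?enorm_eq0// scale1r.
Qed.

Lemma enorm_continuous : continuous (@enorm R n).
Proof.
move=> x; apply: continuous_comp; last exact: sqrt_continuous.
apply: (continuous_big (op := +%R)) => [|i _ y]; first exact: add_continuous.
exact: (cvg_comp _ _ (@coord_continuous R 1 n ord0 i y) (@exprn_continuous R 2 _)).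
Qed.

End euclidean_norm.

(** * Lebesgue measure on R^n: slicing and scaling *)

Section lebesgue_rV.
Context {R : realType}.
Local Open Scope ereal_scope.

Definition cube n (M : R) : set 'rV[R]_n := [set x | forall i, (`|x ord0 i| <= M)%R].

Arguments cube : clear implicits.

Lemma measurable_cube n M : measurable (cube n M).
Proof.
have -> : cube n M = \bigcap_(i in [set: 'I_n])
    ((fun x : 'rV[R]_n => x ord0 i) @^-1` `[(- M)%R, M]%classic).
  by apply/seteqP; split=> [x xM i _|x xM i] /=;
    [rewrite in_itv /= -ler_norml|have := xM i I; rewrite /= in_itv /= -ler_norml].
apply: fin_bigcap_measurable => // i _; rewrite -[X in measurable X]setTI.
exact: measurable_coord.
Qed.

Lemma rV_cons0 n (p : 'rV[R]_n * R) : rV_cons p ord0 ord0 = p.2.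
Proof. by rewrite mxE unlift_none. Qed.

Lemma rV_consS n (p : 'rV[R]_n * R) i : rV_cons p ord0 (lift ord0 i) = p.1 ord0 i.
Proof. by rewrite mxE liftK. Qed.

Lemma lebesgue_rV_cube n M : lebesgue_rV n (cube n M) < +oo.
Proof.
elim: n => [|n IH].
  by rewrite /= /dirac indicE; case: (_ \in _); rewrite ltry.
have -> : lebesgue_rV n.+1 (cube n.+1 M) =
    (lebesgue_rV n \x lebesgue_measure) (@rV_cons R n @^-1` cube n.+1 M) by [].
have -> : @rV_cons R n @^-1` cube n.+1 M = cube n M `*` `[(- M)%R, M]%classic.
  apply/seteqP; split=> [[y t] /= yM|[y t] [/= yM]].
    split=> /= [i|]; first by have := yM (lift ord0 i); rewrite rV_consS.
    by rewrite in_itv /= -ler_norml; have := yM ord0; rewrite rV_cons0.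
  rewrite in_itv /= -ler_norml => tM i.
  by have [j ->|->] := unliftP ord0 i; rewrite ?rV_consS ?rV_cons0.
rewrite product_measure1E; [|exact: measurable_cube|exact: measurable_itv].
have itv_fin : lebesgue_measure (`[(- M)%R, M]%classic : set R) < +oo.
  by rewrite lebesgue_measure_itv; case: ifP => _; rewrite -?EFinD ltry.
by apply: lte_mul_pinfty => //; rewrite ge0_fin_numE.
Qed.

(** Another name for [lebesgue_rV n], which is a bare measure by its type; Tonelli's theorem needs a
    term carrying a sigma-finite structure. *)
Definition sigma_finite_lebesgue_rV n : set 'rV[R]_n -> \bar R := lebesgue_rV n.

HB.instance Definition _ n := measure_function.isMeasure.Build _ _ _
  (@sigma_finite_lebesgue_rV n) (measure0 (lebesgue_rV n))
  (measure_ge0 (lebesgue_rV n)) (@measure_semi_sigma_additive _ _ _ (lebesgue_rV n)).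

Lemma sigma_finite_lebesgue_rVT n : sigma_finite setT (@sigma_finite_lebesgue_rV n).
Proof.
exists (fun k => cube n k%:R).
  apply/seteqP; split=> // x _; exists (Num.bound (enorm x)) => // i.
  rewrite (le_trans (coord_le_enorm _ _))// ltW//.
  by apply: archi_boundP; exact: enorm_ge0.
by move=> k; split; [exact: measurable_cube|exact: lebesgue_rV_cube].
Qed.

HB.instance Definition _ n := @Measure_isSigmaFinite.Build _ _ _
  (@sigma_finite_lebesgue_rV n) (@sigma_finite_lebesgue_rVT n).

(** Both orders are kept: slicing along coordinate 0 uses the first, slicing along any later
    coordinate the second. *)
Lemma ge0_integral_lebesgue_rVS n (f : 'rV[R]_n.+1 -> \bar R) :
  (forall x, 0 <= f x) -> measurable_fun setT f ->
  \int[lebesgue_rV n.+1]_x f x =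
    \int[lebesgue_rV n]_y \int[lebesgue_measure]_t f (rV_cons (y, t)) /\
  \int[lebesgue_rV n.+1]_x f x =
    \int[lebesgue_measure]_t \int[lebesgue_rV n]_y f (rV_cons (y, t)).
Proof.
move=> f0 mf.
have mfc : measurable_fun setT (f \o @rV_cons R n).
  by apply: measurableT_comp => //; exact: measurable_rV_cons.
have -> : \int[lebesgue_rV n.+1]_x f x =
    \int[@sigma_finite_lebesgue_rV n \x lebesgue_measure]_z f (rV_cons z).
  transitivity (\int[lebesgue_rV n \x lebesgue_measure]_z f (rV_cons z)).
    by rewrite /= ge0_integral_pushforward//; exact: measurable_rV_cons.
  by apply: eq_measure_integral => A mA _; exact: eq_measure_integral.
split.
  by rewrite (fubini_tonelli1 (f \o @rV_cons R n))//; move=> z; exact: f0.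
by rewrite (fubini_tonelli2 (f \o @rV_cons R n))//; move=> z; exact: f0.
Qed.

(** [c^-1] times the image of Lebesgue measure under [t |-> t / c] gives every half-open interval
    its length, hence is Lebesgue measure. *)
Lemma ge0_integral_lebesgueZ (f : R -> \bar R) (c : R) : (0 < c)%R ->
  (forall t, 0 <= f t) -> measurable_fun setT f ->
  \int[lebesgue_measure]_t f (c^-1 * t)%R = c%:E * \int[lebesgue_measure]_t f t.
Proof.
move=> c0 f0 mf.
have mc : measurable_fun setT (fun t : R => (c^-1 * t)%R : measurableTypeR R).
  exact: measurable_funM.
have c0' : (0 <= c^-1)%R by rewrite invr_ge0 ltW.
pose nu := mscale (NngNum c0') (image_measure lebesgue_measure mc).
have nuE (X : set R) : ocitv X -> lebesgue_measure X = nu X.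
  move=> /ocitvP[->|[[a b] /= ab ->]]; first by rewrite !measure0.
  rewrite /nu /mscale /= lebesgue_measure_itv /= lte_fin ab.
  have -> : pushforward lebesgue_measure
      (fun t : R => (c^-1 * t)%R : measurableTypeR R) `]a, b]%classic =
      lebesgue_measure (`](c * a)%R, (c * b)%R]%classic : set R).
    congr (lebesgue_measure _); apply/seteqP; split=> t /=; rewrite !in_itv /=.
      by rewrite ltr_pdivlMl// ler_pdivrMl.
    by rewrite ltr_pdivlMl// ler_pdivrMl.
  rewrite lebesgue_measure_itv /= lte_fin ltr_pM2l// ab.
  by rewrite -!EFinD -EFinM -mulrBr mulKf ?gt_eqF.
rewrite [X in _ = _ * X](eq_measure_integral nu); last first.
  by move=> A mA _; exact: lebesgue_measure_unique.
rewrite ge0_integral_mscale// ge0_integral_pushforward//.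
rewrite muleA -EFinM mulfV ?gt_eqF// mul1e.
by [].
Qed.

Lemma ge0_integral_lebesgue_rVZ n (f : 'rV[R]_n -> \bar R) (c : R) : (0 < c)%R ->
  (forall x, 0 <= f x) -> measurable_fun setT f ->
  \int[lebesgue_rV n]_x f (c^-1 *: x)%R = (c ^+ n)%:E * \int[lebesgue_rV n]_x f x.
Proof.
move=> c0; elim: n f => [|n IH] f f0 mf.
  rewrite expr0 mul1e; apply: eq_integral => x _; congr f.
  by apply/rowP => -[].
have mZ : measurable_fun setT (fun x : 'rV[R]_n.+1 => c^-1 *: x)%R.
  apply: measurable_fun_rVP => j; under eq_fun do rewrite mxE.
  by apply: measurable_funM => //; exact: measurable_coord.
have [-> _] := ge0_integral_lebesgue_rVS (fun x => f0 (c^-1 *: x)%R)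
  (measurableT_comp mf mZ).
have [-> _] := ge0_integral_lebesgue_rVS f0 mf.
have consZ (y : 'rV[R]_n) t :
    (c^-1 *: rV_cons (y, t))%R = rV_cons (c^-1 *: y, (c^-1 * t)%R)%R.
  apply/rowP => i; rewrite mxE.
  by have [j ->|->] := unliftP ord0 i; rewrite ?rV_consS ?rV_cons0 //= mxE.
pose F y := \int[lebesgue_measure]_t f (rV_cons (y, t)).
have mF : measurable_fun setT F.
  apply: (@measurable_fun_fubini_tonelli_F _ _ _ _ _ lebesgue_measure (f \o @rV_cons R n)).
    by apply: measurableT_comp => //; exact: measurable_rV_cons.
  by move=> z; exact: f0.
have F0 y : 0 <= F y by exact: integral_ge0.
transitivity (\int[lebesgue_rV n]_y (c%:E * F (c^-1 *: y)%R)).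
  apply: eq_integral => y _; rewrite -ge0_integral_lebesgueZ//.
    by apply: eq_integral => t _; rewrite consZ.
  apply: (measurableT_comp mf); apply: measurable_fun_rVP => i.
  have [j ->|->] := unliftP ord0 i.
    by rewrite (_ : (fun _ => _) = cst ((c^-1 *: y)%R ord0 j))//;
      apply/funext => t; rewrite rV_consS.
  by rewrite (_ : (fun _ => _) = id)//; apply/funext => t; rewrite rV_cons0.
have mFZ : measurable_fun setT (fun y : 'rV[R]_n => F (c^-1 *: y)%R).
  apply: (measurableT_comp mF); apply: measurable_fun_rVP => j.
  under eq_fun do rewrite mxE.
  by apply: measurable_funM => //; exact: measurable_coord.
rewrite (@ge0_integralZl _ _ _ (lebesgue_rV n) setT measurableT _ mFZ c%:E
  (fun y _ => F0 _)); last by rewrite lee_fin ltW.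
by rewrite IH// muleA -EFinM exprS.
Qed.

End lebesgue_rV.
Arguments cube {R} n M.

(** * Polar coordinates on the unit ball *)

Section polar.
Context {R : realType} {n : nat}.

Definition ball_measure : {measure set 'rV[R]_n -> \bar R} :=
  mrestr (lebesgue_rV n) (@measurable_punctured_ball R n).

Let B := [set x : 'rV[R]_n | 0 < enorm x <= 1].
Let mB : measurable B. Proof. exact: measurable_punctured_ball. Qed.

Lemma ball_measure_fin : (ball_measure setT < +oo)%E.
Proof.
have BC : (lebesgue_rV n B <= lebesgue_rV n (cube n 1))%E.
  apply: le_measure; rewrite ?inE//; first exact: measurable_cube.
  by move=> x /= /andP[_ x1] i; rewrite (le_trans (coord_le_enorm _ _)).
rewrite /ball_measure /= /mrestr setTI.
exact: (le_lt_trans BC (lebesgue_rV_cube _ _)).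
Qed.

Lemma ge0_integral_ball_measure (f : 'rV[R]_n -> \bar R) :
  (forall x, 0 <= f x)%E -> measurable_fun setT f ->
  (\int[ball_measure]_x f x = \int[lebesgue_rV n]_(x in B) f x)%E.
Proof.
move=> f0 mf; rewrite -{1}(setUv B) ge0_integral_setU//=; last 3 first.
- exact: measurableC.
- by rewrite setUv.
- exact/disj_setPCl.
rewrite [X in (_ + X)%E](_ : _ = 0%E) ?adde0; last first.
  apply: null_set_integral; [exact: measurableC| |].
    exact: measurable_funTS.
  by rewrite /ball_measure /= /mrestr setICl measure0.
apply: eq_measure_integral => A mA AB.
by rewrite /ball_measure /= /mrestr setIidl.
Qed.

Definition homogeneous0 (G : 'rV[R]_n -> R) :=
  forall c x, 0 < c -> G (c *: x) = G x.

(** Dilation by [1 / a] carries the ball of radius [a] onto the unit ball, leaves [G] fixed and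
    contributes the Jacobian [a ^+ n]. *)
Lemma ge0_integral_ball_scale (G : 'rV[R]_n -> R) (a : R) : 0 < a <= 1 ->
  measurable_fun setT G -> (forall x, 0 <= G x) -> homogeneous0 G ->
  (\int[ball_measure]_(x in [set x | enorm x <= a]%R) (G x)%:E =
   (a ^+ n)%:E * \int[ball_measure]_x (G x)%:E)%E.
Proof.
move=> /andP[a0 a1] mG G0 hG.
have mE : measurable [set x : 'rV[R]_n | enorm x <= a].
  rewrite (_ : mkset _ = setT `&` @enorm R n @^-1` `]-oo, a]%classic).
    exact: measurable_enorm.
  by rewrite setTI; apply/seteqP; split=> x /=; rewrite in_itv.
have mEG : measurable_fun setT (EFin \o G) by exact/measurable_EFinP.
rewrite integral_mkcond [LHS]ge0_integral_ball_measure; last 2 first.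
- by move=> x; rewrite patchE; case: ifP => // _; rewrite lee_fin.
- exact/(measurable_restrictT _ _).1/measurable_funTS.
rewrite ge0_integral_ball_measure//.
rewrite ![(\int[lebesgue_rV n]_(x in B) _)%E]integral_mkcond.
rewrite -ge0_integral_lebesgue_rVZ//; last 2 first.
- by move=> x; rewrite patchE; case: ifP => // _; rewrite lee_fin.
- exact/(measurable_restrictT _ _).1/measurable_funTS.
have memE (D : set 'rV[R]_n) y (b : bool) : (D y <-> b) -> (y \in D) = b.
  by move=> Db; apply/idP/idP => [/set_mem/Db|/Db/mem_set].
apply: eq_integral => x _; rewrite !patchE.
have ai : 0 < a^-1 by rewrite invr_gt0.
rewrite (memE B x (0 < enorm x <= 1))// (memE B _ (0 < enorm (a^-1 *: x) <= 1))//.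
rewrite (memE _ x (enorm x <= a))// enormZ gtr0_norm// hG//.
have -> : (0 < a^-1 * enorm x <= 1) = (0 < enorm x <= a).
  by rewrite pmulr_rgt0// mulrC ler_pdivrMr// mul1r.
case: (ltP 0 (enorm x)) => //= x0.
by case: (leP (enorm x) a) => [xa|]; [rewrite (le_trans xa)|case: ifP].
Qed.

Section tail.
Variable (G : 'rV[R]_n -> R).
Hypotheses (mG : measurable_fun setT G) (G0 : forall x, 0 <= G x).
Hypotheses (hG : homogeneous0 G) (G_fin : (\int[ball_measure]_x (G x)%:E < +oo)%E).

Let mEG : measurable_fun setT (EFin \o G). Proof. exact/measurable_EFinP. Qed.
Let EG0 x : (0 <= (G x)%:E)%E. Proof. by rewrite lee_fin. Qed.

Let mle (a : R) : measurable [set x : 'rV[R]_n | enorm x <= a].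
Proof.
rewrite (_ : mkset _ = setT `&` @enorm R n @^-1` `]-oo, a]%classic).
  exact: measurable_enorm.
by rewrite setTI; apply/seteqP; split=> x /=; rewrite in_itv.
Qed.

Let mgt (a : R) : measurable [set x : 'rV[R]_n | a < enorm x].
Proof.
rewrite (_ : mkset _ = ~` [set x | enorm x <= a]); first exact: measurableC.
by apply/seteqP; split=> x /=; rewrite ltNge => /negP.
Qed.

(** The factor in front of the integral depends on [a] alone and not on [G]: this is the
    independence of radius and direction. It degenerates to 1 or 0 when [a] lies outside the open
    interval from 0 to 1. *)
Lemma ge0_integral_ball_tail (a : R) :
  (\int[ball_measure]_(x in [set x | a < enorm x]%R) (G x)%:E =
   (if a <= 0 then 1 else if 1 <= a then 0 else 1 - a ^+ n)%:E *
     \int[ball_measure]_x (G x)%:E)%E.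
Proof.
have split_int : (\int[ball_measure]_x (G x)%:E =
    \int[ball_measure]_(x in [set x | enorm x <= a]%R) (G x)%:E +
    \int[ball_measure]_(x in [set x | a < enorm x]%R) (G x)%:E)%E.
  rewrite -ge0_integral_setU//=; last 2 first.
  - by apply: measurable_funTS.
  - by apply/disj_setPS => x /= [/le_lt_trans h /h]; rewrite ltxx.
  congr (integral _ _ _); apply/seteqP; split=> x //= _.
  by case: (leP (enorm x) a); [left|right].
have [a0|a0] := leP a 0.
  rewrite mul1e split_int [X in (X + _)%E](_ : _ = 0%E) ?add0e//.
  apply: null_set_integral => //; first exact: measurable_funTS.
  rewrite /ball_measure /= /mrestr (_ : _ `&` _ = set0) ?measure0//.
  by apply/seteqP; split=> x //= [/le_trans/(_ a0)]; rewrite leNgt => /negP h /andP[].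
have [a1|a1] := leP 1 a.
  rewrite mul0e; apply: null_set_integral => //; first exact: measurable_funTS.
  rewrite /ball_measure /= /mrestr (_ : _ `&` _ = set0) ?measure0//.
  by apply/seteqP; split=> x //= [/(le_lt_trans a1)]; rewrite ltNge => /negP h /andP[].
have := split_int; rewrite ge0_integral_ball_scale//; last by rewrite a0 ltW.
have : (\int[ball_measure]_x (G x)%:E)%E \is a fin_num.
  by rewrite ge0_fin_numE//; exact: integral_ge0.
have : (\int[ball_measure]_(x in [set x | a < enorm x]%R) (G x)%:E)%E \is a fin_num.
  rewrite ge0_fin_numE; last exact: integral_ge0.
  by apply: le_lt_trans G_fin; apply: ge0_subset_integral.
case: (integral _ _ _) => // u _; case: (integral _ _ _) => // v _ [vE].
by rewrite -EFinM; congr (_%:E); lra.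
Qed.

End tail.

(** The law of |x| with weight [G] and the one without weight are proportional on the half-lines
    []a, +oo[], which generate the Borel sets. The identity is cross-multiplied so that no division
    by the mass of the ball, not yet known to be positive, occurs. *)
Lemma ge0_integral_polar (G : 'rV[R]_n -> R) (phi : R -> \bar R) :
  measurable_fun setT G -> (forall x, 0 <= G x) -> homogeneous0 G ->
  (\int[ball_measure]_x (G x)%:E < +oo)%E ->
  measurable_fun setT phi -> (forall t, 0 <= phi t)%E ->
  (\int[ball_measure]_x (phi (enorm x) * (G x)%:E) * ball_measure setT =
   \int[ball_measure]_x (G x)%:E * \int[ball_measure]_x phi (enorm x))%E.
Proof.
move=> mG G0 hG Gfin mphi phi0.
have mE : measurable_fun setT (@enorm R n : _ -> measurableTypeR R).
  exact: measurable_enorm.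
have int1 : (\int[ball_measure]_x (1 : R)%:E = ball_measure setT)%E.
  by rewrite integral_cst// mul1e.
have c1_ge0 : 0 <= fine (ball_measure setT) by rewrite fine_ge0.
have cG_ge0 : 0 <= fine (\int[ball_measure]_x (G x)%:E)%E.
  by rewrite fine_ge0// integral_ge0// => x _; rewrite lee_fin.
have c1E : (fine (ball_measure setT))%:E = ball_measure setT.
  by rewrite fineK// ge0_fin_numE//; exact: ball_measure_fin.
have cGE : ((fine (\int[ball_measure]_x (G x)%:E))%:E = \int[ball_measure]_x (G x)%:E)%E.
  by rewrite fineK// ge0_fin_numE//; apply: integral_ge0 => x _; rewrite lee_fin.
pose dens : {measure set _ -> \bar R} := density ball_measure mG G0.
pose nuG := mscale (NngNum c1_ge0) (image_measure dens mE).
pose nu1 := mscale (NngNum cG_ge0) (image_measure ball_measure mE).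
have nuE (A : set (measurableTypeR R)) : measurable A -> nuG A = nu1 A.
  have tail (a : R) : nuG `]a, +oo[%classic = nu1 `]a, +oo[%classic.
    rewrite /nuG /nu1 /mscale /= /pushforward c1E cGE.
    rewrite (_ : _ @^-1` _ = [set x | a < enorm x]%R); last first.
      by apply/seteqP; split=> x /=; rewrite in_itv/= andbT.
    rewrite /dens /= /density ge0_integral_ball_tail//.
    have mgt : measurable [set x : 'rV[R]_n | a < enorm x].
      rewrite (_ : mkset _ = setT `&` @enorm R n @^-1` `]a, +oo[%classic).
        exact: measurable_enorm.
      by rewrite setTI; apply/seteqP; split=> x /=; rewrite in_itv/= andbT.
    have intgt : (\int[ball_measure]_(x in [set x | a < enorm x]%R) (1 : R)%:E =
        ball_measure [set x | a < enorm x]%R)%E.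
      by rewrite integral_cst// mul1e.
    have := @ge0_integral_ball_tail (cst 1) (measurable_cst _) (fun=> ler01) (fun _ _ _ => erefl).
    rewrite int1 => /(_ ball_measure_fin a); rewrite intgt => ->.
    by rewrite muleCA [RHS]muleCA; congr (_ * _)%E; exact: muleC.
  apply: (@measure_unique _ R (measurableTypeR R) (@RGenOInfty.G R)
    (fun k : nat => `](- k%:R), +oo[%classic)).
  - exact: RGenOInfty.measurableE.
  - move=> _ _ [a ->] [b ->]; exists (Num.max a b).
    by apply/seteqP; split=> x /=; rewrite !in_itv /= !andbT gt_max => /andP.
  - by move=> k; eexists.
  - apply/seteqP; split=> // x _; exists (Num.bound `|x|) => //=.
    rewrite in_itv /= andbT ltrNl (le_lt_trans (ler_norm _))// normrN.
    exact: archi_boundP.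
  - by move=> _ [a ->]; exact: tail.
  - move=> k; apply: (@le_lt_trans _ _ (nuG setT)); first by rewrite le_measure ?inE.
    by rewrite /nuG /mscale /= /pushforward lte_mul_pinfty// preimage_setT.
have : (\int[nuG]_t phi t = \int[nu1]_t phi t)%E.
  by apply: eq_measure_integral => A mA _; exact: nuE.
rewrite !ge0_integral_mscale//= c1E cGE !ge0_integral_pushforward//=.
move=> <-; rewrite [LHS]muleC; congr (_ * _)%E.
rewrite preimage_setT ge0_integral_density//.
exact: (measurableT_comp mphi).
Qed.

End polar.

Section poly_evaluation.
Context {R : realType} {d : nat}.
Implicit Types (P Q : mpoly d R) (x : 'rV[R]_d).

Lemma peval0 x : peval (0 : mpoly d R) x = 0. Proof. exact: meval0. Qed.

Lemma pevalX m x : peval (mpolyX R m) x = \prod_i x ord0 i ^+ m i.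
Proof. exact: mevalX. Qed.

Lemma pevalE P : peval P =
  fun x => \sum_(m <- msupp P) mcoeff m P * \prod_i x ord0 i ^+ m i.
Proof.
apply/funext => x; rewrite {1}[P]mpolyE /peval raddf_sum; apply: eq_bigr => m _.
by rewrite /= mevalZ mevalX.
Qed.

Lemma peval_sum (I : Type) (r : seq I) (F : I -> mpoly d R) x :
  peval (\sum_(i <- r) F i) x = \sum_(i <- r) peval (F i) x.
Proof. exact: raddf_sum. Qed.

Lemma measurable_peval P : measurable_fun setT (peval P).
Proof.
rewrite pevalE; apply: measurable_sum => m; apply: measurable_funM => //.
apply: measurable_prod => i _; apply: measurable_funX; exact: measurable_coord.
Qed.

Lemma peval_bounded P : exists M, forall x, (forall i, `|x ord0 i| <= 1) ->
  `|peval P x| <= M.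
Proof.
exists (\sum_(m <- msupp P) `|mcoeff m P|) => x x1; rewrite pevalE.
rewrite (le_trans (ler_norm_sum _ _ _))//; apply: ler_sum => m _.
rewrite normrM ler_piMr// normr_prod prodr_ile1// => i _; rewrite normrX.
by rewrite exprn_ge0//= exprn_ile1.
Qed.

Lemma peval_homog k P x : P \is ishomog1 k mdeg ->
  peval P x = enorm x ^+ k * peval P (radial x).
Proof. by move=> hP; rewrite -(peval_scale _ _ hP) enorm_radialK. Qed.

Lemma peval_radial k P x : P \is ishomog1 k mdeg ->
  peval P (radial x) = (enorm x)^-1 ^+ k * peval P x.
Proof. by move=> hP; rewrite /radial (peval_scale _ _ hP). Qed.

Lemma radial_coord_le1 x i : `|radial x ord0 i| <= 1.
Proof. exact: le_trans (coord_le_enorm _ _) (enorm_radial_le1 _). Qed.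

Definition set_coord x i (t : R) : 'rV[R]_d :=
  \row_j (if j == i then t else x ord0 j).

(** Reduces partial derivatives of multivariate polynomials to derivatives of univariate ones, so
    that the fundamental theorem of calculus can be applied line by line. *)
Lemma line_polynomial P x i : exists p : {poly R}, forall t,
  peval P (set_coord x i t) = p.[t] /\
  peval (mderiv i P) (set_coord x i t) = p^`().[t].
Proof.
elim/mpolyind: P => [|c m P _ _ [p hp]].
  by exists 0 => t; rewrite mderiv0 !peval0 deriv0 !horner0.
pose K := \prod_(j | j != i) x ord0 j ^+ m j.
have XE (l : multinom d) t : (forall j, j != i -> l j = m j) ->
    peval (mpolyX R l) (set_coord x i t) = t ^+ l i * K.
  move=> lm; rewrite pevalX (bigD1 i)//= mxE eqxx; congr (_ * _).
  by apply: eq_bigr => j ji; rewrite mxE (negbTE ji) lm.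
exists (c * K *: 'X^(m i) + p) => t; have [h1 h2] := hp t; split.
  by rewrite pevalD pevalZ XE// h1 hornerD hornerZ hornerXn -mulrA [K * _]mulrC.
rewrite linearD linearZ /= mderivX pevalD !pevalZ h2 XE => [|j ji].
  rewrite derivD derivZ derivXn !hornerE /= hornerMn hornerXn mnmE mnm1E eqxx subn1.
  by rewrite -mulr_natl; congr (_ + _); ring.
by rewrite mnmBE mnm1E eq_sym (negbTE ji) subn0.
Qed.

End poly_evaluation.

Lemma Rintegral_ball_measure {R : realType} n (f : 'rV[R]_n -> R) :
  measurable_fun setT f -> (forall x, ~ 0 < enorm x <= 1 -> f x = 0) ->
  \int[ball_measure]_x f x = \int[lebesgue_rV n]_x f x.
Proof.
move=> mf f0; have mEf : measurable_fun setT (EFin \o f) by exact/measurable_EFinP.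
have patch0 (F : 'rV[R]_n -> \bar R) : (forall x, ~ 0 < enorm x <= 1 -> F x = 0%E) ->
    F \_ [set x | 0 < enorm x <= 1] = F.
  move=> F0; apply/funext => x; rewrite patchE; case: ifPn => // /negP xB.
  by rewrite F0// => xB'; apply: xB; rewrite inE.
rewrite /Rintegral [in LHS]integralE [in RHS]integralE; congr (fine (_ - _)%E).
  rewrite ge0_integral_ball_measure//; last exact: measurable_funepos.
  rewrite [LHS]integral_mkcond patch0// => x /f0 fx.
  by rewrite funeposE fx maxxx.
rewrite ge0_integral_ball_measure//; last exact: measurable_funeneg.
rewrite [LHS]integral_mkcond patch0// => x /f0 fx.
by rewrite funenegE fx oppe0 maxxx.
Qed.

(** * Green's identity on the ball with a polynomial weight *)

Section integration_by_parts.
Context {R : realType}.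

Lemma integral_deriv_poly (p : {poly R}) a b : a < b ->
  (\int[lebesgue_measure]_(t in `[a, b]) (p^`().[t])%:E = (p.[b] - p.[a])%:E)%E.
Proof.
move=> ab; rewrite EFinB; apply: continuous_FTC2 => //.
- by apply: continuous_subspaceT => x; exact: continuous_horner.
- split => [x _| |]; first exact: derivable_horner.
  + by apply: cvg_at_right_filter; exact: continuous_horner.
  + by apply: cvg_at_left_filter; exact: continuous_horner.
- by move=> x _; rewrite -derivE.
Qed.

Context {n : nat}.

(** The weight integrated by parts is its square, a polynomial inside the ball that vanishes on the
    sphere, so that no boundary term appears. *)
Definition cutoff (x : 'rV[R]_n) := Num.max 0 (1 - enorm x ^+ 2).

(** The partial derivative of [P * cutoff ^+ 2] in direction i: inside the ball that of [cutoff] is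
    -2 x_i, whence the factor 4. *)
Definition cutoff_derivative i (P : mpoly n R) (x : 'rV[R]_n) :=
  peval (mderiv i P) x * cutoff x ^+ 2 -
  4%:R * (peval (mpolyX R (mnm1 i) * P) x * cutoff x).

(** On a line in direction i, [P * cutoff ^+ 2] is a polynomial along the chord of the ball and
    vanishes at both ends of it. The chord has half-length [sqrt (1 - c)], where [c] is the squared
    distance of the line from the origin. *)
Lemma integral_cutoff_line i (P : mpoly n R) x :
  (\int[lebesgue_measure]_t (cutoff_derivative i P (set_coord x i t))%:E = 0)%E.
Proof.
pose c := \sum_(j | j != i) x ord0 j ^+ 2.
have cutE t : cutoff (set_coord x i t) = Num.max 0 (1 - c - t ^+ 2).
  rewrite /cutoff enorm_sqr (bigD1 i)//= mxE eqxx opprD addrCA addrC.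
  congr (Num.max 0 (1 - _ - _)); apply: eq_bigr => j ji.
  by rewrite mxE (negbTE ji).
have [c1|c1] := leP 1 c.
  apply: integral0_eq => t _; rewrite /cutoff_derivative cutE.
  have -> : Num.max 0 (1 - c - t ^+ 2) = 0.
    by apply/max_idPl; have := sqr_ge0 t; lra.
  by rewrite expr0n !mulr0 subr0.
pose a := Num.sqrt (1 - c).
have a0 : 0 < a by rewrite sqrtr_gt0 subr_gt0.
have aE : a ^+ 2 = 1 - c by rewrite sqr_sqrtr// subr_ge0 ltW.
have [p hp] := line_polynomial P x i.
pose H : {poly R} := p * ((1 - c)%:P - 'X^2) ^+ 2.
transitivity (\int[lebesgue_measure]_(t in `[(- a)%R, a]) (H^`().[t])%:E)%E.
  rewrite [RHS]integral_mkcond; apply: eq_integral => t _; rewrite patchE.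
  rewrite /cutoff_derivative cutE; case: ifPn => [|ta].
    rewrite inE /= in_itv /= -ler_norml => ta.
    have t2 : t ^+ 2 <= a ^+ 2.
      by rewrite -(real_normK (num_real t)) lerXn2r ?nnegrE// ltW.
    rewrite (max_idPr _); last by rewrite -aE subr_ge0.
    have -> : peval (mpolyX R (mnm1 i) * P) (set_coord x i t) = t * p.[t].
      by rewrite pevalM (hp t).1 /peval mevalXU mxE eqxx.
    rewrite (hp t).2 /H expr2 !derivM !derivB derivC derivXn; congr (_%:E).
    by rewrite !hornerE /=; ring.
  have -> : Num.max 0 (1 - c - t ^+ 2) = 0.
    apply/max_idPl; rewrite -aE subr_le0 -(real_normK (num_real t)).
    rewrite lerXn2r ?nnegrE//; first exact: ltW a0.
    rewrite leNgt; apply: contra ta => ta.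
    by rewrite inE /= in_itv /= -ler_norml ltW.
  by rewrite expr0n !mulr0 subr0.
rewrite integral_deriv_poly; last by rewrite gtrN.
by rewrite /H !hornerE /= sqrrN aE subrr !(mulr0, expr0n) subrr.
Qed.

(** Tonelli's theorem for lines in direction i. It compares two nonnegative functions because it
    will be used on the positive and negative parts of a single one. *)
Lemma integral_lines_eq m (i : 'I_m) (f g : 'rV[R]_m -> \bar R) :
  (forall x, 0 <= f x)%E -> (forall x, 0 <= g x)%E ->
  measurable_fun setT f -> measurable_fun setT g ->
  (forall x, \int[lebesgue_measure]_t f (set_coord x i t) =
             \int[lebesgue_measure]_t g (set_coord x i t))%E ->
  (\int[lebesgue_rV m]_x f x = \int[lebesgue_rV m]_x g x)%E.
Proof.
elim: m i f g => [[]//|m IH] i f g f0 g0 mf mg fg.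
have [Ef1 Ef2] := ge0_integral_lebesgue_rVS f0 mf.
have [Eg1 Eg2] := ge0_integral_lebesgue_rVS g0 mg.
have [j|] := unliftP ord0 i => iE.
  rewrite Ef2 Eg2; apply: eq_integral => t _.
  have mc : measurable_fun setT (fun y : 'rV[R]_m => rV_cons (y, t)).
    apply: measurable_fun_rVP => k; have [l ->|->] := unliftP ord0 k.
      under eq_fun do rewrite rV_consS; exact: measurable_coord.
    by under eq_fun do rewrite rV_cons0; exact: measurable_cst.
  apply: (IH j) => // [||y]; [exact: measurableT_comp|exact: measurableT_comp|].
  have E s : rV_cons (set_coord y j s, t) = set_coord (rV_cons (y, t)) i s.
    apply/rowP => k; rewrite [RHS]mxE iE.
    have [l ->|->] := unliftP ord0 k; last by rewrite !rV_cons0.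
    by rewrite !rV_consS mxE (inj_eq lift_inj).
  by under eq_integral do rewrite E; under [RHS]eq_integral do rewrite E.
rewrite Ef1 Eg1; apply: eq_integral => y _.
have E s : rV_cons (y, s) = set_coord (rV_cons (y, 0)) i s.
  apply/rowP => k; rewrite [RHS]mxE iE.
  by have [l ->|->] := unliftP ord0 k; rewrite ?rV_consS ?rV_cons0.
by under eq_integral do rewrite E; under [RHS]eq_integral do rewrite E.
Qed.

Lemma measurable_cutoff : measurable_fun setT cutoff.
Proof.
apply: measurable_maxr => //; apply: measurable_funB => //.
by apply: measurable_funX; exact: measurable_enorm.
Qed.

Lemma cutoff_ge0 x : 0 <= cutoff x. Proof. by rewrite le_max lexx. Qed.

Lemma cutoff_le1 x : cutoff x <= 1.
Proof. by rewrite ge_max ler01 gerBl sqr_ge0. Qed.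

Lemma cutoff_eq0 x : 1 <= enorm x -> cutoff x = 0.
Proof. by move=> x1; apply/max_idPl; rewrite subr_le0 exprn_ege1. Qed.

Lemma cutoff_supp (P : 'rV[R]_n -> R) (x : 'rV[R]_n) :
  ~ (forall i, `|x ord0 i| <= 1) -> P x * cutoff x = 0 :> R.
Proof.
move=> x1; rewrite cutoff_eq0 ?mulr0// leNgt; apply/negP => xlt; apply: x1 => i.
by rewrite (le_trans (coord_le_enorm _ _))// ltW.
Qed.

Lemma cutoff_integrable (f : 'rV[R]_n -> R) (M : R) : measurable_fun setT f ->
  (forall x : 'rV[R]_n, (forall i, `|x ord0 i| <= 1) -> `|f x| <= M) ->
  (lebesgue_rV n).-integrable setT (EFin \o (fun x => f x * cutoff x)).
Proof.
move=> mf fM; have mfc : measurable_fun setT (fun x => f x * cutoff x).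
  by apply: measurable_funM => //; exact: measurable_cutoff.
apply/integrableP; split; first exact/measurable_EFinP.
have M0 : 0 <= M.
  by rewrite (le_trans (normr_ge0 (f 0)))// fM// => i; rewrite mxE normr0.
apply: (@le_lt_trans _ _ (\int[lebesgue_rV n]_(x in cube n 1) M%:E)%E).
  rewrite [leRHS]integral_mkcond; apply: ge0_le_integral => //.
  - exact/measurableT_comp/measurable_EFinP.
  - by apply/(measurable_restrictT _ _).1 => //; exact: measurable_cube.
  move=> x _; rewrite patchE /=; case: ifPn => [/set_mem xc|/negP xc].
    rewrite lee_fin normrM (ger0_norm (cutoff_ge0 x)) -[leRHS]mulr1.
    by rewrite ler_pM ?cutoff_ge0 ?cutoff_le1 ?fM.
  by rewrite cutoff_supp ?normr0// => xc'; apply: xc; rewrite inE.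
rewrite integral_cst; last exact: measurable_cube.
by rewrite lte_mul_pinfty// ?lee_fin// lebesgue_rV_cube.
Qed.

Lemma peval_cutoff_integrable (P : mpoly n R) j :
  (lebesgue_rV n).-integrable setT (EFin \o (fun x => peval P x * cutoff x ^+ j.+1)).
Proof.
have [M PM] := peval_bounded P.
have -> : (fun x => peval P x * cutoff x ^+ j.+1) =
    (fun x => (peval P x * cutoff x ^+ j) * cutoff x).
  by apply/funext => x; rewrite exprSr mulrA.
apply: (@cutoff_integrable _ M) => [|x x1].
  apply: measurable_funM; first exact: measurable_peval.
  by apply: measurable_funX; exact: measurable_cutoff.
rewrite normrM -[leRHS]mulr1 ler_pM ?PM// ger0_norm ?exprn_ge0 ?cutoff_ge0//.
by rewrite exprn_ile1 ?cutoff_ge0 ?cutoff_le1.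
Qed.

Lemma Rintegral_cutoff_derivative i (P : mpoly n R) :
  \int[lebesgue_rV n]_x (peval (mderiv i P) x * cutoff x ^+ 2) =
  4%:R * \int[lebesgue_rV n]_x (peval (mpolyX R (mnm1 i) * P) x * cutoff x).
Proof.
have i1 := peval_cutoff_integrable (mderiv i P) 1.
have i2 := peval_cutoff_integrable (mpolyX R (mnm1 i) * P) 0.
have i3 : (lebesgue_rV n).-integrable setT
    (EFin \o (fun x => 4%:R * (peval (mpolyX R (mnm1 i) * P) x * cutoff x))).
  exact: integrableRZ.
rewrite -RintegralZl//; apply/eqP; rewrite -subr_eq0 -RintegralB//.
have mc : measurable_fun setT (EFin \o cutoff_derivative i P).
  apply/measurable_EFinP/measurable_funB.
  - by apply: measurable_funM; [exact: measurable_peval|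
      apply: measurable_funX; exact: measurable_cutoff].
  - apply: measurable_funM => //.
    by apply: measurable_funM; [exact: measurable_peval|exact: measurable_cutoff].
rewrite /Rintegral integralE.
rewrite (@integral_lines_eq _ i _ ((EFin \o cutoff_derivative i P)^\-)%E)//.
- set I := integral _ _ _; have : (0 <= I)%E by exact: integral_ge0.
  by case: I => //= I _; rewrite subrr.
- exact: measurable_funepos.
- exact: measurable_funeneg.
move=> x; have := integral_cutoff_line i P x; rewrite integralE => I0.
pose h (t : R) := (cutoff_derivative i P (set_coord x i t))%:E.
transitivity (\int[lebesgue_measure]_t (h^\+ t))%E.
  by apply: eq_integral => t _; rewrite !funeposE.
transitivity (\int[lebesgue_measure]_t (h^\- t))%E; last first.
  by apply: eq_integral => t _; rewrite !funenegE.
by apply: ge0_sube_eq0 I0; exact: integral_ge0.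
Qed.

(** Since [P] is harmonic, grad Q . grad P is the divergence of Q grad P. Integration by parts moves
    the derivative onto the weight and leaves 4 Q (x . grad P), where Euler's identity gives the
    factor k. *)
Lemma Rintegral_cutoff_gradient (P Q : mpoly n R) k :
  harmonic_homogeneous k P ->
  \int[lebesgue_rV n]_x
      (peval (\sum_(i < n) mderiv i Q * mderiv i P) x * cutoff x ^+ 2) =
  4%:R * k%:R * \int[lebesgue_rV n]_x (peval (Q * P) x * cutoff x).
Proof.
move=> [hP lP].
have -> : \sum_(i < n) mderiv i Q * mderiv i P =
    \sum_(i < n) mderiv i (Q * mderiv i P).
  under [RHS]eq_bigr do rewrite mderivM.
  by rewrite big_split /= -mulr_sumr -/(laplacian P) lP mulr0 addr0.
under eq_Rintegral do rewrite peval_sum mulr_suml.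
rewrite Rintegral_sum => [|i]; last exact: peval_cutoff_integrable.
under eq_bigr do rewrite Rintegral_cutoff_derivative.
rewrite -mulr_sumr -mulrA; congr (_ * _).
rewrite -Rintegral_sum => [|i]; last exact: (peval_cutoff_integrable _ 0).
rewrite -RintegralZl//; last exact: (peval_cutoff_integrable _ 0).
apply: eq_Rintegral => x _; rewrite -mulr_suml -peval_sum mulrA -pevalZ.
congr (peval _ _ * _); under eq_bigr do rewrite mulrCA.
by rewrite -mulr_sumr (euler hP) scalerAr.
Qed.

(** The gradient form on the left of the previous identity is symmetric in [P] and [Q], so that k
    and l times the same integral agree. *)
Lemma Rintegral_cutoff_orthogonal (P Q : mpoly n R) k l : k != l ->
  harmonic_homogeneous k P -> harmonic_homogeneous l Q ->
  \int[lebesgue_rV n]_x (peval (Q * P) x * cutoff x) = 0.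
Proof.
move=> kl hP hQ; have := Rintegral_cutoff_gradient Q hP.
under eq_bigr do rewrite mulrC.
rewrite (Rintegral_cutoff_gradient P hQ) [P * Q]mulrC => /eqP.
rewrite -subr_eq0 -mulrBl mulf_eq0 -mulrBr mulf_eq0 pnatr_eq0 /= subr_eq0.
by rewrite eqr_nat eq_sym (negbTE kl) => /eqP.
Qed.

Lemma measurable_radialM (P Q : mpoly n R) :
  measurable_fun setT (fun x => peval P (radial x) * peval Q (radial x)).
Proof.
apply: measurable_funM.
  by apply: (measurableT_comp (measurable_peval P)); exact: measurable_radial.
by apply: (measurableT_comp (measurable_peval Q)); exact: measurable_radial.
Qed.

(* The cutoff and the indicator of the ball are two radial weights, so the
   orthogonality for the former gives the one on the sphere. *)
Lemma Rintegral_ball_orthogonal (P Q : mpoly n R) k l : k != l ->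
  harmonic_homogeneous k P -> harmonic_homogeneous l Q ->
  \int[ball_measure]_x (peval Q (radial x) * peval P (radial x)) = 0.
Proof.
move=> kl hP hQ; have := Rintegral_cutoff_orthogonal kl hP hQ.
have [hhP _] := hP; have [hhQ _] := hQ.
have [M1 hM1] := peval_bounded P; have [M2 hM2] := peval_bounded Q.
pose G x := peval Q (radial x) * peval P (radial x).
have mG : measurable_fun setT G by exact: measurable_radialM.
pose M := M2 * M1.
have GM x : `|G x| <= M.
  by rewrite normrM ler_pM ?hM1 ?hM2//; move=> i; exact: radial_coord_le1.
(* The radial factor of [Q * P * cutoff]: homogeneity extracts [|x| ^ (l + k)] and leaves the
   directional part [G]. *)
pose phi (t : R) := t ^+ (l + k) * Num.max 0 (1 - t ^+ 2).
have mphi : measurable_fun setT phi.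
  apply: measurable_funM; first exact: measurable_funX.
  by apply: measurable_maxr => //; apply: measurable_funB => //; exact: measurable_funX.
have mphiE : measurable_fun setT (fun x : 'rV[R]_n => phi (enorm x)).
  by apply: (measurableT_comp mphi); exact: measurable_enorm.
have QPE x : peval (Q * P) x * cutoff x = phi (enorm x) * G x.
  rewrite pevalM (peval_homog _ hhQ) (peval_homog _ hhP) /phi /G exprD /cutoff.
  ring.
(* Different degrees are not both 0, so [phi] vanishes at 0 and [phi (enorm x)] is supported in the
   punctured ball. *)
have kl0 : (0 < l + k)%N.
  by rewrite lt0n; apply: contra kl; rewrite addn_eq0 => /andP[/eqP -> /eqP ->].
have phi_supp (F : 'rV[R]_n -> R) x : ~ [set x : 'rV[R]_n | 0 < enorm x <= 1] x ->
    phi (enorm x) * F x = 0.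
  move=> /negP; rewrite negb_and -leNgt -ltNge => /orP[x0|x1]; rewrite /phi.
    have -> : enorm x = 0 by apply/eqP; rewrite eq_le x0 enorm_ge0.
    by rewrite expr0n gtn_eqF// !mul0r.
  rewrite (max_idPl _) ?mulr0 ?mul0r// subr_le0.
  by rewrite exprn_ege1// ltW.
have phi01 t : 0 <= t -> 0 <= phi t <= 1.
  move=> t0; rewrite /phi; have [t1|t1] := leP t 1.
    rewrite mulr_ge0 ?exprn_ge0 ?le_max ?lexx//= mulr_ile1 ?exprn_ge0 ?exprn_ile1//.
      by rewrite le_max lexx.
    by rewrite ge_max ler01 gerBl sqr_ge0.
  rewrite (max_idPl _) ?mulr0 ?lexx ?ler01// subr_le0.
  by rewrite exprn_ege1// ltW.
have ball_int (F : 'rV[R]_n -> R) (K : R) : measurable_fun setT F ->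
    (forall x, `|F x| <= K) -> ball_measure.-integrable setT (EFin \o F).
  by move=> mF; apply: bounded_integrable => //; exact: ball_measure_fin.
have iG : ball_measure.-integrable setT (EFin \o G) by exact: (ball_int _ M).
have iphi : ball_measure.-integrable setT
    (EFin \o (fun x : 'rV[R]_n => phi (enorm x))).
  apply: (ball_int _ 1) => // x.
  by have /andP[p0 p1] := phi01 _ (enorm_ge0 x); rewrite ger0_norm.
have iphiG : ball_measure.-integrable setT (EFin \o (fun x => phi (enorm x) * G x)).
  apply: (ball_int _ M); first exact: measurable_funM.
  move=> x; rewrite normrM -[leRHS]mul1r ler_pM//.
  by have /andP[p0 p1] := phi01 _ (enorm_ge0 x); rewrite ger0_norm.
have M0 : 0 <= M by rewrite (le_trans _ (GM 0)).
(* The polar formula is for nonnegative functions, so it is applied to [G + M]. *)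
have GM0 x : 0 <= G x + M by have := GM x; rewrite ler_norml => /andP[]; lra.
have i1 : ball_measure.-integrable setT (EFin \o (fun _ : 'rV[R]_n => M)).
  by apply: (ball_int _ M) => // x; rewrite ger0_norm.
have iGM : ball_measure.-integrable setT (EFin \o (fun x => G x + M)) by exact: integrableRD.
have mGM : measurable_fun setT (fun x => G x + M) by exact: measurable_funD.
have iphiGM : ball_measure.-integrable setT (EFin \o (fun x => phi (enorm x) * (G x + M))).
  apply: (ball_int _ (M + M)); first exact: measurable_funM.
  move=> x; rewrite normrM -[leRHS]mul1r ler_pM//.
    by have /andP[p0 p1] := phi01 _ (enorm_ge0 x); rewrite ger0_norm.
  by rewrite (le_trans (ler_normD _ _))// lerD// ger0_norm.
have hG0 : homogeneous0 (fun x => G x + M).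
  by move=> c x c0; rewrite /G !radialZ.
have mphi' : measurable_fun setT (fun t : R => (phi (Num.max 0 t))%:E).
  by apply/measurable_EFinP/(measurableT_comp mphi); exact: measurable_maxr.
have := ge0_integral_polar mGM GM0 hG0 (integrable_lty measurableT iGM) mphi'.
have phi0 t : (0 <= (phi (Num.max 0 t))%:E)%E.
  have /andP[p0 _] : 0 <= phi (Num.max 0 t) <= 1 by apply: phi01; rewrite le_max lexx.
  by rewrite lee_fin.
have maxE (x : 'rV[R]_n) : Num.max 0 (enorm x) = enorm x.
  by apply/max_idPr; exact: enorm_ge0.
move=> /(_ phi0) /(congr1 fine).
under eq_integral do rewrite maxE -EFinM.
under [X in _ = fine (_ * X)%E]eq_integral do rewrite maxE.
rewrite !fineM; last 4 first.
- exact: integrable_fin_num iGM.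
- exact: integrable_fin_num iphi.
- exact: integrable_fin_num iphiGM.
- by rewrite ge0_fin_numE//; exact: ball_measure_fin.
rewrite -!/(Rintegral _ _ _) => polarE ortho.
have phiG0 : \int[ball_measure]_x (phi (enorm x) * G x) = 0.
  rewrite -ortho Rintegral_ball_measure//; last 2 first.
  - exact: measurable_funM.
  - by move=> x; exact: phi_supp.
  by apply: eq_Rintegral => x _; rewrite QPE.
have phiGME : \int[ball_measure]_x (phi (enorm x) * (G x + M)) =
    \int[ball_measure]_x (phi (enorm x) * G x) +
    M * \int[ball_measure]_x phi (enorm (x : 'rV[R]_n)).
  rewrite -RintegralZl// -RintegralD//; last exact: integrableRZ.
  by apply: eq_Rintegral => x _; rewrite mulrDr [M * _]mulrC.
have GME : \int[ball_measure]_x (G x + M) =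
    \int[ball_measure]_x G x + M * fine (ball_measure [set: 'rV[R]_n]).
  by rewrite RintegralD// Rintegral_cst.
move: polarE; rewrite phiGME GME phiG0 add0r.
set Phi := \int[ball_measure]_x phi (enorm (x : 'rV[R]_n)); set c1 := fine _.
set cG := \int[ball_measure]_x G x => E.
have /eqP : cG * Phi = 0 by lra.
rewrite mulf_eq0 => /orP[/eqP //|/eqP Phi0].
(* If the integral of [phi] vanishes, the ball of radius 1/2, on which [phi] is positive away from
   0, is null; by scaling the whole ball is null, and every integral over it is 0. *)
have B0 : ball_measure [set x : 'rV[R]_n | enorm x <= 2^-1] = 0%E.
  have : (\int[ball_measure]_x `|(phi (enorm (x : 'rV[R]_n)))%:E| = 0)%E.
    transitivity (\int[ball_measure]_x (phi (enorm (x : 'rV[R]_n)))%:E)%E.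
      apply: eq_integral => x _; rewrite gee0_abs// lee_fin.
      by have /andP[] := phi01 _ (enorm_ge0 x).
    by rewrite -[LHS]fineK ?(integrable_fin_num _ iphi)// -/(Rintegral _ _ _) -/Phi Phi0.
  have mEphi : measurable_fun setT (EFin \o (fun x : 'rV[R]_n => phi (enorm x))).
    exact/measurable_EFinP.
  move=> /(ae_eq_integral_abs _ measurableT mEphi)[N [mN N0 phiN]].
  have mle : measurable [set x : 'rV[R]_n | enorm x <= 2^-1].
    rewrite (_ : mkset _ = setT `&` @enorm R n @^-1` `]-oo, 2^-1]%classic).
      exact: measurable_enorm.
    by rewrite setTI; apply/seteqP; split=> x /=; rewrite in_itv.
  have mgt : measurable [set x : 'rV[R]_n | 0 < enorm x <= 1].
    exact: measurable_punctured_ball.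
  rewrite /ball_measure /= /mrestr.
  apply: (subset_measure0 (B := N `&` [set x | 0 < enorm x <= 1])) => //.
  - exact: measurableI.
  - exact: measurableI.
  move=> x [/= x2 /andP[x0 x1]]; split; last by rewrite /= x0.
  apply: phiN => /= /(_ I)/eqP; rewrite eqe /phi mulf_eq0 expf_eq0.
  have xlt1 : enorm x < 1 by apply: le_lt_trans x2 _; rewrite invf_lt1// ltr1n.
  have x2lt1 : 0 < 1 - enorm x ^+ 2 by rewrite subr_gt0 expr2; nra.
  by rewrite (gt_eqF x0) andbF /= (max_idPr _) ?gt_eqF// ltW.
have cG0 : ball_measure [set: 'rV[R]_n] = 0%E.
  have half : 0 < (2^-1 : R) <= 1 by rewrite invr_gt0 ltr0n /= invf_le1// ler1n.
  have := ge0_integral_ball_scale half (measurable_cst (1 : R)) (fun=> ler01)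
    (fun (_ : R) (_ : 'rV[R]_n) _ => erefl).
  rewrite -[fun x => (cst 1 x)%:E]/(cst 1%:E) !integral_cst// ?mul1e; last first.
    rewrite (_ : mkset _ = setT `&` @enorm R n @^-1` `]-oo, 2^-1]%classic).
      exact: measurable_enorm.
    by rewrite setTI; apply/seteqP; split=> x /=; rewrite in_itv.
  rewrite B0 => /esym/eqP; rewrite mule_eq0 => /orP[|/eqP//].
  by rewrite eqe expf_eq0 gt_eqF ?andbF// invr_gt0.
have nT (x : 'rV[R]_n) : ~ [set: 'rV[R]_n] x -> G x = cst 0 x by move=> /(_ I).
rewrite /cG (negligible_Rintegral measurableT cG0 mG (measurable_cst (0 : R)) nT).
by rewrite Rintegral_cst// mul0r.
Qed.

End integration_by_parts.

(** * Surface integrals and orthogonality between degrees *)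

Section sphere.
Context {R : realType} {d : nat}.

Lemma surface_measure_fin : (surface_measure d [set: 'rV[R]_d] < +oo)%E.
Proof.
rewrite /surface_measure /= /mscale /=; apply: lte_mul_pinfty => //.
exact: ball_measure_fin.
Qed.

Lemma surface_measure_sphereC :
  surface_measure d (~` @sphere R d) = 0%E.
Proof.
rewrite /surface_measure /= /mscale /= /pushforward /mrestr.
rewrite (_ : _ `&` _ = set0) ?measure0 ?mule0//.
apply/seteqP; split=> x //= [xS /andP[x0 _]]; apply: xS.
by rewrite /sphere /= enorm_radial// -enorm_gt0.
Qed.

Lemma measurable_sphere : measurable (@sphere R d).
Proof.
rewrite (_ : @sphere R d = setT `&` @enorm R d @^-1` [set 1]).
  exact: measurable_enorm.
by rewrite setTI.
Qed.

Lemma Rintegral_surface_measure (f : 'rV[R]_d -> R) M : measurable_fun setT f ->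
  (forall x, `|f (radial x)| <= M) ->
  (surface_measure d).-integrable setT (EFin \o f) /\
  \int[surface_measure d]_x f x = d%:R * \int[ball_measure]_x f (radial x).
Proof.
move=> mf fM.
have fi : ball_measure.-integrable setT (EFin \o (f \o @radial R d)).
  apply: (bounded_integrable ball_measure_fin _ fM).
  by apply: (measurableT_comp mf); exact: measurable_radial.
have [i1 E1] := Rintegral_image_measure (@measurable_radial R d) mf fi.
have [i2 E2] := Rintegral_mscale d%:R%:nng i1.
by split=> //; rewrite [LHS]E2 E1.
Qed.

Lemma Rintegral_sphere (f : 'rV[R]_d -> R) M : measurable_fun setT f ->
  (forall x, `|f (radial x)| <= M) ->
  \int[surface_measure d]_(x in @sphere R d) f x = \int[surface_measure d]_x f x.
Proof.
move=> mf fM; rewrite Rintegral_mkcond.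
apply: (negligible_Rintegral _ surface_measure_sphereC) => //.
- by apply: measurableC; exact: measurable_sphere.
- apply/(measurable_restrictT _ _).1; first exact: measurable_sphere.
  exact: measurable_funTS.
- by move=> x /contrapT xS; rewrite patchE mem_set.
Qed.

(** Completes the orthonormality of the basis, which relates members of one degree, by the pairs of
    different degrees. *)
Lemma sphere_orthogonal (P Q : mpoly d R) k l : k != l ->
  harmonic_homogeneous k P -> harmonic_homogeneous l Q ->
  \int[surface_measure d]_x (peval P x * peval Q x) = 0.
Proof.
move=> kl hP hQ.
have [M1 hM1] := peval_bounded P; have [M2 hM2] := peval_bounded Q.
have [|x|_ ->] := @Rintegral_surface_measure (fun x => peval P x * peval Q x) (M1 * M2).
- by apply: measurable_funM; exact: measurable_peval.
- by rewrite normrM ler_pM ?hM1 ?hM2// => i; exact: radial_coord_le1.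
by rewrite (Rintegral_ball_orthogonal _ hQ hP) ?mulr0// eq_sym.
Qed.

End sphere.

(** * Gauss quadrature in the square of the radius *)

Section gauss_polynomials.
Context {R : rcfType}.
Implicit Types (p q : {poly R}) (I : R -> Prop).

Definition order_convex I := forall a b c, I a -> I b -> a < c < b -> I c.

Lemma poly_ivt_lt q a b : a <= b -> q.[a] < 0 -> 0 < q.[b] ->
  exists c, root q c /\ a < c < b.
Proof.
move=> ab qa qb; have [|c /andP[ac cb] qc] := @poly_ivt _ q a b ab.
  by rewrite !ltW.
exists c; split=> //; rewrite !lt_neqAle ac cb !andbT; apply/andP; split.
  by apply: contraTneq qa => ->; rewrite (rootP qc) ltxx.
by apply: contraTneq qb => <-; rewrite (rootP qc) ltxx.
Qed.

(** The point [a] of [I] below the root keeps it off the left end of [I]; this later makes the Gauss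
    nodes positive, where inverse powers are harmless. *)
Lemma sign_change_root I q : order_convex I ->
  [\/ exists c, [/\ root q c, I c & exists2 a, I a & a < c],
      forall x, I x -> 0 <= q.[x] | forall x, I x -> q.[x] <= 0].
Proof.
move=> cI.
have [qge|/existsNP[a /not_implyP[Ia /negP]]] :=
  pselect (forall x, I x -> 0 <= q.[x]); first exact: Or32.
rewrite -ltNge => qa.
have [qle|/existsNP[b /not_implyP[Ib /negP]]] :=
  pselect (forall x, I x -> q.[x] <= 0); first exact: Or33.
rewrite -ltNge => qb; apply: Or31.
have [ab|ba] := leP a b.
  have [c [qc acb]] := poly_ivt_lt ab qa qb.
  exists c; split=> //; first exact: (cI a b).
  by exists a => //; case/andP: acb.
have [c [qc bca]] : exists c, root (- q) c /\ b < c < a.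
  by apply: poly_ivt_lt; rewrite ?hornerN ?oppr_lt0 ?oppr_gt0 ?ltW.
exists c; split; [by rewrite -rootN|exact: (cI b a)|exists b => //].
by case/andP: bca.
Qed.

(** [z] collects the points where [q] changes sign on [I]. Each factor [X - c] split off from [q]
    toggles the membership of [c]: added when absent, removed when present, since a double factor is
    a square. *)
Lemma const_sign_roots I q : order_convex I -> q != 0 ->
  exists z : seq R, [/\ uniq z,
    {in z, forall c, [/\ root q c, I c & exists2 a, I a & a < c]} &
    (forall x, I x -> 0 <= (q * \prod_(c <- z) ('X - c%:P)).[x]) \/
    (forall x, I x -> (q * \prod_(c <- z) ('X - c%:P)).[x] <= 0)].
Proof.
move=> cI; have [n] := ubnP (size q); elim: n q => // n IH q.
rewrite ltnS => qn q0.
have [[c [/factor_theorem[q' qE] Ic ac]]|qs|qs] := sign_change_root q cI; last 2 first.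
- by exists [::]; split=> //; left=> x Ix; rewrite big_nil mulr1; exact: qs.
- by exists [::]; split=> //; right=> x Ix; rewrite big_nil mulr1; exact: qs.
have q'0 : q' != 0 by apply: contraNneq q0 => q'0; rewrite qE q'0 mul0r.
have [|z [uz zr sz]] := IH q' _ q'0.
  by move: qn; rewrite qE size_Mmonic ?monicXsubC// size_XsubC addn2.
have [cz|cz] := boolP (c \in z).
  exists (rem c z); split; first exact: rem_uniq.
    move=> y; rewrite mem_rem_uniq// inE => /andP[_ /zr[ry Iy ay]].
    by split=> //; rewrite qE rootM ry.
  rewrite qE -mulrA; suff -> : ('X - c%:P) * \prod_(y <- rem c z) ('X - y%:P) =
    \prod_(y <- z) ('X - y%:P) by [].
  by rewrite (perm_big _ (perm_to_rem cz)) big_cons.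
exists (c :: z); split=> [|y|]; first by rewrite /= cz.
  rewrite inE => /orP[/eqP ->|/zr[ry Iy ay]].
    by split=> //; rewrite qE rootM root_XsubC eqxx orbT.
  by split=> //; rewrite qE rootM ry.
set Z := \prod_(y <- z) _ in sz.
have -> : q * \prod_(y <- c :: z) ('X - y%:P) = ('X - c%:P) ^+ 2 * (q' * Z).
  by rewrite big_cons -/Z qE expr2 -!mulrA mulrCA; congr (_ * _); rewrite mulrCA.
have s0 x : 0 <= (('X - c%:P) ^+ 2).[x] by rewrite horner_exp sqr_ge0.
by case: sz => sz; [left|right] => x /sz ?; rewrite hornerM;
  [exact: mulr_ge0|exact: mulr_ge0_le0].
Qed.

Lemma rVpoly_sum n (v : 'rV[R]_n) : rVpoly v = \sum_(i < n) v ord0 i *: 'X^i.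
Proof.
by rewrite /rVpoly poly_def; apply: eq_bigr => i _; rewrite valK.
Qed.

Section functional.
Variable L : {poly R} -> R.
Hypothesis L_linear : linear L.

Let LD p q : L (p + q) = L p + L q.
Proof. by have := L_linear 1 p q; rewrite !scale1r. Qed.

Let L0 : L 0 = 0.
Proof. by have := LD 0 0; rewrite addr0 => /eqP; rewrite addrC -subr_eq subrr => /eqP. Qed.

Let LZ c p : L (c *: p) = c * L p.
Proof. by have := L_linear c p 0; rewrite !addr0 L0 addr0. Qed.

Let LB p q : L (p - q) = L p - L q.
Proof. by rewrite LD -scaleN1r LZ mulN1r. Qed.

Let L_sum (J : Type) (r : seq J) (P : pred J) (F : J -> {poly R}) :
  L (\sum_(i <- r | P i) F i) = \sum_(i <- r | P i) L (F i).
Proof. exact: (big_morph L LD L0). Qed.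

(** [X^n] minus its projection onto lower degrees. The Gram matrix of the monomials is invertible,
    as a kernel vector would hold the coefficients of a nonzero [p] with [L (p ^+ 2) = 0]. *)
Lemma orthogonal_polynomial n :
  (forall p, p != 0 -> (size p <= n)%N -> L (p ^+ 2) != 0) ->
  exists q, [/\ q \is monic, size q = n.+1 &
    forall p, (size p <= n)%N -> L (q * p) = 0].
Proof.
move=> Lpos; pose G : 'M[R]_n := \matrix_(i, j) L ('X^i * 'X^j).
have LG (v : 'rV_n) p : (size p <= n)%N ->
    L (rVpoly v * p) = \sum_(j < n) p`_j * (v *m G) ord0 j.
  move=> pn; rewrite -[in LHS](coefK p) poly_def.
  rewrite (big_ord_widen n (fun i => p`_i *: 'X^i))// big_mkcond /=.
  rewrite mulr_sumr L_sum; apply: eq_bigr => j _.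
  case: ltnP => [_|pj]; last by rewrite mulr0 L0 nth_default// mul0r.
  rewrite -scalerAr LZ; congr (_ * _); rewrite mxE rVpoly_sum mulr_suml L_sum.
  by apply: eq_bigr => i _; rewrite -scalerAl LZ mxE.
have uG : G \in unitmx.
  rewrite unitmxE unitfE; apply/det0P => -[v v0 vG].
  have pv0 : rVpoly v != 0.
    by apply: contraNneq v0 => pv; rewrite -(rVpolyK v) pv linear0.
  have /negP := Lpos _ pv0 (size_poly _ _); apply; apply/eqP.
  rewrite expr2 LG ?size_poly// vG big1// => j _; by rewrite mxE mulr0.
pose b : 'rV[R]_n := \row_j L ('X^n * 'X^j).
pose c := rVpoly (b *m invmx G).
have cn : (size c < size ('X^n : {poly R}))%N by rewrite size_polyXn ltnS size_poly.
exists ('X^n - c); split=> [||p pn].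
- by rewrite monicE lead_coefDl ?size_polyN// lead_coefXn.
- by rewrite size_polyDl ?size_polyN// size_polyXn.
rewrite mulrBl LB LG// mulmxKV// -[in X in X - _](coefK p) poly_def.
rewrite (big_ord_widen n (fun i => p`_i *: 'X^i))// big_mkcond /=.
rewrite mulr_sumr L_sum; apply/eqP; rewrite subr_eq0; apply/eqP.
apply: eq_bigr => j _; rewrite mxE; case: ltnP => [_|pj].
  by rewrite -scalerAr LZ.
by rewrite mulr0 L0 nth_default// mul0r.
Qed.

(** The nodes are the roots of the orthogonal polynomial of degree n. The hypothesis on [L (p * g)]
    stands for the Cauchy-Schwarz inequality; definiteness is asked up to degree n because it is
    applied to that polynomial itself. *)
Lemma gauss_quadrature I n : order_convex I ->
  (forall p, (forall x, I x -> 0 <= p.[x]) -> 0 <= L p) ->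
  (forall p g, (forall x, I x -> 0 <= p.[x]) -> L p = 0 -> L (p * g) = 0) ->
  (forall p, p != 0 -> (size p <= n.+1)%N -> L (p ^+ 2) != 0) ->
  exists (z : seq R) (w : R -> R), [/\ uniq z, size z = n,
    {in z, forall c, [/\ 0 <= w c, I c & exists2 a, I a & a < c]} &
    forall p, (size p <= 2 * n)%N -> L p = \sum_(c <- z) w c * p.[c]].
Proof.
move=> cI Lge0 Leq0 Lpos.
have [|q [mq sq qL]] := @orthogonal_polynomial n.
  by move=> p p0 pn; apply: Lpos => //; exact: leqW.
have q0 : q != 0 by exact: monic_neq0.
have [z [uz zr sz]] := const_sign_roots cI q0.
set Z := \prod_(c <- z) _ in sz.
have Zq : Z %| q.
  apply: uniq_roots_dvdp; last by rewrite uniq_rootsE.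
  by apply/allP => c /zr[].
(* With fewer than n sign changes, [Z] would be orthogonal to [q] although [q * Z] has constant sign
   on [I]; then [q * Z] is null for [L], and so is its multiple [q ^+ 2]. *)
have zn : size z = n.
  have : (size z <= n)%N.
    by rewrite -ltnS -sq -(size_prod_XsubC z id); apply: dvdp_leq.
  rewrite leq_eqVlt => /orP[/eqP//|zn]; exfalso.
  have LqZ : L (q * Z) = 0 by apply: qL; rewrite size_prod_XsubC.
  have := Lpos q q0; rewrite sq => /(_ (leqnn _))/eqP; apply.
  have -> : q ^+ 2 = (q * Z) * (q %/ Z).
    by rewrite expr2 -mulrA [Z * _]mulrC divpK.
  case: sz => sz; first exact: Leq0.
  have -> : q * Z * (q %/ Z) = (- (q * Z)) * (- (q %/ Z)) by rewrite mulrNN.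
  apply: Leq0 => [x /sz|]; first by rewrite hornerN oppr_ge0.
  by rewrite -scaleN1r LZ LqZ mulr0.
have qZ : q = Z.
  apply/eqP; rewrite -eqp_monic//; last by rewrite monic_prod_XsubC.
  rewrite eqp_sym -dvdp_size_eqp//.
  by rewrite size_prod_XsubC sq zn.
(* The Lagrange polynomials of the nodes; their images under [L] are the weights. *)
pose l c := \prod_(y <- rem c z) ((c - y)^-1 *: ('X - y%:P)).
have lz c y : c \in z -> y \in z -> (l c).[y] = (y == c)%:R.
  move=> cz yz; rewrite horner_prod; have [->|yc] := eqVneq y c.
    rewrite big1_seq// => x /=; rewrite mem_rem_uniq// inE => /andP[xc _].
    by rewrite hornerZ hornerXsubC mulVf// subr_eq0 eq_sym.
  have yr : y \in rem c z by rewrite mem_rem_uniq// inE yc.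
  by rewrite (perm_big _ (perm_to_rem yr)) big_cons /= hornerZ hornerXsubC subrr mulr0 mul0r.
have sl c : c \in z -> (size (l c) <= n)%N.
  move=> cz; rewrite /l scaler_prod (leq_trans (size_scale_leq _ _))//.
  by rewrite size_prod_XsubC size_rem// zn; case: (n) zn cz => //; case: (z).
have LE p : (size p <= 2 * n)%N -> L p = \sum_(c <- z) L (l c) * p.[c].
  (* The quotient by [q] has degree below n, so orthogonality removes its contribution and leaves
     the remainder, which takes the values of [p] at the nodes. *)
  move=> pn; rewrite {1}(divp_eq p q) LD mulrC qL ?add0r; last first.
    by rewrite size_divp// sq /= leq_subLR addnn -mul2n.
  have rn : (size (p %% q)%R <= n)%N by rewrite -ltnS -sq ltn_modp.
  have -> : p %% q = \sum_(c <- z) p.[c] *: l c.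
    apply/eqP; rewrite -subr_eq0; apply/eqP.
    apply: (@roots_geq_poly_eq0 _ _ z) => //; last first.
      rewrite zn (leq_trans (size_polyD _ _))// geq_max rn size_polyN.
      apply: (leq_trans (size_sum _ _ _)); apply/bigmax_leqP_seq => c cz _.
      exact: leq_trans (size_scale_leq _ _) (sl _ cz).
    apply/allP => c cz; rewrite rootE hornerD hornerN horner_sum.
    rewrite (perm_big _ (perm_to_rem cz)) big_cons /= hornerZ lz// eqxx mulr1.
    rewrite big1_seq => [|y /=]; last first.
      rewrite mem_rem_uniq// inE => /andP[yc yz].
      by rewrite hornerZ lz// eq_sym (negbTE yc) mulr0.
    rewrite addr0 {2}(divp_eq p q) hornerD hornerM.
    have [/rootP -> _ _] := zr _ cz.
    by rewrite mulr0 add0r subrr.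
  rewrite L_sum; apply: eq_bigr => c _; by rewrite LZ mulrC.
exists z, (fun c => L (l c)); split=> // c cz.
have [_ Ic ac] := zr _ cz; split=> //.
(* [l c] and its square agree at all nodes, and the square still has degree below 2n, so exactness
   gives both the same image, which is nonnegative. *)
suff -> : L (l c) = L (l c ^+ 2) by apply: Lge0 => x _; rewrite horner_exp sqr_ge0.
rewrite [RHS]LE; last first.
  rewrite (leq_trans (size_poly_exp_leq _ _))//.
  have n0 : (0 < n)%N by rewrite -zn; case: (z) cz.
  rewrite (@leq_ltn_trans (n.-1 * 2))//; last by lia.
  by rewrite leq_mul2r -!subn1 leq_sub2r// sl.
rewrite (perm_big _ (perm_to_rem cz)) big_cons /= horner_exp lz// eqxx expr1n mulr1.
rewrite big1_seq ?addr0// => y /=; rewrite mem_rem_uniq// inE => /andP[yc yz].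
by rewrite horner_exp lz// (negbTE yc) expr0n mulr0.
Qed.

End functional.
End gauss_polynomials.

(** * Sign of the interpolation error of inverse powers *)

Section inverse_products.
Context {R : rcfType}.

(* As functions of [u = s ^+ 2], nonnegative combinations of products of the
   [(s + t)^-1] are stable under [F |-> - (F u - F u0) / (u - u0)], so that
   their divided differences alternate in sign; [s ^- k] is one of them. *)
Inductive inverse_product : (R -> R) -> Prop :=
| inverse_product0 : inverse_product (fun=> 0)
| inverse_product1 : inverse_product (fun=> 1)
| inverse_productD F G c : 0 <= c -> inverse_product F -> inverse_product G ->
    inverse_product (fun s => F s + c * G s)
| inverse_productV F (t : R) : 0 <= t -> inverse_product F ->
    inverse_product (fun s => F s / (s + t)).

Lemma inverse_product_ge0 F : inverse_product F -> forall s : R, 0 < s -> 0 <= F s.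
Proof.
elim=> // [{}F G c c0 _ IHF _ IHG|{}F t t0 _ IHF] s s0.
  by rewrite addr_ge0 ?mulr_ge0 ?IHF ?IHG.
by rewrite divr_ge0 ?IHF ?addr_ge0// ltW.
Qed.

Lemma inverse_product_difference F (u : R) : inverse_product F -> 0 < u ->
  exists2 G, inverse_product G &
    forall s : R, 0 < s -> F s = F u - (s ^+ 2 - u ^+ 2) * G s.
Proof.
move=> hF u0; elim: hF => [||{}F G c c0 hF [F' hF' F'E] hG [G' hG' G'E]|
  {}F t t0 hF [F' hF' F'E]].
- by exists (fun=> 0); [exact: inverse_product0|move=> s _; rewrite mulr0 subr0].
- by exists (fun=> 0); [exact: inverse_product0|move=> s _; rewrite mulr0 subr0].
- exists (fun s => F' s + c * G' s); first exact: inverse_productD.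
  by move=> s s0; rewrite (F'E s)// (G'E s)//; ring.
(* Divide the identity for [F] by [s + t] and use 1/(s + t) = 1/(u + t) - (s^2 - u^2) / ((s + t)(u +
   t)(s + u)). *)
- exists (fun s => F' s / (s + t) + (F u / (u + t)) * (1 / (s + t) / (s + u))).
    apply: inverse_productD.
    + by rewrite divr_ge0 ?(inverse_product_ge0 hF)// addr_ge0// ltW.
    + exact: inverse_productV.
    + apply: inverse_productV; [exact: ltW|apply: inverse_productV => //].
      exact: inverse_product1.
  move=> s s0; rewrite (F'E s)//; field.
  have pos (x y : R) : 0 < x -> 0 <= y -> x + y != 0.
    by move=> x0 y0; rewrite gt_eqF// ltr_wpDr.
  by rewrite !pos// ltW.
Qed.

Lemma inverse_product_exp k : inverse_product (fun s => s^-1 ^+ k).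
Proof.
elim: k => [|k IH].
  rewrite (_ : (fun _ => _) = fun=> 1); first exact: inverse_product1.
  by apply/funext => s; rewrite expr0.
rewrite (_ : (fun _ => _) = fun s => s^-1 ^+ k / (s + 0)).
  exact: inverse_productV.
by apply/funext => s; rewrite addr0 exprSr.
Qed.

(* Newton interpolation of [F] at the squares of [z], each taken twice. *)
Lemma double_interpolation (z : seq R) F : inverse_product F ->
  {in z, forall t : R, 0 < t} ->
  exists2 p : {poly R}, (size p <= 2 * size z)%N &
    exists2 G, inverse_product G & forall s : R, 0 < s ->
      F s = p.[s ^+ 2] + \prod_(t <- z) (s ^+ 2 - t ^+ 2) ^+ 2 * G s.
Proof.
move=> hF; elim: z => [|t z IH] z0.
  exists 0; first by rewrite size_poly0.
  by exists F => // s _; rewrite horner0 big_nil add0r mul1r.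
have [|p pz [G hG FE]] := IH; first by move=> x xz; apply: z0; rewrite inE xz orbT.
have t0 : 0 < t by apply: z0; exact: mem_head.
have [G1 hG1 GE] := inverse_product_difference hG t0.
have [G2 hG2 G1E] := inverse_product_difference hG1 t0.
pose Z : {poly R} := \prod_(x <- z) (('X - (x ^+ 2)%:P) ^+ 2).
(* Two differences at the same node: G = G(t) - (s^2 - t^2) G1(t) + (s^2 - t^2)^2 G2, the two minus
   signs cancelling in the remainder. *)
exists (p + Z * ((G t)%:P - G1 t *: ('X - (t ^+ 2)%:P))).
  have sZ : size Z = (2 * size z).+1.
    rewrite /Z; elim: (z) => [|x y IHy]; first by rewrite big_nil size_poly1.
    rewrite big_cons size_monicM ?monic_exp ?monicXsubC//; last first.
      by apply/monic_neq0/monic_prod => *; rewrite monic_exp ?monicXsubC.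
    by rewrite IHy size_exp_XsubC /=; lia.
  rewrite (leq_trans (size_polyD _ _))// geq_max; apply/andP; split.
    by rewrite (leq_trans pz)//= leq_mul2l leqnSn orbT.
  rewrite (leq_trans (size_polyMleq _ _))// sZ /= .
  rewrite mulnS addnC leq_add2r.
  rewrite (leq_trans (size_polyD _ _))// geq_max size_polyN.
  rewrite (leq_trans (size_polyC_leq1 _))//=.
  by rewrite (leq_trans (size_scale_leq _ _))// size_XsubC.
exists G2 => // s s0; rewrite FE// big_cons !hornerE/= GE// G1E//.
rewrite /Z horner_prod; under [in RHS]eq_bigr do rewrite horner_exp hornerXsubC.
by ring.
Qed.

End inverse_products.

Lemma measurable_seq {R : realType} (z : seq R) : measurable ([set` z] : set R).
Proof.
elim: z => [|t s IH]; first by rewrite set_nil.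
have -> : [set` t :: s] = [set t] `|` [set` s].
  apply/seteqP; split=> x /=; rewrite inE; first by case/orP => [/eqP|]; [left|right].
  by case=> [->|->]; rewrite ?eqxx ?orbT.
exact: measurableU.
Qed.

Section finite_support.
Context {R : realType}.
Variables (m : {measure set R -> \bar R}) (z : seq R).
Hypotheses (m_fin : (m setT < +oo)%E) (uz : uniq z) (mz : m (~` [set` z]) = 0%E).

Let fin_set1 (t : R) : m [set t] \is a fin_num.
Proof.
by rewrite ge0_fin_numE// (le_lt_trans _ m_fin)// le_measure// inE.
Qed.

Let indicator_sum (F : R -> R) x : ~ (~` [set` z]) x ->
  F x = \sum_(t <- z) F t * \1_[set t] x.
Proof.
move=> /contrapT /= xz; rewrite (bigD1_seq x)//= indicE mem_set// mulr1.
rewrite big1 ?addr0// => t tx; rewrite indicE memNset ?mulr0// => /= xt.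
by move: tx; rewrite xt eqxx.
Qed.

Let integrable_atom (F : R -> R) t :
  m.-integrable setT (EFin \o (fun x => F t * \1_[set t] x)).
Proof.
apply: (@bounded_integrable _ _ _ _ `|F t|) => //.
  by apply: measurable_funM => //; exact: measurable_indic.
by move=> x; rewrite normrM ler_piMr// indicE; case: (_ \in _); rewrite ?normr1 ?normr0.
Qed.

Let measurable_atoms (F : R -> R) :
  measurable_fun setT (fun x => \sum_(t <- z) F t * \1_[set t] x).
Proof.
by apply: measurable_sum => t; apply: measurable_funM => //; exact: measurable_indic.
Qed.

Lemma finite_support_Rintegral (F : R -> R) : measurable_fun setT F ->
  \int[m]_t F t = \sum_(t <- z) fine (m [set t]) * F t.
Proof.
move=> mF; rewrite (negligible_Rintegral _ mz mF (measurable_atoms F)).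
- rewrite Rintegral_sum => [|t]; last exact: integrable_atom.
  apply: eq_bigr => t _; rewrite RintegralZl//; last first.
    apply: (@bounded_integrable _ _ _ _ 1) => //.
    by move=> x; rewrite indicE; case: (_ \in _); rewrite ?normr1 ?normr0.
  by rewrite mulrC; congr (_ * _); rewrite /Rintegral integral_indic// setIT.
- by apply: measurableC; exact: measurable_seq.
- exact: indicator_sum.
Qed.

End finite_support.

(** * Quadrature for a measure on the half line *)

Section measure_quadrature.
Context {R : realType}.
Variables (m : {measure set R -> \bar R}) (J : set R).
Hypotheses (m_fin : (m setT < +oo)%E) (mJ : measurable J) (J_conv : m (~` J) = 0%E).
Hypotheses (J_ge0 : forall t, J t -> 0 <= t) (J_convex : order_convex J).
Hypothesis m_moments : forall n, m.-integrable setT (fun t => (t ^+ n)%:E).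

(** The image of [m] under squaring, as a functional on polynomials. *)
Let L (p : {poly R}) := \int[m]_t p.[t ^+ 2].

Let measurable_even (p : {poly R}) : measurable_fun setT (fun t : R => p.[t ^+ 2]).
Proof.
apply: (measurableT_comp (f := horner p)); last exact: measurable_funX.
by apply: continuous_measurable_fun; exact: continuous_horner.
Qed.

Let measurable_nonroots (p : {poly R}) : measurable [set t : R | p.[t ^+ 2] != 0].
Proof.
have := measurable_even p measurableT (measurableC (measurable_set1 0)).
rewrite setTI; congr measurable.
by apply/seteqP; split=> t /= /eqP.
Qed.

Let integrable_even (p : {poly R}) : m.-integrable setT (EFin \o (fun t : R => p.[t ^+ 2])).
Proof.
rewrite (_ : _ \o _ = (fun t => \sum_(i < size p) (p`_i)%:E * (t ^+ (2 * i))%:E)%E).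
  by apply: integrable_sum => // i _; exact: integrableZl.
apply/funext => t /=; rewrite horner_coef -sumEFin; apply: eq_bigr => i _.
by rewrite -EFinM exprM.
Qed.

Let L_linear : linear L.
Proof.
move=> c p q; rewrite /L.
under eq_Rintegral do rewrite hornerD hornerZ.
rewrite RintegralD//; last exact: (integrableZl measurableT c (integrable_even p)).
by rewrite RintegralZl//; exact: integrable_even.
Qed.

Let mJC : measurable (~` J). Proof. exact: measurableC. Qed.

Let L_ge0 p : (forall u, 0 <= u /\ J (Num.sqrt u) -> 0 <= p.[u]) -> 0 <= L p.
Proof.
move=> p0; rewrite /L.
rewrite (@negligible_Rintegral _ _ _ m (~` J) _ (fun t => `|p.[t ^+ 2]|))//.
- by apply: Rintegral_ge0 => t _.
- by apply: measurableT_comp => //; exact: measurable_even.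
move=> t /contrapT Jt; rewrite ger0_norm// p0//; split; first exact: sqr_ge0.
by rewrite sqrtr_sqr ger0_norm// J_ge0.
Qed.

Let L_eq0 p : (forall u, 0 <= u /\ J (Num.sqrt u) -> 0 <= p.[u]) -> L p = 0 ->
  m [set t | p.[t ^+ 2] != 0] = 0%E.
Proof.
move=> p0 Lp0.
have := integrable_fin_num measurableT (integrable_even p).
move=> /fineK; rewrite -/(Rintegral m setT (fun t => p.[t ^+ 2])) -/(L p) Lp0.
have mp : measurable_fun setT (EFin \o (fun t : R => p.[t ^+ 2])).
  exact/measurable_EFinP.
rewrite (@ae_eq_integral _ _ _ m setT (abse \o (EFin \o (fun t : R => p.[t ^+ 2]))))//.
- move=> /esym/(ae_eq_integral_abs _ measurableT mp)[N [mN N0 pN]].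
  apply/eqP; rewrite eq_le measure_ge0 andbT -N0 le_measure ?inE//.
  move=> t /= pt; apply: pN => /= /(_ I)[/eqP]; exact/negP.
- exact: measurableT_comp.
exists (~` J); split=> // t /= tJ Jt; apply: tJ => _.
rewrite ger0_norm// p0//; split; first exact: sqr_ge0.
by rewrite sqrtr_sqr ger0_norm// J_ge0.
Qed.

Let L_eq0M p g : (forall u, 0 <= u /\ J (Num.sqrt u) -> 0 <= p.[u]) -> L p = 0 ->
  L (p * g) = 0.
Proof.
move=> p0 Lp0.
have mN : measurable [set t : R | p.[t ^+ 2] != 0].
  exact: measurable_nonroots.
rewrite /L (negligible_Rintegral mN (L_eq0 p0 Lp0) (measurable_even _)
  (measurable_cst (0 : R))); first by rewrite Rintegral_cst// mul0r.
by move=> t /= /negP/negPn/eqP pt; rewrite hornerM pt mul0r.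
Qed.

Let I : R -> Prop := fun u => 0 <= u /\ J (Num.sqrt u).

Let I_convex : order_convex I.
Proof.
move=> a b c [a0 Ja] [b0 Jb] /andP[ac cb].
have c0 : 0 < c by exact: le_lt_trans ac.
split; first exact: ltW.
by apply: (J_convex Ja Jb); rewrite !ltr_sqrt ?ac//; exact: lt_trans cb.
Qed.

(** Either [m] is carried by at most n points and is its own quadrature, or the functional is
    definite up to degree n and Gauss quadrature applies. The clause on the node 0 serves positive
    degrees k, where weights get divided by [t ^+ k]. *)
Lemma measure_quadrature n : exists (z : seq R) (w : R -> R),
  [/\ uniq z, (size z <= n)%N,
    {in z, forall t : R, [/\ J t, 0 <= w t & m [set 0] = 0%E -> t = 0 -> w t = 0]},
    forall p : {poly R}, (size p <= 2 * n)%N ->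
      \int[m]_t p.[t ^+ 2] = \sum_(t <- z) w t * p.[t ^+ 2] &
    forall k, m [set 0] = 0%E ->
      m.-integrable setT (EFin \o (fun t : R => t^-1 ^+ k)) ->
      \sum_(t <- z) w t * t^-1 ^+ k <= \int[m]_t t^-1 ^+ k].
Proof.
have [[p [p0 [pn Lp0]]]|/forallNP Lpos] := pselect (exists p : {poly R}, p != 0 /\
    (size p <= n.+1)%N /\ L (p ^+ 2) = 0).
  (* The zeros of [p.[t ^+ 2]] in [J], obtained as a list of maximal length; squaring is injective
     on [J], so there are at most n of them. *)
  pose S (z : seq R) := [/\ uniq z, {in z, forall t : R, J t /\ p.[t ^+ 2] = 0} &
    (size z <= n)%N].
  have S0 : exists k, `[<exists z, S z /\ size z = k>].
    by exists 0%N; apply/asboolP; exists [::].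
  have Sn k : `[<exists z, S z /\ size z = k>] -> (k <= n)%N.
    by move=> /asboolP[z [[_ _ zn] <-]].
  have [_ /asboolP[z [[uz zJ zn] <-]] zmax] := ex_maxnP S0 Sn.
  have zall t : J t -> p.[t ^+ 2] = 0 -> t \in z.
    move=> Jt pt; apply/negP => tz.
    have tzJ : {in t :: z, forall t : R, J t /\ p.[t ^+ 2] = 0}.
      by move=> y; rewrite inE => /orP[/eqP ->|/zJ].
    suff : (size (t :: z) <= size z)%N by rewrite /= ltnn.
    apply: zmax; apply/asboolP; exists (t :: z); split=> //; split=> //.
      by rewrite /= uz (introN idP tz).
    rewrite -(size_map (fun x => x ^+ 2)) -ltnS (leq_trans _ pn)//.
    apply: max_poly_roots => //.
      by apply/allP => _ /mapP[y /tzJ[_ py] ->]; apply/rootP.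
    rewrite map_inj_in_uniq => [|x y xz yz xy].
      by rewrite /= uz (introN idP tz).
    by apply/eqP; rewrite -(@eqrXn2 _ 2)// ?xy// J_ge0//; have [] := tzJ _ xz; have [] := tzJ _ yz.
  have mz : m (~` [set` z]) = 0%E.
    have Np : m [set t | p.[t ^+ 2] != 0] = 0%E.
      rewrite -(@L_eq0 (p ^+ 2))//; last by move=> u _; rewrite horner_exp sqr_ge0.
      by congr (m _); apply/seteqP; split=> t /=; rewrite horner_exp expf_eq0.
    have mNp : measurable [set t : R | p.[t ^+ 2] != 0].
      exact: measurable_nonroots.
    apply: (subset_measure0 _ _ _ (null_set_setU mJC mNp J_conv Np)).
    - by apply: measurableC; exact: measurable_seq.
    - exact: measurableU.
    move=> t /= tz; have [Jt|] := pselect (J t); last by left.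
    by right; apply/negP => /eqP pt; apply: tz; exact: zall.
  exists z, (fun t => fine (m [set t])); split=> //.
  - move=> t /zJ[Jt _]; split=> [//||m0 ->]; last by rewrite m0.
    exact: fine_ge0.
  - by move=> q _; exact: finite_support_Rintegral.
  - move=> k _ /measurable_int/measurable_EFinP mk.
    by rewrite (finite_support_Rintegral m_fin uz mz mk).
have [||p p0 pn|z [w [uz sz zw zE]]] := gauss_quadrature (L := L) (n := n) L_linear I_convex.
- exact: L_ge0.
- exact: L_eq0M.
- by apply/negP => /eqP Lp; apply: (Lpos p).
exists (map Num.sqrt z), (fun t => w (t ^+ 2)).
have z0 : {in z, forall c : R, 0 <= c} by move=> c /zw[_ []].
split.
- rewrite map_inj_in_uniq// => x y /z0 x0 /z0 y0 /eqP.
  by rewrite eqr_sqrt// => /eqP.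
- by rewrite size_map sz.
- move=> _ /mapP[c /zw[wc [c0 Jc] [b [b0 _] bc]] ->]; rewrite sqr_sqrtr//; split=> // _ /eqP.
  by rewrite sqrtr_eq0 leNgt (le_lt_trans b0 bc).
- move=> p pn; rewrite -/(L p) zE// big_map; apply: eq_big_seq => c /z0 c0.
  by rewrite sqr_sqrtr.
move=> k m0 ik.
(* The interpolant with doubled nodes has size at most 2n, so the rule integrates it exactly, and
   the remainder is nonnegative on the positive reals. *)
have [|p pz [G hG FE]] := double_interpolation (z := map Num.sqrt z) (inverse_product_exp k).
  move=> _ /mapP[c /zw[_ _ [a [a0 _] ac]] ->].
  by rewrite sqrtr_gt0 (le_lt_trans a0).
rewrite size_map sz in pz.
have -> : \sum_(t <- map Num.sqrt z) w (t ^+ 2) * t^-1 ^+ k = L p.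
  rewrite zE// big_map; apply: eq_big_seq => c cz; have c0 := z0 _ cz.
  rewrite sqr_sqrtr// FE; last first.
    by have [_ _ [a [a0 _] ac]] := zw _ cz; rewrite sqrtr_gt0 (le_lt_trans a0).
  rewrite big_map (bigD1_seq c)//= subrr expr0n mul0r mul0r addr0.
  by rewrite sqr_sqrtr.
rewrite -subr_ge0 -RintegralB//.
have mF := (measurable_EFinP _ _).1 (measurable_int _ ik).
(* The sign of the remainder is known on the positive part of [J]; the rest is null, so an absolute
   value may be inserted. *)
rewrite (@negligible_Rintegral _ _ _ m (~` J `|` [set 0]) _
  (fun t => `|t^-1 ^+ k - p.[t ^+ 2]|)).
- by apply: Rintegral_ge0.
- exact: measurableU.
- exact: null_set_setU.
- by apply: measurable_funB => //; exact: measurable_even.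
- by apply: measurableT_comp => //; apply: measurable_funB => //; exact: measurable_even.
move=> t /not_orP[/contrapT Jt /eqP t0].
have {}t0 : 0 < t by rewrite lt_neqAle eq_sym t0 J_ge0.
rewrite ger0_norm// FE// addrC addKr mulr_ge0 ?(inverse_product_ge0 hG)//.
by apply: prodr_ge0 => *; exact: sqr_ge0.
Qed.

End measure_quadrature.

(** * Component measures of a pseudo-positive charge *)

Section measure_difference.
Context {R : realType}.
Variables (p n : {measure set R -> \bar R}).
Hypotheses (p_fin : (p setT < +oo)%E) (n_fin : (n setT < +oo)%E).
Hypothesis np : forall a b : R, a <= b -> (n `]a, b]%classic <= p `]a, b]%classic)%E.

Let fin_measure (q : {measure set R -> \bar R}) A : (q setT < +oo)%E ->
  measurable A -> q A \is a fin_num.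
Proof.
move=> qT mA; rewrite ge0_fin_numE//; apply: le_lt_trans qT.
by apply: le_measure; rewrite ?inE.
Qed.

Let distribution_right_continuous (q : {measure set R -> \bar R}) (x : R) :
  (q setT < +oo)%E ->
  fine (q `]-oo, t]%classic) @[t --> x^'+] --> fine (q `]-oo, x]%classic).
Proof.
move=> qT; apply/cvg_at_rightP => u [ux ucvg].
have E t : fine (q `]-oo, t]%classic) = \int[q]_y \1_(`]-oo, t]%classic) y.
  by rewrite /Rintegral integral_indic// setIT.
rewrite E; under eq_cvg do rewrite E.
apply: (@dominated_Rintegral _ _ _ q _ _ (cst 1)) => //.
- by move=> k; exact: measurable_indic.
- move=> y; have [yx|xy] := leP y x.
    apply: cvg_near_cst; near=> k.
    by rewrite !indicE !mem_set//= in_itv//= (le_trans yx)// ltW.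
  apply: cvg_near_cst; near=> k.
  rewrite !indicE !memNset//= in_itv /= ?leNgt; first by rewrite xy.
  apply/negP; rewrite negbK; near: k; exact: (cvgr_lt x).
- by apply: (bounded_integrable qT (M := 1)) => //= y; rewrite normr1.
- by move=> k y; rewrite indicE; case: (_ \in _); rewrite ?normr1 ?normr0.
Unshelve. all: by end_near. Qed.

Let F (t : R) : R := fine (p `]-oo, t]%classic) - fine (n `]-oo, t]%classic).

Let measure_itv (q : {measure set R -> \bar R}) (a b : R) : (q setT < +oo)%E ->
  a <= b ->
  fine (q `]a, b]%classic) = fine (q `]-oo, b]%classic) - fine (q `]-oo, a]%classic).
Proof.
move=> qT ab.
have := fin_measure qT (measurable_itv `]-oo, b]).
have := fin_measure qT (measurable_itv `]-oo, a]).
have -> : `]a, b]%classic = `]-oo, b] `\` `]-oo, a] :> set R.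
  by rewrite -[RHS]setCK setCD setCitvl setUC -[LHS]setCK setCitv.
move=> fa fb; rewrite measureD ?setIidr//; last by rewrite ltey_eq fb.
  by rewrite fineB.
exact: subset_itvl.
Qed.

Let F_nondecreasing : {homo F : a b / a <= b}.
Proof.
move=> a b ab; rewrite -subr_ge0.
have -> : F b - F a = fine (p `]a, b]%classic) - fine (n `]a, b]%classic).
  by rewrite !measure_itv// /F; ring.
by rewrite subr_ge0 fine_le ?fin_measure// np.
Qed.

Let F_right_continuous : right_continuous F.
Proof. by move=> x; apply: cvgB; exact: distribution_right_continuous. Qed.

HB.instance Definition _ := isCumulative.Build R _ R F
  F_nondecreasing F_right_continuous.

(** [R] and [measurableTypeR R] are the same Borel space under two structures; these identities
    carry measures from one to the other. *)
Let measurable_idTR : measurable_fun setT (idfun : measurableTypeR R -> R).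
Proof. by move=> _ B mB; rewrite setTI. Qed.
Let measurable_idRT : measurable_fun setT (idfun : R -> measurableTypeR R).
Proof. by move=> _ B mB; rewrite setTI. Qed.

(** The difference of the two distribution functions is nondecreasing by the comparison on
    intervals, and its Stieltjes measure is the difference sought; half-open intervals determine the
    sum with [n]. *)
Lemma measure_difference : exists m : {measure set R -> \bar R},
  forall A, measurable A -> (m A + n A = p A)%E.
Proof.
exists (image_measure (lebesgue_stieltjes_measure F) measurable_idTR) => A mA.
pose m1 := measure_add (lebesgue_stieltjes_measure F) (image_measure n measurable_idRT).
have lsE (a b : R) : a <= b ->
    lebesgue_stieltjes_measure F `]a, b]%classic = (F b - F a)%:E.
  move=> ab; rewrite -(wlength_itv_bnd F false false ab).
  exact: (measurable_mu_extE (wlength F) (is_ocitv a b)).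
rewrite -[LHS](measure_addE' (lebesgue_stieltjes_measure F) (image_measure n measurable_idRT) A).
apply: (@measure_unique _ R (measurableTypeR R) (@ocitv R)
   (fun k => `](- k%:R)%R, k%:R]%classic) _ _ _ _ m1 (image_measure p measurable_idRT)) => //.
- exact: ocitvI.
- by move=> k; exact: is_ocitv.
- apply/seteqP; split=> // x _; exists (Num.bound `|x|) => //=; rewrite in_itv /=.
  have := archi_boundP (normr_ge0 x); rewrite ltr_norml => /andP[-> /ltW].
  by [].
- move=> _ [[a b] _ <-] /=.
  rewrite [LHS](measure_addE' (lebesgue_stieltjes_measure F)).
  have [ab | ba] := leP a b; last first.
    by rewrite set_itv_ge ?measure0 ?adde0// bnd_simp -leNgt ltW.
  transitivity ((F b - F a)%:E + n `]a, b]%classic)%E.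
    by congr (_ + _)%E; exact: lsE.
  have -> : F b - F a = fine (p `]a, b]%classic) - fine (n `]a, b]%classic).
    by rewrite !measure_itv// /F; ring.
  by rewrite EFinB !fineK ?fin_measure// subeK ?fin_measure.
- move=> k; rewrite [ltLHS]measure_addE'.
  rewrite lte_add_pinfty//.
    by rewrite [ltLHS]lsE ?ltry// (le_trans (y := 0))// oppr_le0.
  by have := fin_measure n_fin (measurable_itv `]- k%:R, k%:R]); rewrite ge0_fin_numE.
Qed.
End measure_difference.

Section measure_sums.
Context d (T : measurableType d) (R : realType).

Lemma Rintegral_measure_add (m1 m2 : {measure set T -> \bar R}) (f : T -> R) :
  m1.-integrable setT (EFin \o f) -> m2.-integrable setT (EFin \o f) ->
  \int[measure_add m1 m2]_x f x = \int[m1]_x f x + \int[m2]_x f x.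
Proof.
move=> f1 f2; have mf : measurable_fun setT f by apply/measurable_EFinP; case/integrableP: f1.
rewrite /Rintegral -fineD ?integrable_fin_num//; congr fine.
exact: integral_measure_add.
Qed.

Lemma Rintegral_image_density d' (T' : measurableType d') (m : {measure set T -> \bar R})
    (g : T -> R) (mg : measurable_fun setT g) (g0 : forall x, 0 <= g x)
    (phi : T -> T') (mphi : measurable_fun setT phi) (h : T' -> R) :
  measurable_fun setT h -> m.-integrable setT (EFin \o (fun x => h (phi x) * g x)) ->
  (image_measure (density m mg g0) mphi).-integrable setT (EFin \o h) /\
  \int[image_measure (density m mg g0) mphi]_t h t = \int[m]_x (h (phi x) * g x).
Proof.
move=> mh hi; have mhphi : measurable_fun setT (h \o phi) by exact: measurableT_comp.
have [|ii ->] := Rintegral_image_measure (m := density m mg g0) mphi mh.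
  exact: integrable_density.
by split=> //; exact: Rintegral_density.
Qed.

End measure_sums.

Section radial_component.
Context {R : realType} {d : nat}.
Variables (mu : {charge set 'rV[R]_d -> \bar R}) (Q : 'rV[R]_d -> R).
Hypotheses (mQ : measurable_fun setT Q) (iQ : cintegrable mu Q).
Hypothesis Q_ge0 : forall a b : R, a <= b ->
  0 <= cintegral mu (fun x => \1_(`]a, b]%classic) (enorm x) * Q x).

Let Qp (x : 'rV[R]_d) : R := Num.max (Q x) 0.
Let Qn (x : 'rV[R]_d) : R := Num.max (- Q x) 0.
Let mQp : measurable_fun setT Qp. Proof. exact: measurable_maxr. Qed.
Let mQn : measurable_fun setT Qn.
Proof. by apply: measurable_maxr => //; exact: measurable_funN. Qed.
Let Qp0 x : 0 <= Qp x. Proof. by rewrite le_max lexx orbT. Qed.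
Let Qn0 x : 0 <= Qn x. Proof. by rewrite le_max lexx orbT. Qed.
Let QE x : Q x = Qp x - Qn x.
Proof. by rewrite /Qp /Qn; case: (leP (Q x) 0); case: (leP (- Q x) 0); lra. Qed.
Let Qp_le x : Qp x <= `|Q x|. Proof. by rewrite ge_max ler_norm normr_ge0. Qed.
Let Qn_le x : Qn x <= `|Q x|. Proof. by rewrite ge_max -normrN ler_norm normr_ge0. Qed.

(** A decomposition [p - n] of the image of [Q mu] under |x|: [p] collects the products of parts of
    equal sign, [n] those of opposite sign. *)
Let p1 := image_measure (density (charge_pos mu) mQp Qp0) (@measurable_enorm R d).
Let p2 := image_measure (density (charge_neg mu) mQn Qn0) (@measurable_enorm R d).
Let n1 := image_measure (density (charge_pos mu) mQn Qn0) (@measurable_enorm R d).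
Let n2 := image_measure (density (charge_neg mu) mQp Qp0) (@measurable_enorm R d).
Let p : {measure set R -> \bar R} := measure_add p1 p2.
Let n : {measure set R -> \bar R} := measure_add n1 n2.

Let radial_integral (h : R -> R) : measurable_fun setT h ->
  cintegrable mu (fun x => h (enorm x) * Q x) ->
  [/\ p.-integrable setT (EFin \o h), n.-integrable setT (EFin \o h) &
  \int[p]_t h t - \int[n]_t h t = cintegral mu (fun x => h (enorm x) * Q x)].
Proof.
move=> mh /cintegrableP[ip iN].
have mhe := measurableT_comp mh (@measurable_enorm R d).
have bound (g : 'rV[R]_d -> R) (m : {measure set 'rV[R]_d -> \bar R}) :
    measurable_fun setT g -> (forall x, 0 <= g x) -> (forall x, g x <= `|Q x|) ->
    m.-integrable setT (EFin \o (fun x => h (enorm x) * Q x)) ->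
    m.-integrable setT (EFin \o (fun x => h (enorm x) * g x)).
  move=> mg g0 gQ hm.
  apply: (le_integrableR _ (g := fun x => `|h (enorm x) * Q x|)).
  - exact: measurable_funM.
  - by move=> x; rewrite !normrM ler_wpM2l// ger0_norm.
  - exact: integrable_abse hm.
have [i1 E1] := Rintegral_image_density mQp Qp0 (@measurable_enorm R d) mh
  (bound _ _ mQp Qp0 Qp_le ip).
have [i2 E2] := Rintegral_image_density mQn Qn0 (@measurable_enorm R d) mh
  (bound _ _ mQn Qn0 Qn_le iN).
have [i3 E3] := Rintegral_image_density mQn Qn0 (@measurable_enorm R d) mh
  (bound _ _ mQn Qn0 Qn_le ip).
have [i4 E4] := Rintegral_image_density mQp Qp0 (@measurable_enorm R d) mh
  (bound _ _ mQp Qp0 Qp_le iN).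
split; [exact: integrable_measure_add|exact: integrable_measure_add|].
rewrite !Rintegral_measure_add// E1 E2 E3 E4 /cintegral.
have split_int (m : {measure set 'rV[R]_d -> \bar R}) :
    m.-integrable setT (EFin \o (fun x => h (enorm x) * Q x)) ->
    \int[m]_x (h (enorm x) * Q x) =
    \int[m]_x (h (enorm x) * Qp x) - \int[m]_x (h (enorm x) * Qn x).
  move=> hm; rewrite -RintegralB//; try exact: bound.
  by apply: eq_Rintegral => x _; rewrite QE mulrBr.
by rewrite !split_int//; ring.
Qed.

Lemma radial_component : exists m : {measure set R -> \bar R},
  (m setT < +oo)%E /\
  forall h : R -> R, measurable_fun setT h -> cintegrable mu (fun x => h (enorm x) * Q x) ->
    m.-integrable setT (EFin \o h) /\
    \int[m]_t h t = cintegral mu (fun x => h (enorm x) * Q x).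
Proof.
have [] := @radial_integral (cst 1) => //.
  by apply: eq_integrable iQ => // x _ /=; rewrite mul1r.
have finT (q : {measure set R -> \bar R}) : q.-integrable setT (EFin \o cst (1 : R)) ->
    (q setT < +oo)%E.
  move=> /(integrable_lty measurableT).
  by rewrite -[EFin \o _]/(cst 1%:E) integral_cst// mul1e.
move=> /finT p_fin /finT n_fin _.
have [m mE] : exists m : {measure set R -> \bar R}, forall A, measurable A ->
    (m A + n A = p A)%E.
  apply: measure_difference => // a b ab.
  have m1 : measurable_fun setT (\1_(`]a, b]%classic) : R -> R) by exact: measurable_indic.
  have [] := @radial_integral (\1_(`]a, b]%classic)) => //.
    apply: (le_integrableR _ _ (integrable_abse iQ)).
      by apply: measurable_funM => //; apply: measurableT_comp => //; exact: measurable_enorm.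
    by move=> x; rewrite normrM ler_piMl// indicE; case: (_ \in _); rewrite ?normr1 ?normr0.
  move=> ip iN E; have := Q_ge0 ab; rewrite -E subr_ge0.
  rewrite /Rintegral !integral_indic ?setIT//.
  have fin (q : {measure set R -> \bar R}) : (q setT < +oo)%E -> q `]a, b]%classic \is a fin_num.
    by move=> qT; rewrite ge0_fin_numE//; apply: le_lt_trans qT; apply: le_measure; rewrite ?inE.
  by rewrite -lee_fin !fineK ?fin.
exists m; split.
  by apply: le_lt_trans p_fin; rewrite -mE// leeDl.
move=> h mh ih; have [ip iN <-] := radial_integral mh ih.
have im : m.-integrable setT (EFin \o h).
  by apply: le_measure_integrable ip => A mA; rewrite -mE// leeDl.
split=> //; have <- : \int[measure_add m n]_t h t = \int[p]_t h t.
  congr fine; apply: eq_measure_integral => A mA _.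
  exact: etrans (measure_addE' m n A) (mE A mA).
by rewrite Rintegral_measure_add// addrK.
Qed.

End radial_component.

Lemma measurable_enorm_comp {R : realType} {d : nat} (h : R -> R) :
  measurable_fun setT h -> measurable_fun setT (fun x : 'rV[R]_d => h (enorm x)).
Proof. by move=> mh; apply: measurableT_comp => //; exact: measurable_enorm. Qed.

(** * Continuous approximations of interval indicators *)

Section interval_approximation.
Context {R : realType}.
Implicit Types a b t : R.

Definition clip t : R := Num.min 1 (Num.max 0 t).

Lemma clip_ge0 t : 0 <= clip t. Proof. by rewrite le_min ler01 le_max lexx. Qed.

Lemma clip_le1 t : clip t <= 1. Proof. by rewrite ge_min lexx. Qed.

Lemma clip_le0 t : t <= 0 -> clip t = 0.
Proof. by move=> t0; rewrite /clip (max_idPl t0) (min_idPr _)// ler01. Qed.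

Lemma clip_ge1 t : 1 <= t -> clip t = 1.
Proof.
by move=> t1; rewrite /clip (max_idPr (le_trans ler01 t1)) (min_idPl _).
Qed.

Lemma le_clip t t' : t <= t' -> clip t <= clip t'.
Proof. by move=> tt'; rewrite /clip !minEle !maxEle; do !case: ifP; lra. Qed.

Lemma clip_continuous : continuous clip.
Proof.
move=> t; apply: (@continuous_comp _ _ _ (fun t => Num.max 0 t) (fun t => Num.min 1 t)).
  by apply: continuous_max; [exact: cvg_cst|exact: cvg_id].
by apply: continuous_min; [exact: cvg_cst|exact: cvg_id].
Qed.

(** A trapezoid rising to the right of [a] and falling to the right of [b], hence the half-open
    limit []a, b]] and a support inside [[a, b + 1]]. *)
Definition ramp a b (n : nat) t := clip (n.+1%:R * (t - a)) - clip (n.+1%:R * (t - b)).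

Lemma ramp_ge0 a b n t : a <= b -> 0 <= ramp a b n t.
Proof. by move=> ab; rewrite subr_ge0 le_clip// ler_pM2l ?ltr0n// lerB. Qed.

Lemma ramp_norm_le1 a b n t : a <= b -> `|ramp a b n t| <= 1.
Proof.
move=> ab; rewrite ger0_norm ?ramp_ge0// /ramp.
by have := clip_le1 (n.+1%:R * (t - a)); have := clip_ge0 (n.+1%:R * (t - b)); lra.
Qed.

Lemma ramp_supp a b n t : a <= b -> ramp a b n t != 0 -> a <= t <= b + 1.
Proof.
move=> ab; apply: contra_neqT; rewrite negb_and -!ltNge => /orP[ta|tb].
  rewrite /ramp !clip_le0 ?subrr//; apply: mulr_ge0_le0 => //; lra.
have n1 : 1 <= n.+1%:R :> R by rewrite ler1n.
rewrite /ramp !clip_ge1 ?subrr//; nra.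
Qed.

Lemma ramp_continuous a b n : continuous (ramp a b n).
Proof.
have c (e : R) : continuous (fun t : R => clip (n.+1%:R * (t - e))).
  move=> t; apply: (@continuous_comp _ _ _ (fun t => n.+1%:R * (t - e)) clip).
    by apply: cvgM; [exact: cvg_cst|apply: cvgB; [exact: cvg_id|exact: cvg_cst]].
  exact: clip_continuous.
by move=> t; apply: cvgB; exact: c.
Qed.

Lemma ramp_cvg a b t : a <= b ->
  (ramp a b n t : R) @[n --> \oo] --> (\1_(`]a, b]%classic) t : R).
Proof.
move=> ab.
have c (e : R) : (clip (n.+1%:R * (t - e)) : R) @[n --> \oo] --> ((e < t)%R%:R : R).
  have [et|te] := ltP e t.
    apply: cvg_near_cst; near=> n; apply: clip_ge1.
    rewrite -ler_pdivrMr ?subr_gt0// mul1r (@le_trans _ _ n%:R)// ?ler_nat//.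
    by near: n; exact: nbhs_infty_ger.
  apply: cvg_near_cst; near=> n; apply: clip_le0.
  by rewrite pmulr_rle0 ?ltr0n// subr_le0.
have -> : \1_(`]a, b]%classic) t = (a < t)%R%:R - (b < t)%R%:R :> R.
  rewrite indicE mem_setE /= in_itv /=; case: (ltP b t) => bt; rewrite ?subrr ?subr0 ?andbT//.
  by rewrite andbF (le_lt_trans ab bt) subrr.
by apply: cvgB; exact: c.
Unshelve. all: by end_near. Qed.

End interval_approximation.

Section pseudo_positive_component.
Context {R : realType} {d : nat} {a : nat -> nat}.
Variables (Y : forall k, 'I_(a k) -> mpoly d R) (mu : {charge set 'rV[R]_d -> \bar R}).
Hypotheses (mu_pos : pseudo_positive Y mu) (mu_moment : moment_measure mu).

(** Pseudo-positivity speaks of continuous test functions with compact support; dominated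
    convergence along ramps extends it to half-open intervals. *)
Lemma pseudo_positive_component k (l : 'I_(a k)) : exists m : {measure set R -> \bar R},
  (m setT < +oo)%E /\
  forall h : R -> R, measurable_fun setT h ->
    cintegrable mu (fun x => h (enorm x) * peval (Y l) x) ->
    m.-integrable setT (EFin \o h) /\
    \int[m]_t h t = cintegral mu (fun x => h (enorm x) * peval (Y l) x).
Proof.
have iQ := mu_moment (Y l).
apply: radial_component => //; first exact: measurable_peval.
move=> u v uv; have mh n : measurable_fun setT (ramp u v n : R -> R).
  by apply: continuous_measurable_fun; exact: ramp_continuous.
have cvg_int (m : {measure set 'rV[R]_d -> \bar R}) :
    m.-integrable setT (EFin \o peval (Y l)) ->
    \int[m]_x (ramp u v n (enorm x) * peval (Y l) x) @[n --> \oo] -->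
    \int[m]_x (\1_(`]u, v]%classic) (enorm x) * peval (Y l) x).
  move=> im; apply: (dominated_Rintegral (g := fun x => `|peval (Y l) x|)).
  - move=> n; apply: measurable_funM; last exact: measurable_peval.
    exact: measurable_enorm_comp.
  - apply: measurable_funM; last exact: measurable_peval.
    by apply: measurable_enorm_comp; exact: measurable_indic.
  - by move=> x; apply: cvgM; [exact: ramp_cvg|exact: cvg_cst].
  - exact: integrable_abse im.
  - by move=> n x; rewrite normrM ler_piMl// ramp_norm_le1.
have [ip iN] := (cintegrableP mu (peval (Y l))).1 iQ.
have : cintegral mu (fun x => ramp u v n (enorm x) * peval (Y l) x) @[n --> \oo] -->
    cintegral mu (fun x => \1_(`]u, v]%classic) (enorm x) * peval (Y l) x).
  by apply: cvgB; exact: cvg_int.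
move=> /cvgr_to_ge; apply; near=> n; apply: mu_pos.
- exact/continuous_subspaceT/ramp_continuous.
- by move=> t _; exact: ramp_ge0.
- apply: (@subclosed_compact _ _ `[u, v + 1]%classic).
  + exact: closed_closure.
  + exact: segment_compact.
  + rewrite closureE; apply: smallest_sub; first exact: interval_closed.
    by move=> t [_ /= /(ramp_supp uv)]; rewrite in_itv.
Unshelve. all: by end_near. Qed.

End pseudo_positive_component.

(** * Supports and null sets *)

Section supports.
Context {R : realType}.

Lemma null_of_locally_null d (T : measurableType d) (m : {measure set T -> \bar R})
    (I : countType) (c : I -> set T) (A : set T) : measurable A ->
  (forall i, measurable (c i)) ->
  (forall x, A x -> exists2 i, c i x & m (c i) = 0%E) -> m A = 0%E.
Proof.
move=> mA mc Ac.
pose b n := if unpickle n is Some i then (if m (c i) == 0%E then c i else set0) else set0.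
have mb n : measurable (b n) by rewrite /b; case: unpickle => // i; case: ifP.
apply/eqP; rewrite eq_le measure_ge0 andbT.
apply: (@le_trans _ _ (\sum_(n <oo) m (b n))%E).
  apply: measure_sigma_subadditive => // x /Ac[i cix mi].
  by exists (pickle i) => //; rewrite /b pickleK mi eqxx.
rewrite eseries0// => n _ _; rewrite /b; case: unpickle => [i|]; last exact: measure0.
by case: eqP => // _; exact: measure0.
Qed.

Lemma open_measurable_rV n (U : set 'rV[R]_n) : open U -> measurable U.
Proof. by move=> oU; exact: sub_sigma_algebra. Qed.

(** Balls with rational centre and radius 1/(k+1) form a countable base, so the points outside the
    support are covered by countably many null sets. *)
Lemma measure_support_rVC n (m : {measure set 'rV[R]_n -> \bar R}) A :
  measurable A -> (forall x, A x -> ~ measure_support m x) -> m A = 0%E.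
Proof.
move=> mA Am.
pose c (q : 'rV[rat]_n * nat) : set 'rV[R]_n :=
  ball (map_mx ratr q.1 : 'rV[R]_n) (q.2.+1%:R^-1 : R).
have mc q : measurable (c q).
  by apply: open_measurable_rV; apply: ball_open; rewrite invr_gt0.
apply: (null_of_locally_null (c := c)) => // x /Am /existsNP[U /not_implyP[oUx mU]].
have {}mU : m U = 0%E by apply/eqP; rewrite eq_le measure_ge0 andbT leNgt; apply/negP.
have /nbhs_ballP[e /= e0 xeU] := open_nbhs_nbhs oUx.
have [k ke] : exists k, k.+1%:R^-1 < e / 2.
  have e20 : 0 < e / 2 by rewrite divr_gt0.
  have [k _ /(_ k (leqnn k)) ke] := near_infty_natSinv_lt (PosNum e20).
  by exists k.
have k0 : 0 < k.+1%:R^-1 :> R by rewrite invr_gt0.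
have qP j : exists q : rat, ball (x ord0 j) (k.+1%:R^-1) (ratr q : R).
  have [||y [By [q _ qy]]] := @dense_rat R (ball (x ord0 j) k.+1%:R^-1).
  - by exists (x ord0 j); exact: ballxx.
  - exact: ball_open.
  by exists q; rewrite qy.
have [q qxP] := choice qP.
have xc : c (\row_j q j, k) x.
  by split=> [|i j]; [rewrite /= invr_gt0|rewrite !mxE ord1; exact/ball_sym].
exists (\row_j q j, k) => //.
apply: (subset_measure0 _ (open_measurable_rV oUx.1) _ mU) => // y cy; apply: xeU.
rewrite (splitr e); apply: ball_triangle.
  by apply/ball_sym; apply: le_ball xc; exact: ltW.
by apply: le_ball cy; exact: ltW.
Qed.

Lemma measure_supportC (m : {measure set R -> \bar R}) A :
  measurable A -> (forall x, A x -> ~ measure_support m x) -> m A = 0%E.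
Proof.
move=> mA Am.
pose c (q : rat * rat) : set R := `]ratr q.1, ratr q.2[%classic.
have mc q : measurable (c q) by exact: measurable_itv.
apply: (null_of_locally_null (c := c)) => // x /Am /existsNP[U /not_implyP[oUx mU]].
have {}mU : m U = 0%E by apply/eqP; rewrite eq_le measure_ge0 andbT leNgt; apply/negP.
have /nbhs_ballP[e /= e0 xeU] := open_nbhs_nbhs oUx.
have xe1 : x - e < x by rewrite ltrBlDr ltrDl.
have xe2 : x < x + e by rewrite ltrDl.
have [q1] := rat_in_itvoo xe1; rewrite in_itv /= => /andP[q1e q1x].
have [q2] := rat_in_itvoo xe2; rewrite in_itv /= => /andP[q2x q2e].
exists (q1, q2); first by rewrite /c /= in_itv /= q1x q2x.
have mUm : measurable U by exact: (open_measurable oUx.1).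
apply: (subset_measure0 _ mUm _ mU) => // y; rewrite /c /= in_itv /= => /andP[q1y yq2].
by apply: xeU; rewrite /ball /= ltr_norml; lra.
Qed.

Lemma closed_ereal_segment (rho : R) (r : \bar R) :
  closed [set t : R | (rho%:E <= t%:E <= r)%E].
Proof.
rewrite (_ : mkset _ = [set t | rho <= t] `&` [set t | (t%:E <= r)%E]); last first.
  by apply/seteqP; split=> t /=; rewrite lee_fin => /andP.
apply: closedI; first exact: closed_ge.
case: r => [r||].
- rewrite (_ : mkset _ = [set t | t <= r]); first exact: closed_le.
  by apply/seteqP; split=> t /=; rewrite lee_fin.
- rewrite (_ : mkset _ = setT); first exact: closedT.
  by apply/seteqP; split=> t //= _; rewrite leey.
- rewrite (_ : mkset _ = set0); first exact: closed0.
  by apply/seteqP; split=> t //=; rewrite leeNy_eq.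
Qed.

Lemma closed_annulus n rho (r : \bar R) : closed (@annulus R n rho r).
Proof.
have -> : @annulus R n rho r = @enorm R n @^-1` [set t | (rho%:E <= t%:E <= r)%E] by [].
apply: closed_comp => [x _|]; [exact: enorm_continuous|exact: closed_ereal_segment].
Qed.

Lemma measurable_annulus n rho (r : \bar R) : measurable (@annulus R n rho r).
Proof.
rewrite -[X in measurable X]setCK; apply: measurableC.
by apply: open_measurable_rV; apply: closed_openC; exact: closed_annulus.
Qed.

Lemma measure_support_subset (T : topologicalType) (m : set T -> \bar R) (C : set T) :
  closed C -> m (~` C) = 0%E -> measure_support m `<=` C.
Proof.
move=> cC mC x mx; apply: contrapT => xC.
by have := mx (~` C) (conj (closed_openC cC) xC); rewrite mC ltxx.
Qed.

End supports.

Section charge_null.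
Context d (T : measurableType d) (R : realType) (nu : {charge set T -> \bar R}).
Variable N : set T.
Hypotheses (mN : measurable N) (N0 : charge_total_variation nu N = 0%E).

Let posN0 : charge_pos nu N = 0%E.
Proof.
apply/eqP; rewrite eq_le measure_ge0 andbT -N0 charge_total_variationE.
by rewrite leeDl.
Qed.

Let negN0 : charge_neg nu N = 0%E.
Proof.
apply/eqP; rewrite eq_le measure_ge0 andbT -N0 charge_total_variationE.
by rewrite leeDr.
Qed.

Lemma cintegral_null_eq (f g : T -> R) : measurable_fun setT f ->
  measurable_fun setT g -> (forall x, ~ N x -> f x = g x) ->
  cintegral nu f = cintegral nu g.
Proof.
move=> mf mg fg; rewrite /cintegral.
by rewrite (negligible_Rintegral mN posN0 mf mg fg) (negligible_Rintegral mN negN0 mf mg fg).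
Qed.

Lemma cintegrable_null_eq (f g : T -> R) : measurable_fun setT f ->
  measurable_fun setT g -> (forall x, ~ N x -> f x = g x) ->
  cintegrable nu g -> cintegrable nu f.
Proof. exact: negligible_integrable_eq. Qed.

End charge_null.

(** * Charges carried by spherical shells *)

Section sum_measure.
Context d (T : measurableType d) (R : realType) (I : Type).
Variable m : I -> {measure set T -> \bar R}.

Definition sum_measure (s : seq I) : {measure set T -> \bar R} :=
  foldr (fun i (p : {measure set T -> \bar R}) => measure_add (m i) p) mzero s.

Lemma sum_measureE s A : sum_measure s A = (\sum_(i <- s) m i A)%E.
Proof.
elim: s => [|i s IHs]; first by rewrite big_nil.
by rewrite big_cons -IHs; exact: measure_addE'.
Qed.

Lemma sum_measure_integrable s (f : T -> R) : measurable_fun setT f ->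
  (forall i, (m i).-integrable setT (EFin \o f)) ->
  (sum_measure s).-integrable setT (EFin \o f).
Proof.
move=> mf fi; elim: s => [|i s IHs]; last exact: integrable_measure_add.
apply/integrableP; split; first exact/measurable_EFinP.
by rewrite integral_measure_zero.
Qed.

Lemma Rintegral_sum_measure s (f : T -> R) : measurable_fun setT f ->
  (forall i, (m i).-integrable setT (EFin \o f)) ->
  \int[sum_measure s]_x f x = \sum_(i <- s) \int[m i]_x f x.
Proof.
move=> mf fi; elim: s => [|i s IHs].
  by rewrite big_nil /Rintegral integral_measure_zero.
rewrite big_cons -IHs; apply: Rintegral_measure_add => //.
exact: sum_measure_integrable.
Qed.

End sum_measure.

(** * Integrals against series of measures *)

Section measure_series.
Context d (T : measurableType d) (R : realType).
Variable m : nat -> {measure set T -> \bar R}.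
Local Notation M := (mseries m 0).

Lemma mseries_ge n A : (m n A <= M A)%E.
Proof.
have m0 k : true -> (0 <= m k A)%E by move=> _; exact: measure_ge0.
rewrite /mseries (nneseriesD1 m0 (n := n))//.
by rewrite leeDl//; apply: nneseries_ge0 => k _ _; exact: measure_ge0.
Qed.

Lemma mseries_integrable (f : T -> R) : M.-integrable setT (EFin \o f) ->
  forall n, (m n).-integrable setT (EFin \o f).
Proof. by move=> fM n; apply: le_measure_integrable fM => A _; exact: mseries_ge. Qed.

Let ge0_cvg_Rintegral_mseries (f : T -> R) : (forall x, 0 <= f x) ->
  M.-integrable setT (EFin \o f) ->
  (\sum_(k < n) \int[m k]_x f x)%R @[n --> \oo] --> (\int[M]_x f x)%R.
Proof.
move=> f0 fM; have mf := measurable_int _ fM.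
have fm := mseries_integrable fM.
have fin := integrable_fin_num measurableT fM.
have E0 n : (0 <= \int[m n]_x (f x)%:E)%E by apply: integral_ge0 => x _; rewrite lee_fin.
have ME : (\int[M]_x (f x)%:E = \sum_(k <oo) \int[m k]_x (f x)%:E)%E.
  by apply: ge0_integral_measure_series => // x _; rewrite lee_fin.
have : (\sum_(0 <= k < n) \int[m k]_x (f x)%:E)%E @[n --> \oo] --> (\int[M]_x f x)%R%:E.
  rewrite /Rintegral fineK// ME; apply: is_cvg_nneseries => k _ _; exact: E0.
move=> /fine_cvg; apply: cvg_trans; apply: near_eq_cvg; near=> n.
rewrite /= big_mkord -[RHS]/(fine (_%:E)) -sumEFin; congr fine; apply: eq_bigr => k _.
by rewrite fineK//; exact: integrable_fin_num (fm k).
Unshelve. all: by end_near. Qed.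

(** Signed functions are reduced to nonnegative ones by writing [f] as [f + |f|] minus [|f|]. *)
Lemma cvg_Rintegral_mseries (f : T -> R) : M.-integrable setT (EFin \o f) ->
  (\sum_(k < n) \int[m k]_x f x)%R @[n --> \oo] --> (\int[M]_x f x)%R.
Proof.
move=> fM; have fm := mseries_integrable fM.
have aM : M.-integrable setT (EFin \o (fun x => `|f x|)) by exact: integrable_abse fM.
have faM : M.-integrable setT (EFin \o (fun x => f x + `|f x|)) by exact: integrableRD.
have E (q : {measure set T -> \bar R}) : q.-integrable setT (EFin \o f) ->
    \int[q]_x f x = \int[q]_x (f x + `|f x|) - \int[q]_x `|f x|.
  move=> fq; have aq : q.-integrable setT (EFin \o (fun x => `|f x|)) by exact: integrable_abse fq.
  by rewrite RintegralD// addrK.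
rewrite E//.
rewrite (_ : (fun n => _) = (fun n : nat => \sum_(k < n) \int[m k]_x (f x + `|f x|) -
    \sum_(k < n) \int[m k]_x `|f x|)); last first.
  by apply/funext => n; rewrite -sumrB; apply: eq_bigr => k _; exact: E.
apply: cvgB; apply: ge0_cvg_Rintegral_mseries => // x.
by have := ler_norm (- f x); rewrite normrN; lra.
Qed.

Lemma ge0_mseries_integrable (f : T -> R) : measurable_fun setT f ->
  (forall x, 0 <= f x) -> (forall n, (m n).-integrable setT (EFin \o f)) ->
  (\sum_(k <oo) (\int[m k]_x f x)%R%:E < +oo)%E -> M.-integrable setT (EFin \o f).
Proof.
move=> mf f0 fm foo; have mEf : measurable_fun setT (EFin \o f) by exact/measurable_EFinP.
apply/integrableP; split=> //.
under eq_integral do rewrite /= ger0_norm//.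
rewrite ge0_integral_measure_series//; last by move=> x _; rewrite lee_fin.
rewrite (eq_eseriesr (g := fun k => (\int[m k]_x f x)%R%:E))// => k _.
by rewrite /Rintegral fineK//; exact: integrable_fin_num (fm k).
Qed.

End measure_series.

Section finite_part.
Context d (T : measurableType d) (R : realType).
Variable m : {measure set T -> \bar R}.

(** The measure [m] itself; the proof of finiteness is an argument so that the structure of a finite
    measure can be declared on the term. *)
Definition finite_part of (m setT < +oo)%E : set T -> \bar R := m.

Variable m_fin : (m setT < +oo)%E.

HB.instance Definition _ := measure_function.Measure.on (finite_part m_fin).
HB.instance Definition _ :=
  Measure_isFinite.Build _ _ _ (finite_part m_fin) (lty_fin_num_fun m_fin).

End finite_part.

Section charge_series.
Context d (T : measurableType d) (R : realType).
Variables p n : nat -> {measure set T -> \bar R}.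
Hypotheses (p_fin : (mseries p 0 setT < +oo)%E) (n_fin : (mseries n 0 setT < +oo)%E).

(** The charge is the difference of the two summed measures. They dominate its Jordan parts, so
    common null sets and integrable functions pass to it. *)
Lemma charge_series : exists sigma : {charge set T -> \bar R},
  (forall A, measurable A -> mseries p 0 A = 0%E -> mseries n 0 A = 0%E ->
     charge_total_variation sigma A = 0%E) /\
  (forall f : T -> R, (mseries p 0).-integrable setT (EFin \o f) ->
     (mseries n 0).-integrable setT (EFin \o f) ->
     cintegrable sigma f /\
     (\sum_(k < i) (\int[p k]_x f x - \int[n k]_x f x) : R) @[i --> \oo] -->
       (cintegral sigma f : R)).
Proof.
pose P : {finite_measure set T -> \bar R} := finite_part p_fin.
pose N : {finite_measure set T -> \bar R} := finite_part n_fin.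
have sE A : measurable A -> charge_diff P N A = (P A - N A)%E by rewrite charge_diffE.
exists (charge_diff P N); split=> [A mA p0 n0|f fp fn].
  rewrite charge_total_variationE; apply/eqP; rewrite eq_le adde_ge0// andbT.
  rewrite -(adde0 0%E); apply: leeD.
    by rewrite -p0; exact: (charge_pos_le sE).
  by rewrite -n0; exact: (charge_neg_le sE).
split; first exact: (charge_diff_cintegrable sE).
rewrite (cintegral_diff sE fp fn); under eq_cvg do rewrite sumrB.
by apply: cvgB; exact: cvg_Rintegral_mseries.
Qed.

End charge_series.

Section polynomial_growth.
Context {R : realType} {d : nat}.
Implicit Types f g : 'rV[R]_d -> R.

Lemma growth_coef_ge0 (C e v : R) : 0 <= e -> `|v| <= C * (1 + e) -> 0 <= C.
Proof.
by move=> e0 /(le_trans (normr_ge0 v)); rewrite pmulr_lge0// ltr_pwDl.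
Qed.

Lemma exprn_le1D (t : R) m n : 0 <= t -> (m <= n)%N -> t ^+ m <= 1 + t ^+ n.
Proof.
move=> t0 mn; have [t1|t1] := leP t 1.
  by rewrite (le_trans (exprn_ile1 m t0 t1))// lerDl exprn_ge0.
by rewrite (le_trans (ler_weXn2l (ltW t1) mn))// lerDr.
Qed.

Definition polynomial_growth f :=
  exists (C : R) (N : nat), forall x, `|f x| <= C * (1 + enorm x ^+ N).

Lemma polynomial_growthM f g : polynomial_growth f -> polynomial_growth g ->
  polynomial_growth (fun x => f x * g x).
Proof.
move=> [C [N fC]] [D [M gD]]; exists (3 * (C * D)), (N + M)%N => x.
rewrite normrM (le_trans (ler_pM _ _ (fC x) (gD x)))//.
have x0 := enorm_ge0 x.
have C0 := growth_coef_ge0 (exprn_ge0 N x0) (fC x).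
have D0 := growth_coef_ge0 (exprn_ge0 M x0) (gD x).
have n1 := exprn_le1D x0 (leq_addr M N).
have n2 := exprn_le1D x0 (leq_addl N M).
rewrite mulrACA [leRHS](_ : _ = C * D * (3 * (1 + enorm x ^+ (N + M)))); last by ring.
apply: ler_wpM2l; first exact: mulr_ge0.
by move: n1 n2; rewrite exprD; lra.
Qed.

Lemma polynomial_growthD f g : polynomial_growth f -> polynomial_growth g ->
  polynomial_growth (fun x => f x + g x).
Proof.
move=> [C [N fC]] [D [M gD]]; exists (2 * (C + D)), (N + M)%N => x.
rewrite (le_trans (ler_normD _ _))//.
have x0 := enorm_ge0 x.
have C0 := growth_coef_ge0 (exprn_ge0 N x0) (fC x).
have D0 := growth_coef_ge0 (exprn_ge0 M x0) (gD x).
have n1 := exprn_le1D x0 (leq_addr M N).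
have n2 := exprn_le1D x0 (leq_addl N M).
have n3 : 0 <= enorm x ^+ (N + M) by rewrite exprn_ge0.
have := fC x; have := gD x; nra.
Qed.

Lemma polynomial_growth_cst c : polynomial_growth (fun=> c).
Proof.
by exists `|c|, 0%N => x; rewrite expr0 ler_peMr// lerDl.
Qed.

Lemma polynomial_growth_enormX N : polynomial_growth (fun x => enorm x ^+ N).
Proof.
exists 1, N => x; rewrite mul1r ger0_norm ?exprn_ge0 ?enorm_ge0//.
by rewrite lerDr.
Qed.

Lemma polynomial_growth_comp_enorm (h : R -> R) : polynomially_bounded h ->
  polynomial_growth (fun x => h (enorm x)).
Proof. by move=> [C [N hC]]; exists C, N => x; apply: hC; exact: enorm_ge0. Qed.

Lemma polynomial_growth_peval (P : mpoly d R) : polynomial_growth (peval P).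
Proof.
rewrite pevalE; elim: (msupp P) => [|m s IHs].
  by under eq_fun do rewrite big_nil; exact: polynomial_growth_cst.
under eq_fun do rewrite big_cons; apply: polynomial_growthD => //.
apply: polynomial_growthM; first exact: polynomial_growth_cst.
elim: (index_enum _) => [|i t IHt].
  by under eq_fun do rewrite big_nil; exact: polynomial_growth_cst.
under eq_fun do rewrite big_cons; apply: polynomial_growthM => //.
exists 1, (m i) => x; rewrite mul1r normrX (@le_trans _ _ (enorm x ^+ m i))//.
  by rewrite lerXn2r// ?nnegrE ?enorm_ge0//; exact: coord_le_enorm.
by rewrite lerDr.
Qed.

End polynomial_growth.

(** * Shells: densities on the sphere of radius t *)

Section shells.
Context {R : realType} {d : nat}.

Lemma surface_integral_eq (f g : 'rV[R]_d -> R) : measurable_fun setT f ->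
  measurable_fun setT g -> (forall x, enorm x = 1 -> f x = g x) ->
  \int[surface_measure d]_x f x = \int[surface_measure d]_x g x.
Proof.
move=> mf mg fg; apply: (negligible_Rintegral _ surface_measure_sphereC) => //.
  by apply: measurableC; exact: measurable_sphere.
by move=> x /contrapT; exact: fg.
Qed.

Lemma measurable_scale (t : R) : measurable_fun setT (fun x : 'rV[R]_d => t *: x).
Proof.
apply: measurable_fun_rVP => j; under eq_fun do rewrite mxE.
by apply: measurable_funM => //; exact: measurable_coord.
Qed.

(** The measure [c g dtheta] carried to the sphere of radius [t]; for [t = 0] it becomes an atom at
    the origin. *)
Definition shell (c : {nonneg R}) (t : R) (g : 'rV[R]_d -> R)
    (mg : measurable_fun setT g) (g0 : forall x, 0 <= g x) : {measure set 'rV[R]_d -> \bar R} :=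
  mscale c (image_measure (density (surface_measure d) mg g0) (measurable_scale t)).

Lemma Rintegral_shell (c : {nonneg R}) t g mg g0 (M : R) (f : 'rV[R]_d -> R) :
  (forall x, g (radial x) <= M) -> measurable_fun setT f -> polynomial_growth f ->
  [/\ (surface_measure d).-integrable setT (EFin \o (fun x => f (t *: x) * g x)),
    (@shell c t g mg g0).-integrable setT (EFin \o f) &
  \int[@shell c t g mg g0]_x f x =
    c%:num * \int[surface_measure d]_x (f (t *: x) * g x)].
Proof.
move=> gM mf [C [N fC]].
have mft : measurable_fun setT (fun x : 'rV[R]_d => f (t *: x)).
  by apply: measurableT_comp => //; exact: measurable_scale.
have [|x|i1 _] := @Rintegral_surface_measure R d (fun x => f (t *: x) * g x)
   ((C * (1 + `|t| ^+ N)) * M).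
- exact: measurable_funM.
- rewrite normrM (ger0_norm (g0 _)) ler_pM//.
  have C0 := growth_coef_ge0 (exprn_ge0 N (enorm_ge0 0)) (fC 0).
  rewrite (le_trans (fC _))// ler_wpM2l// lerD2l enormZ exprMn.
  rewrite ler_piMr ?exprn_ge0// exprn_ile1 ?enorm_ge0//; exact: enorm_radial_le1.
have [i2 E2] := Rintegral_image_density mg g0 (measurable_scale t) mf i1.
have [i3 E3] := Rintegral_mscale c i2.
by split=> //; rewrite [LHS]E3 E2.
Qed.

Lemma shell_null (c : {nonneg R}) t g mg g0 A : measurable A ->
  (forall x, enorm x = 1 -> ~ A (t *: x)) -> @shell c t g mg g0 A = 0%E.
Proof.
move=> mA At; rewrite /shell /= /mscale /= /pushforward /density.
rewrite (_ : (\int[_]_(x in _) _)%E = 0%E) ?mule0//.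
have mtA : measurable ((fun x : 'rV[R]_d => t *: x) @^-1` A).
  by rewrite -[X in measurable X]setTI; exact: measurable_scale.
apply: null_set_integral => //.
  by apply/measurable_EFinP; exact: measurable_funTS.
apply: (subset_measure0 _ _ _ surface_measure_sphereC) => //.
  by apply: measurableC; exact: measurable_sphere.
by move=> x xA /At; exact.
Qed.

End shells.

Section shell_charge.
Context {R : realType} {d : nat} {a : nat -> nat}.
Variable Y : forall k, 'I_(a k) -> mpoly d R.
Hypothesis Y_norm : forall k (l : 'I_(a k)),
  \int[surface_measure d]_x (peval (Y l) x ^+ 2) = 1.
Variables (z : forall k, 'I_(a k) -> seq R) (c : forall k, 'I_(a k) -> R -> {nonneg R}).
Hypothesis z_ge0 : forall k (l : 'I_(a k)), {in z l, forall t : R, 0 <= t}.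
Hypothesis c_summable : forall N,
  (\sum_(k <oo) (\sum_(l < a k) \sum_(t <- z l) (c l t)%:num * t ^+ N)%:E < +oo)%E.

Let Yp k (l : 'I_(a k)) (x : 'rV[R]_d) : R := Num.max (peval (Y l) x) 0.
Let Yn k (l : 'I_(a k)) (x : 'rV[R]_d) : R := Num.max (- peval (Y l) x) 0.
Let mYp k l : measurable_fun setT (@Yp k l).
Proof. by apply: measurable_maxr => //; exact: measurable_peval. Qed.
Let mYn k l : measurable_fun setT (@Yn k l).
Proof. by apply: measurable_maxr => //; apply: measurable_funN; exact: measurable_peval. Qed.
Let Yp0 k l x : 0 <= @Yp k l x. Proof. by rewrite le_max lexx orbT. Qed.
Let Yn0 k l x : 0 <= @Yn k l x. Proof. by rewrite le_max lexx orbT. Qed.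
Let YE k l x : peval (@Y k l) x = Yp l x - Yn l x.
Proof. by rewrite /Yp /Yn; case: (leP (peval (Y l) x) 0); case: (leP (- peval (Y l) x) 0); lra. Qed.
Let Yp_le k l x : @Yp k l x <= `|peval (Y l) x|.
Proof. by rewrite ge_max ler_norm normr_ge0. Qed.
Let Yn_le k l x : @Yn k l x <= `|peval (Y l) x|.
Proof. by rewrite ge_max -normrN ler_norm normr_ge0. Qed.

Let nodes k := [seq (l, t) | l <- enum 'I_(a k), t <- @z k l].

Let sum_nodes k (F : 'I_(a k) -> R -> R) :
  \sum_(i <- nodes k) F i.1 i.2 = \sum_(l < a k) \sum_(t <- z l) F l t.
Proof. by rewrite big_allpairs_dep /= big_enum. Qed.

(** The uniform bound for [\int |Y_{k,l}| dtheta]: the mass of the sphere plus the squared norm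
    1. *)
Let C1 : R := fine (surface_measure d [set: 'rV[R]_d]) + 1.

Let peval_radial_bounded k (l : 'I_(a k)) : exists M : R, forall x, `|peval (Y l) (radial x)| <= M.
Proof.
have [M hM] := peval_bounded (Y l); exists M => x.
by apply: hM => i; exact: radial_coord_le1.
Qed.

Let integral_part k (l : 'I_(a k)) (g : 'rV[R]_d -> R) N (t : R) :
  measurable_fun setT g -> (forall x, 0 <= g x) -> (forall x, g x <= `|peval (Y l) x|) ->
  0 <= t ->
  \int[surface_measure d]_x (enorm (t *: x) ^+ N * g x) <= C1 * t ^+ N.
Proof.
move=> mg g0 gY t0; have [M hM] := peval_radial_bounded l.
have [x|ig _] := @Rintegral_surface_measure R d g M mg.
  by rewrite ger0_norm// (le_trans (gY _)).
have [|x|iY _] := @Rintegral_surface_measure R d (fun x => peval (Y l) x ^+ 2) (M ^+ 2).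
- by apply: measurable_funX; exact: measurable_peval.
- by rewrite normrX lerXn2r// nnegrE// (le_trans _ (hM x)).
rewrite (@surface_integral_eq R d _ (fun x => t ^+ N * g x)); last 3 first.
- apply: measurable_funM => //; apply: measurable_funX.
  by apply: measurableT_comp; [exact: measurable_enorm|exact: measurable_scale].
- exact: measurable_funM.
- by move=> x x1; rewrite enormZ x1 mulr1 ger0_norm.
rewrite RintegralZl// mulrC ler_wpM2r ?exprn_ge0//.
have i1 : (surface_measure d).-integrable setT (EFin \o (cst 1 : 'rV[R]_d -> R)).
  by apply: (bounded_integrable surface_measure_fin (M := 1)) => //= x; rewrite normr1.
have -> : C1 = \int[surface_measure d]_x (1 + peval (Y l) x ^+ 2).
  by rewrite RintegralD// Y_norm Rintegral_cst// mul1r.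
apply: le_Rintegral => //; first exact: integrableRD.
move=> x _; rewrite (le_trans (gY x))// -[X in _ <= _ + X]real_normK ?num_real//.
by have := sqr_ge0 (`|peval (Y l) x| - 1); have := normr_ge0 (peval (Y l) x); nra.
Qed.

Let series_integrable (g : forall k, 'I_(a k) -> 'rV[R]_d -> R)
    (mg : forall k l, measurable_fun setT (g k l)) (g0 : forall k l x, 0 <= g k l x) :
  (forall k l x, g k l x <= `|peval (Y l) x|) ->
  forall f, measurable_fun setT f -> polynomial_growth f ->
  (mseries (fun k => sum_measure (fun i : 'I_(a k) * R =>
     shell (c i.1 i.2) i.2 (mg k i.1) (g0 k i.1)) (nodes k)) 0).-integrable setT (EFin \o f).
Proof.
move=> gY f mf [C [N fC]]; set M := mseries _ _.
have growth k (l : 'I_(a k)) t (h : 'rV[R]_d -> R) : measurable_fun setT h -> polynomial_growth h ->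
    (shell (c l t) t (mg k l) (g0 k l)).-integrable setT (EFin \o h) /\
    \int[shell (c l t) t (mg k l) (g0 k l)]_x h x =
    (c l t)%:num * \int[surface_measure d]_x (h (t *: x) * g k l x).
  move=> mh hh; have [M' hM] := peval_radial_bounded l.
  have gM x : g k l (radial x) <= M' by exact: le_trans (gY _ _ _) (hM x).
  by have [_ ? ?] := Rintegral_shell (c l t) t (mg k l) (g0 k l) gM mh hh.
have iX j : M.-integrable setT (EFin \o (fun x => enorm x ^+ j)).
  have mX : measurable_fun setT (fun x : 'rV[R]_d => enorm x ^+ j).
    by apply: measurable_funX; exact: measurable_enorm.
  apply: ge0_mseries_integrable => //.
  - by move=> x; rewrite exprn_ge0// enorm_ge0.
  - move=> k; apply: sum_measure_integrable => // i.
    by apply: (growth k i.1 i.2 _ mX _).1; exact: polynomial_growth_enormX.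
  apply: (@le_lt_trans _ _ (C1%:E * \sum_(k <oo)
      (\sum_(l < a k) \sum_(t <- z l) (c l t)%:num * t ^+ j)%:E)%E).
    rewrite -nneseriesZl; last first.
      move=> k _; rewrite lee_fin; apply: sumr_ge0 => l _; rewrite big_seq; apply: sumr_ge0 => t tz.
      by rewrite mulr_ge0// exprn_ge0// (z_ge0 tz).
    apply: lee_nneseries => [k _ _|k _].
      by rewrite lee_fin; apply: Rintegral_ge0 => x _; rewrite exprn_ge0// enorm_ge0.
    rewrite -EFinM lee_fin Rintegral_sum_measure//; last first.
      by move=> i; apply: (growth k i.1 i.2 _ mX _).1; exact: polynomial_growth_enormX.
    rewrite (eq_bigr (fun i => (c i.1 i.2)%:num *
        \int[surface_measure d]_x (enorm (i.2 *: x) ^+ j * g k i.1 x))); last first.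
      by move=> i _; apply: (growth k i.1 i.2 _ mX _).2; exact: polynomial_growth_enormX.
    rewrite (sum_nodes (fun l t => (c l t)%:num *
        \int[surface_measure d]_x (enorm (t *: x) ^+ j * g k l x))).
    rewrite mulr_sumr; apply: ler_sum => l _; rewrite mulr_sumr big_seq [leRHS]big_seq.
    apply: ler_sum => t tz; rewrite mulrCA ler_wpM2l//.
    by apply: integral_part => //; exact: z_ge0 tz.
  by rewrite lte_mul_pinfty// lee_fin addr_ge0// fine_ge0.
apply: (le_integrableR mf fC); apply: integrableRZ; apply: integrableRD => //.
exact: (iX 0%N).
Qed.

(** The positive and negative parts of the [Y_{k,l}] give two series of shells. Grouping by degree
    makes each term a finite sum, and all moments of both series converge by [c_summable] and the
    bound [C1]. *)
Lemma shell_charge : exists sigma : {charge set 'rV[R]_d -> \bar R},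
  (forall A, measurable A ->
     (forall k (l : 'I_(a k)), {in z l, forall t x, enorm x = 1 -> ~ A (t *: x)}) ->
     charge_total_variation sigma A = 0%E) /\
  (forall f, measurable_fun setT f -> polynomial_growth f ->
     cintegrable sigma f /\
     (\sum_(k < i) \sum_(l < a k) \sum_(t <- z l) (c l t)%:num *
       \int[surface_measure d]_x (f (t *: x) * peval (Y l) x) : R) @[i --> \oo] -->
       (cintegral sigma f : R)).
Proof.
have ip := series_integrable mYp Yp0 Yp_le; have iN := series_integrable mYn Yn0 Yn_le.
have finT (q : {measure set 'rV[R]_d -> \bar R}) :
    q.-integrable setT (EFin \o cst (1 : R)) -> (q setT < +oo)%E.
  move=> /(integrable_lty measurableT).
  by rewrite -[EFin \o _]/(cst 1%:E) integral_cst// mul1e.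
have p_fin := finT _ (ip _ (measurable_cst _) (polynomial_growth_cst _)).
have n_fin := finT _ (iN _ (measurable_cst _) (polynomial_growth_cst _)).
have [sigma [sigma0 sigmaE]] := charge_series p_fin n_fin.
exists sigma; split=> [A mA zA|f mf hf].
  have null (g : forall k, 'I_(a k) -> 'rV[R]_d -> R)
      (mg : forall k l, measurable_fun setT (g k l)) (g0 : forall k l x, 0 <= g k l x) :
    mseries (fun k => sum_measure (fun i : 'I_(a k) * R =>
      shell (c i.1 i.2) i.2 (mg k i.1) (g0 k i.1)) (nodes k)) 0 A = 0%E.
    rewrite /mseries eseries0// => k _ _; rewrite sum_measureE big_seq big1// => i.
    move=> /allpairsPdep[l [t [_ tz ->]]] /=.
    by apply: shell_null => // x; exact: zA tz x.
  by apply: sigma0 => //; exact: null.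
have [ci cE] := sigmaE f (ip _ mf hf) (iN _ mf hf).
split=> //; apply: cvg_trans cE; apply: near_eq_cvg; near=> i.
apply: eq_bigr => k _.
have growth (l : 'I_(a k)) t (g : 'rV[R]_d -> R) (mg : measurable_fun setT g)
    (g0 : forall x, 0 <= g x) : (forall x, g x <= `|peval (Y l) x|) ->
    [/\ (surface_measure d).-integrable setT (EFin \o (fun x => f (t *: x) * g x)),
    (shell (c l t) t mg g0).-integrable setT (EFin \o f) &
    \int[shell (c l t) t mg g0]_x f x =
    (c l t)%:num * \int[surface_measure d]_x (f (t *: x) * g x)].
  move=> gY; have [M' hM] := peval_radial_bounded l.
  have gM x : g (radial x) <= M' by exact: le_trans (gY _) (hM x).
  exact: (Rintegral_shell (c l t) t mg g0 gM mf hf).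
rewrite -sum_nodes.
rewrite !Rintegral_sum_measure//; last 2 first.
- by move=> j; have [] := growth j.1 j.2 _ (mYn j.1) (Yn0 j.1) (Yn_le j.1).
- by move=> j; have [] := growth j.1 j.2 _ (mYp j.1) (Yp0 j.1) (Yp_le j.1).
rewrite -sumrB; apply: eq_bigr => j _.
have [i1 _ ->] := growth j.1 j.2 _ (mYp j.1) (Yp0 j.1) (Yp_le j.1).
have [i2 _ ->] := growth j.1 j.2 _ (mYn j.1) (Yn0 j.1) (Yn_le j.1).
rewrite -mulrBr -RintegralB//; congr (_ * _); apply: eq_Rintegral => x _.
by rewrite YE mulrBr.
Unshelve. all: by end_near. Qed.

End shell_charge.

Section orthonormal_shells.
Context {R : realType} {d : nat} {a : nat -> nat}.
Variable Y : forall k, 'I_(a k) -> mpoly d R.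
Hypothesis Y_basis : orthonormal_harmonic_basis Y.

Lemma basis_homog k (l : 'I_(a k)) : Y l \is ishomog1 k mdeg.
Proof. by have [/(_ l)[]] := Y_basis k. Qed.

Lemma basis_orthonormal k (l l' : 'I_(a k)) :
  \int[surface_measure d]_x (peval (Y l) x * peval (Y l') x) = (l == l')%:R.
Proof.
have [_ _ <-] := Y_basis k.
have [M1 hM1] := peval_bounded (Y l); have [M2 hM2] := peval_bounded (Y l').
apply/esym; apply: (@Rintegral_sphere R d _ (M1 * M2)).
  by apply: measurable_funM; exact: measurable_peval.
by move=> x; rewrite normrM ler_pM ?hM1 ?hM2// => i; exact: radial_coord_le1.
Qed.

Variables (z : forall k, 'I_(a k) -> seq R) (c : forall k, 'I_(a k) -> R -> {nonneg R}).
Hypothesis z_ge0 : forall k (l : 'I_(a k)), {in z l, forall t : R, 0 <= t}.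
Hypothesis c_summable : forall N,
  (\sum_(k <oo) (\sum_(l < a k) \sum_(t <- z l) (c l t)%:num * t ^+ N)%:E < +oo)%E.

Lemma orthonormal_shell_charge : exists sigma : {charge set 'rV[R]_d -> \bar R},
  [/\ forall A, measurable A ->
     (forall k (l : 'I_(a k)), {in z l, forall t x, enorm x = 1 -> ~ A (t *: x)}) ->
     charge_total_variation sigma A = 0%E,
   forall f, measurable_fun setT f -> polynomial_growth f -> cintegrable sigma f &
   forall k (l : 'I_(a k)) (h : R -> R), measurable_fun setT h -> polynomially_bounded h ->
     cintegral sigma (fun x => h (enorm x) * peval (Y l) x) =
     \sum_(t <- z l) (c l t)%:num * t ^+ k * h t].
Proof.
have Y_norm k (l : 'I_(a k)) : \int[surface_measure d]_x (peval (Y l) x ^+ 2) = 1.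
  under eq_Rintegral do rewrite expr2.
  by rewrite basis_orthonormal eqxx.
have [sigma [sigma0 sigmaE]] := shell_charge Y_norm z_ge0 c_summable.
exists sigma; split=> // [f mf hf|k l h mh hh]; first exact: (sigmaE f mf hf).1.
set f := fun x : 'rV[R]_d => _.
have mf : measurable_fun setT f.
  by apply: measurable_funM; [exact: measurable_enorm_comp|exact: measurable_peval].
have gf : polynomial_growth f.
  by apply: polynomial_growthM;
      [exact: polynomial_growth_comp_enorm|exact: polynomial_growth_peval].
have [_ fE] := sigmaE f mf gf.
apply: (cvg_unique _ fE) => //.
have termE k' (l' : 'I_(a k')) t : 0 <= t ->
    \int[surface_measure d]_x (f (t *: x) * peval (Y l') x) =
    h t * t ^+ k * \int[surface_measure d]_x (peval (Y l) x * peval (Y l') x).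
  move=> t0; have [M1 hM1] := peval_bounded (Y l); have [M2 hM2] := peval_bounded (Y l').
  have [|x|i1 _] := @Rintegral_surface_measure R d
    (fun x => peval (Y l) x * peval (Y l') x) (M1 * M2).
  - by apply: measurable_funM; exact: measurable_peval.
  - by rewrite normrM ler_pM ?hM1 ?hM2// => i; exact: radial_coord_le1.
  rewrite -RintegralZl//; apply: surface_integral_eq.
  - apply: measurable_funM; last exact: measurable_peval.
    by apply: (measurableT_comp mf); exact: measurable_scale.
  - by apply: measurable_funM => //; apply: measurable_funM; exact: measurable_peval.
  - move=> x x1; rewrite /f enormZ x1 mulr1 ger0_norm//.
    by rewrite (peval_scale _ _ (basis_homog l)) !mulrA.
(* Orthonormality leaves only the term (k, l), so the partial sums are constant as soon as i > k;
   the factor [t ^+ k] comes from the homogeneity of [Y l]. *)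
apply: cvg_near_cst; near=> i.
have ki : (k < i)%N by near: i; exact: nbhs_infty_gt.
rewrite (bigD1 (Ordinal ki))//= [X in _ + X]big1 ?addr0; last first.
  move=> j jk; apply: big1 => l' _; rewrite big_seq; apply: big1 => t tz.
  rewrite termE ?(z_ge0 tz)// (@sphere_orthogonal _ _ _ _ k j) ?mulr0//.
  - by rewrite eq_sym.
  - by have [/(_ l)] := Y_basis k.
  - by have [/(_ l')] := Y_basis j.
rewrite (bigD1 l)//= [X in _ + X]big1 ?addr0; last first.
  move=> l' ll'; rewrite big_seq; apply: big1 => t tz.
  by rewrite termE ?(z_ge0 tz)// basis_orthonormal eq_sym (negbTE ll') !mulr0.
rewrite big_seq [RHS]big_seq; apply: eq_bigr => t tz.
by rewrite termE ?(z_ge0 tz)// basis_orthonormal eqxx mulr1 mulrA mulrAC.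
Unshelve. all: by end_near. Qed.

End orthonormal_shells.

(** * Functions given on the half line *)

Section half_line.
Context {R : realType}.

(** Functions of the radius are specified on [[0, +oo[] only; extending them to the left by their
    value at 0 gives a continuous function on the line that agrees with them at every norm. *)
Lemma continuous_half_line (h : R -> R) : {within `[0, +oo[, continuous h} ->
  continuous (fun t : R => h (Num.max 0 t)).
Proof.
move=> /subspace_continuousP hc t.
have t0 : `[0, +oo[%classic (Num.max 0 t) by rewrite /= in_itv /= andbT le_max lexx.
apply: (@cvg_comp _ _ _ (fun t : R => Num.max 0 t) h _
  (within `[0, +oo[%classic (nbhs (Num.max 0 t)))); last exact: hc.
move=> A hA.
have mc : {for t, continuous (fun t : R => Num.max 0 t)}.
  by apply: continuous_max; [exact: cvg_cst|exact: cvg_id].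
move: (mc _ hA); apply: (@filterS _ (nbhs t)) => u /=; apply.
by rewrite /= in_itv /= andbT le_max lexx.
Qed.

Lemma polynomially_bounded_half_line (h : R -> R) : polynomially_bounded h ->
  polynomially_bounded (fun t : R => h (Num.max 0 t)).
Proof. by move=> [C [N hC]]; exists C, N => t t0; rewrite (max_idPr t0) hC. Qed.

Lemma max_enorm d (x : 'rV[R]_d) : Num.max 0 (enorm x) = enorm x.
Proof. by apply/max_idPr; exact: enorm_ge0. Qed.

Lemma compact_support_bounded (h : R -> R) : {within `[0, +oo[, continuous h} ->
  compact (closure (`[0, +oo[ `&` [set t | h t != 0])) -> polynomially_bounded h.
Proof.
move=> /continuous_half_line hc cK; set K := closure _ in cK.
have /compact_bounded[M [_ /(_ (`|M| + 1))]] : compact ((fun t : R => h (Num.max 0 t)) @` K).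
  by apply: continuous_compact => //; exact: continuous_subspaceT.
rewrite ltr_pwDr// ?ler_norm// => /(_ isT) hM.
exists (`|M| + 1), 0%N => t t0; rewrite expr0.
have M0 : 0 <= `|M| + 1 by rewrite addr_ge0.
have [->|ht] := eqVneq (h t) 0; first by rewrite normr0 mulr_ge0// addr_ge0.
have : `|h (Num.max 0 t)| <= `|M| + 1.
  apply: hM; exists t => //; apply: subset_closure; split=> //.
  by rewrite /= in_itv /= t0.
by rewrite (max_idPr t0); nra.
Qed.

Lemma Rintegral_half_line (m : {measure set R -> \bar R}) (h : R -> R) :
  m `]-oo, 0[%classic = 0%E -> measurable_fun setT (fun t : R => h (Num.max 0 t)) ->
  \int[m]_(t in `[0, +oo[) h t = \int[m]_t h (Num.max 0 t).
Proof.
move=> m0 mh; rewrite Rintegral_mkcond; apply: (negligible_Rintegral _ m0) => //.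
- rewrite (_ : _ \_ _ = (fun t : R => h (Num.max 0 t)) \_ `[0, +oo[%classic).
    by apply/(measurable_restrictT _ _).1 => //; exact: measurable_funTS.
  apply/funext => t; rewrite !patchE; case: ifPn => //.
  by rewrite inE /= in_itv /= andbT => /max_idPr ->.
move=> t /=; rewrite in_itv /= => /negP; rewrite -leNgt => t0.
by rewrite patchE mem_set ?(max_idPr t0)//= in_itv /= t0.
Qed.

End half_line.

Lemma polynomial_growth_cintegrable {R : realType} {d : nat}
    (nu : {charge set 'rV[R]_d -> \bar R}) (f : 'rV[R]_d -> R) :
  moment_measure nu -> measurable_fun setT f -> polynomial_growth f -> cintegrable nu f.
Proof.
move=> nu_moment mf [C [N fC]].
have C0 := growth_coef_ge0 (exprn_ge0 N (enorm_ge0 0)) (fC 0).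
(* [|x| ^ N] is not a polynomial for odd N in general, so it is dominated by [1 + |x| ^ (2N)],
   whence the constant 2. *)
pose P : mpoly d R := C *: (2%:R *: 1 + norm_sq_poly ^+ N * 1).
have PE x : peval P x = C * (2 + enorm x ^+ (2 * N)).
  by rewrite pevalZ pevalD pevalZ peval_norm_sq_powM /peval meval1 !mulr1.
apply: (le_integrableR mf (g := peval P)); last exact: nu_moment.
move=> x; rewrite (le_trans (fC x))// PE ler_wpM2l//.
have := exprn_le1D (enorm_ge0 x) (leq_pmull N (ltn0Sn 1)); lra.
Qed.

Lemma nneseries_lty_eventually {R : realType} (u v : nat -> R) N :
  (forall k, 0 <= u k) -> (forall k, 0 <= v k) ->
  (forall k, (N <= k)%N -> u k <= v k) ->
  (\sum_(k <oo) (v k)%:E < +oo)%E -> (\sum_(k <oo) (u k)%:E < +oo)%E.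
Proof.
move=> u0 v0 uv voo.
have uE0 k : (0 <= (u k)%:E)%E by rewrite lee_fin.
have vE0 k : (0 <= (v k)%:E)%E by rewrite lee_fin.
rewrite (@nneseries_split _ _ 0 N)// add0n lte_add_pinfty//.
  by rewrite sumEFin ltry.
apply: (@le_lt_trans _ _ (\sum_(N <= k <oo) (v k)%:E)%E).
  rewrite eseries_cond [leRHS]eseries_cond.
  by apply: lee_nneseries => // k /= Nk; rewrite lee_fin uv.
by apply: le_lt_trans voo; rewrite [leRHS](@nneseries_split _ _ 0 N)// add0n leeDr// sume_ge0.
Qed.

(** * Existence *)

Definition quadrature_solution {R : realType} {d : nat} {a : nat -> nat}
    (Y : forall k, 'I_(a k) -> mpoly d R) (rho : R) (r : \bar R)
    (mu : {charge set 'rV[R]_d -> \bar R}) (s : nat)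
    (sigma : {charge set 'rV[R]_d -> \bar R}) :=
  [/\ pseudo_positive Y sigma,
      moment_measure sigma,
      measure_support (charge_total_variation sigma) `<=` annulus rho r,
      forall k (l : 'I_(a k)),
        exists2 m : {measure set R -> \bar R},
          component_measure Y sigma l m & (measure_support m #<= `I_s)%card
    & forall P : mpoly d R, iter (2 * s) laplacian P = 0 ->
        cintegral mu (peval P) = cintegral sigma (peval P)].

Section component.
Context {R : realType} {d : nat} {a : nat -> nat}.
Variable Y : forall k, 'I_(a k) -> mpoly d R.
Hypothesis Y_basis : orthonormal_harmonic_basis Y.
Lemma harmonic_span (S : mpoly d R -> Prop) k p H : S 0 ->
  (forall c P Q, S P -> S Q -> S (c *: P + Q)) ->
  (forall l : 'I_(a k), S (p * Y l)) -> harmonic_homogeneous k H -> S (p * H).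
Proof.
move=> S0 SD SY hH; have [_ /(_ _ hH)[c [-> _]] _] := Y_basis k.
rewrite mulr_sumr; elim: (index_enum _) => [|l s IHs]; first by rewrite big_nil.
by rewrite big_cons -scalerAr; apply: SD.
Qed.

Variables (rho : R) (r : \bar R) (mu : {charge set 'rV[R]_d -> \bar R}).
Hypotheses (mu_pseudo_positive : pseudo_positive Y mu) (mu_moment : moment_measure mu).
Hypothesis mu_support :
  measure_support (charge_total_variation mu) `<=` annulus rho r.

Let J : set R := [set t | 0 <= t /\ (rho%:E <= t%:E <= r)%E].

Let measurable_J : measurable J.
Proof.
rewrite (_ : J = `[0, +oo[ `&` [set t | (rho%:E <= t%:E <= r)%E]).
  apply: measurableI; first exact: measurable_itv.
  by apply: closed_measurable; exact: closed_ereal_segment.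
by apply/seteqP; split=> t; rewrite /J /= in_itv /= andbT.
Qed.

Let annulusC0 : charge_total_variation mu (~` annulus rho r) = 0%E.
Proof.
apply: measure_support_rVC; first by apply: measurableC; exact: measurable_annulus.
by move=> x xA /mu_support.
Qed.

(** For N < k, [t ^+ N * t^-1 ^+ k] is an inverse power away from 0, so the one-sided bound holds;
    for k = N = 0 it is exactness on constants. Each N thus misses finitely many degrees, which does
    not affect the convergence of the series. *)
Lemma component_quadrature s k (l : 'I_(a k)) : (0 < s)%N ->
  exists (z : seq R) (w : R -> R),
  [/\ uniq z, (size z <= s)%N,
    {in z, forall t : R, [/\ 0 <= t, (rho%:E <= t%:E <= r)%E, 0 <= w t &
      (0 < k)%N -> t = 0 -> w t = 0]},
    forall j, (j < 2 * s)%N ->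
      cintegral mu (fun x => enorm x ^+ (2 * j) * peval (Y l) x) =
      \sum_(t <- z) w t * t ^+ (2 * j) &
    forall N, (N < k)%N || (N == 0)%N ->
      \sum_(t <- z) w t * t^-1 ^+ k * t ^+ N <=
      cintegral mu (fun x => enorm x ^+ N * peval (Y l) (radial x)) ] /\
    forall N, 0 <= cintegral mu (fun x => enorm x ^+ N * peval (Y l) (radial x)).
Proof.
move=> s0; have hY := basis_homog Y_basis l.
have [m [m_fin mE]] := pseudo_positive_component mu_pseudo_positive mu_moment l.
(* Used for the radii outside the annulus and, in positive degree, for the radius 0, where [Y l]
   vanishes. *)
have null A : measurable A -> (forall x, annulus rho r x -> A (enorm x) -> peval (Y l) x = 0) ->
    m A = 0%E.
  move=> mA AY; have mI : measurable_fun setT (\1_A : R -> R) by exact: measurable_indic.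
  have mIY : measurable_fun setT (fun x : 'rV[R]_d => \1_A (enorm x) * peval (Y l) x).
    by apply: measurable_funM; [exact: measurable_enorm_comp|exact: measurable_peval].
  have m0 : measurable_fun setT (cst 0 : 'rV[R]_d -> R) by [].
  have mAC : measurable (~` annulus rho r : set 'rV[R]_d).
    by apply: measurableC; exact: measurable_annulus.
  have E x : ~ (~` annulus rho r) x -> \1_A (enorm x) * peval (Y l) x = cst 0 x.
    move=> /contrapT xA; rewrite indicE; case: (boolP (_ \in _)); rewrite ?mul0r//.
    by rewrite inE => /(AY _ xA) ->; rewrite mulr0.
  have [|im] := mE _ mI.
    apply: (cintegrable_null_eq mAC annulusC0 mIY m0 E).
    by apply: (bounded_cintegrable _ (M := 0)) => // x; rewrite normr0.
  rewrite (cintegral_null_eq mAC annulusC0 mIY m0 E) /cintegral !Rintegral_cst// !mul0r subrr.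
  rewrite /Rintegral integral_indic// setIT => mA0.
  rewrite -[m A]fineK ?mA0// ge0_fin_numE//; apply: le_lt_trans m_fin.
  by apply: le_measure; rewrite ?inE.
have mJ0 : m (~` J) = 0%E.
  apply: null => [|x xA []]; first exact: measurableC.
  by split; [exact: enorm_ge0|].
have mk0 : (0 < k)%N -> m [set 0] = 0%E.
  move=> k0; apply: null => // x _ /= x0.
  by rewrite (peval_homog _ hY) x0 expr0n eqn0Ngt k0 mul0r.
have mX n : measurable_fun setT (fun t : R => t ^+ n) by exact: exprn_measurable.
have mV : measurable_fun setT (fun t : R => t^-1).
  (* [powR_inv1] wants a nonnegative base, hence the detour through [t ^+ 2]. *)
  rewrite (_ : (fun _ => _) = fun t : R => t * (t ^+ 2) `^ (-1)).
    apply: measurable_funM => //.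
    by apply: (measurableT_comp (measurable_powR _)); exact: exprn_measurable.
  apply/funext => t; rewrite powR_inv1 ?sqr_ge0//.
  by have [->|t0] := eqVneq t 0; rewrite ?invr0 ?mul0r// expr2 invfM mulVKf.
have mVX n : measurable_fun setT (fun t : R => t^-1 ^+ n) by apply: measurable_funX.
have moments n : m.-integrable setT (fun t => (t ^+ n)%:E).
  apply: (mE _ (mX n) _).1; apply: polynomial_growth_cintegrable => //.
    by apply: measurable_funM; [exact: (measurable_enorm_comp (mX _))|exact: measurable_peval].
  by apply: polynomial_growthM; [exact: polynomial_growth_enormX|exact: polynomial_growth_peval].
have radialE N : m.-integrable setT (EFin \o (fun t : R => t ^+ N * t^-1 ^+ k)) /\
    \int[m]_t (t ^+ N * t^-1 ^+ k) = cintegral mu (fun x => enorm x ^+ N * peval (Y l) (radial x)).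
  have mh : measurable_fun setT (fun t : R => t ^+ N * t^-1 ^+ k) by exact: measurable_funM.
  have E (x : 'rV[R]_d) : enorm x ^+ N * peval (Y l) (radial x) =
      (enorm x ^+ N * (enorm x)^-1 ^+ k) * peval (Y l) x.
    by rewrite (peval_radial _ hY) mulrA.
  have -> : (fun x => enorm x ^+ N * peval (Y l) (radial x)) =
      (fun x => (enorm x ^+ N * (enorm x)^-1 ^+ k) * peval (Y l) x).
    by apply/funext.
  apply: (mE _ mh); apply: polynomial_growth_cintegrable => //.
    apply: measurable_funM; last exact: measurable_peval.
    exact: (measurable_enorm_comp mh).
  under eq_fun do rewrite -E.
  apply: polynomial_growthM; first exact: polynomial_growth_enormX.
  have [M hM] := peval_bounded (Y l); exists M, 0%N => x; rewrite expr0.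
  have := hM _ (radial_coord_le1 x); have := normr_ge0 (peval (Y l) (radial x)); nra.
have J_convex : order_convex J.
  move=> t u v [t0 /andP[rt _]] [_ /andP[_ ur]] /andP[/ltW tv /ltW vu].
  split; first exact: le_trans tv.
  by rewrite (le_trans rt) ?lee_fin//= (le_trans _ ur)// lee_fin.
have [z [w [uz sz zJ exact_z bound_z]]] := measure_quadrature m_fin measurable_J mJ0
  (fun t (Jt : J t) => Jt.1) J_convex moments s.
exists z, w; split; first split=> //.
- by move=> t /zJ[[t0 Jt] wt m0]; split=> // /mk0; exact: m0.
- move=> j js; have [|_ <-] := mE _ (mX (2 * j)%N).
    apply: polynomial_growth_cintegrable => //.
      by apply: measurable_funM; [exact: (measurable_enorm_comp (mX _))|exact: measurable_peval].
    by apply: polynomial_growthM; [exact: polynomial_growth_enormX|exact: polynomial_growth_peval].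
  have := exact_z 'X^j; rewrite size_polyXn => /(_ js).
  under eq_Rintegral do rewrite hornerXn -exprM.
  by move=> ->; apply: eq_bigr => t _; rewrite hornerXn -exprM.
- move=> N; have [k0|k_gt0] := posnP k.
    rewrite {1}k0 ltn0 /= => /eqP N0; rewrite -(radialE N).2.
    have := exact_z 1; rewrite size_poly1 muln_gt0 s0 => /(_ isT).
    rewrite k0 N0; under eq_Rintegral do rewrite hornerC.
    under [in X in _ -> _ <= X]eq_Rintegral do rewrite !expr0 mulr1.
    move=> ->; apply: ler_sum => t _; by rewrite hornerC !expr0 !mulr1.
  have [Nk _|kN /= /eqP N0] := ltnP N k; last by move: kN; rewrite N0 leqNgt k_gt0.
  have E t : t != 0 -> t ^+ N * t^-1 ^+ k = t^-1 ^+ (k - N) :> R.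
    by move=> t0; rewrite -{1}(subnK (ltnW Nk)) exprD mulrCA -exprMn mulfV// expr1n mulr1.
  have [iR <-] := radialE N.
  have m00 := mk0 k_gt0.
  have E' (t : R) : ~ [set 0] t -> t^-1 ^+ (k - N) = t ^+ N * t^-1 ^+ k.
    by move=> /eqP t0; rewrite E.
  have mh : measurable_fun setT (fun t : R => t ^+ N * t^-1 ^+ k) by exact: measurable_funM.
  have iV := negligible_integrable_eq (measurable_set1 (0 : R)) m00 (mVX (k - N)%N) mh E' iR.
  rewrite -(negligible_Rintegral (measurable_set1 (0 : R)) m00 (mVX (k - N)%N) mh E').
  rewrite (le_trans _ (bound_z _ m00 iV))// big_seq [leRHS]big_seq; apply: ler_sum => t tz.
  have [_ _ w0] := zJ t tz; have [t0|t0] := eqVneq t 0; first by rewrite w0// !mul0r.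
  by rewrite -mulrA [_ * t ^+ N]mulrC E.
move=> N; rewrite -(radialE N).2.
have mh : measurable_fun setT (fun t : R => t ^+ N * t^-1 ^+ k) by exact: measurable_funM.
rewrite (negligible_Rintegral _ mJ0 mh (g := fun t : R => `|t ^+ N * t^-1 ^+ k|)).
- by apply: Rintegral_ge0.
- exact: measurableC.
- exact: measurableT_comp.
- move=> t /contrapT[t0 _]; rewrite ger0_norm// mulr_ge0// exprn_ge0//.
  by rewrite invr_ge0.
Qed.
End component.

Section atoms.
Context {R : realType}.
Variables (z : seq R) (w : R -> {nonneg R}).

Definition atomic_measure : {measure set R -> \bar R} :=
  sum_measure (fun t => mscale (w t) (dirac t)) z.

Lemma atomic_measure_null A : {in z, forall t : R, ~ A t} -> atomic_measure A = 0%E.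
Proof.
move=> zA; rewrite /atomic_measure sum_measureE big_seq big1// => t tz.
transitivity ((w t)%:num%:E * dirac t A)%E => //.
by rewrite diracE memNset ?mule0//; exact: zA.
Qed.

Let mscale_dirac_Rintegral (h : R -> R) t : measurable_fun setT h ->
  (mscale (w t) (dirac t)).-integrable setT (EFin \o h) /\
  \int[mscale (w t) (dirac t)]_x h x = (w t)%:num * h t.
Proof.
move=> mh; have mEh : measurable_fun setT (EFin \o h) by exact/measurable_EFinP.
have ih : (dirac t : {measure set R -> \bar R}).-integrable setT (EFin \o h).
  apply/integrableP; split=> //; rewrite integral_dirac//; last exact: measurableT_comp.
  by rewrite diracE mem_set// mul1e ltry.
have [iS ->] := Rintegral_mscale (w t) ih; split=> //.
by rewrite /Rintegral integral_dirac// diracE mem_set// mul1e.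
Qed.

Lemma atomic_measure_integrable (h : R -> R) : measurable_fun setT h ->
  atomic_measure.-integrable setT (EFin \o h).
Proof.
move=> mh; apply: sum_measure_integrable => // t.
exact: (mscale_dirac_Rintegral t mh).1.
Qed.

Lemma Rintegral_atomic_measure (h : R -> R) : measurable_fun setT h ->
  \int[atomic_measure]_t h t = \sum_(t <- z) (w t)%:num * h t.
Proof.
move=> mh; rewrite Rintegral_sum_measure//.
  by apply: eq_bigr => t _; exact: (mscale_dirac_Rintegral t mh).2.
by move=> t; exact: (mscale_dirac_Rintegral t mh).1.
Qed.

Lemma closed_seq : closed ([set` z] : set R).
Proof.
elim: z => [|t s IHs].
  rewrite (_ : [set` _] = set0); first exact: closed0.
  by apply/seteqP; split.
rewrite (_ : [set` _] = [set t] `|` [set` s]); first by apply: closedU => //; exact: closed_eq.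
by apply/seteqP; split=> x /=; rewrite inE => /predU1P.
Qed.

Lemma card_seq_le n : (size z <= n)%N -> ([set` z] #<= `I_n)%card.
Proof.
move=> zn; apply: card_le_trans (card_image_le (nth 0 z) `I_n); apply: subset_card_le.
move=> t /= tz; exists (index t z); last exact: nth_index.
by rewrite /= (leq_trans _ zn)// index_mem.
Qed.

Lemma measure_support_atomic : measure_support atomic_measure `<=` [set` z].
Proof.
by apply: measure_support_subset; [exact: closed_seq|]; apply: atomic_measure_null => t tz; exact.
Qed.

End atoms.

Section existence.
Context {R : realType} {d : nat} {a : nat -> nat}.
Variable Y : forall k, 'I_(a k) -> mpoly d R.
Hypotheses (d_gt0 : (0 < d)%N) (Y_basis : orthonormal_harmonic_basis Y).
Variables (rho : R) (r : \bar R) (mu : {charge set 'rV[R]_d -> \bar R}).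
Hypothesis rho_lt_r : (rho%:E < r)%E.
Hypotheses (mu_pseudo_positive : pseudo_positive Y mu) (mu_moment : moment_measure mu).
Hypothesis mu_support :
  measure_support (charge_total_variation mu) `<=` annulus rho r.
Hypothesis mu_summable : (\sum_(k <oo) (\sum_(l < a k)
  cintegral mu (fun x => peval (Y l) (radial x)))%:E < +oo)%E.
Hypothesis mu_summable_infty : r = +oo%E -> forall N : nat,
  (\sum_(k <oo) (\sum_(l < a k)
     cintegral mu (fun x => enorm x ^+ N * peval (Y l) (radial x)))%:E < +oo)%E.

Lemma exists_quadrature_solution s : (0 < s)%N ->
  exists sigma, quadrature_solution Y rho r mu s sigma.
Proof.
move=> s0.
pose spec k (l : 'I_(a k)) z (w : R -> R) := [/\ uniq z, (size z <= s)%N,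
    {in z, forall t : R, [/\ 0 <= t, (rho%:E <= t%:E <= r)%E, 0 <= w t &
      (0 < k)%N -> t = 0 -> w t = 0]},
    forall j, (j < 2 * s)%N ->
      cintegral mu (fun x => enorm x ^+ (2 * j) * peval (Y l) x) =
      \sum_(t <- z) w t * t ^+ (2 * j) &
    forall N, (N < k)%N || (N == 0)%N ->
      \sum_(t <- z) w t * t^-1 ^+ k * t ^+ N <=
      cintegral mu (fun x => enorm x ^+ N * peval (Y l) (radial x)) ] /\
    forall N, 0 <= cintegral mu (fun x => enorm x ^+ N * peval (Y l) (radial x)).
have /choice[f fP] : forall i : {k & 'I_(a k)}, exists zw : seq R * (R -> R),
    spec (tag i) (tagged i) zw.1 zw.2.
  move=> [k l]; have [z [w zw]] :=
    component_quadrature Y_basis mu_pseudo_positive mu_moment mu_support l s0.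
  by exists (z, w).
pose z k (l : 'I_(a k)) : seq R := (f (Tagged (fun k => 'I_(a k)) l)).1.
pose w k (l : 'I_(a k)) : R -> R := (f (Tagged (fun k => 'I_(a k)) l)).2.
have zwP k (l : 'I_(a k)) : spec k l (z k l) (w k l) by exact: (fP (Tagged _ l)).
(* The shell at radius t has weight [w t * t^-k]. It is nonnegative at the nodes; the absolute value
   makes it so for every t. *)
pose c k (l : 'I_(a k)) (t : R) : {nonneg R} := NngNum (normr_ge0 (w k l t * t^-1 ^+ k)).
have cE k (l : 'I_(a k)) : {in z k l, forall t : R, (c k l t)%:num = w k l t * t^-1 ^+ k}.
  move=> t tz; have [[_ _ /(_ _ tz)[t0 _ w0 _] _ _] _] := zwP k l.
  by rewrite /= ger0_norm// mulr_ge0// exprn_ge0// invr_ge0.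
have z_ge0 k (l : 'I_(a k)) : {in z k l, forall t : R, 0 <= t}.
  by move=> t tz; have [[_ _ /(_ _ tz)[]]] := zwP k l.
have cN_ge0 N k (l : 'I_(a k)) : 0 <= \sum_(t <- z k l) (c k l t)%:num * t ^+ N.
  by rewrite big_seq; apply: sumr_ge0 => t tz; rewrite mulr_ge0// exprn_ge0// (z_ge0 _ _ _ tz).
have sumE N k (l : 'I_(a k)) : \sum_(t <- z k l) (c k l t)%:num * t ^+ N =
    \sum_(t <- z k l) w k l t * t^-1 ^+ k * t ^+ N.
  by rewrite big_seq [RHS]big_seq; apply: eq_bigr => t tz; rewrite cE.
have summable N : (\sum_(k <oo)
    (\sum_(l < a k) \sum_(t <- z k l) (c k l t)%:num * t ^+ N)%:E < +oo)%E.
  pose I N k := \sum_(l < a k) cintegral mu (fun x => enorm x ^+ N * peval (Y l) (radial x)).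
  have I0 M k : 0 <= I M k by apply: sumr_ge0 => l _; exact: (zwP k l).2.
  (* In the unbounded case the N-th series of the hypothesis dominates for k > N; in a bounded
     annulus [t ^+ N] is at most [|r| ^ N] at the nodes, and the series for N = 0 suffices. *)
  have [r_oo|r_fin] := eqVneq r +oo%E.
    apply: (@nneseries_lty_eventually _ _ (I N) N.+1) => // [k|k Nk|].
    - by apply: sumr_ge0.
    - apply: ler_sum => l _; rewrite sumE.
      by have [[_ _ _ _ ->]] := zwP k l => //; rewrite Nk.
    - exact: mu_summable_infty.
  have [r' rE] : exists r', r = r'%:E.
    by move: rho_lt_r r_fin; case: r => // r'; exists r'.
  apply: (@nneseries_lty_eventually _ _ (fun k => `|r'| ^+ N * I 0%N k) 0) => // [k|k|k _|].
  - by apply: sumr_ge0.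
  - by rewrite mulr_ge0// exprn_ge0.
  - rewrite mulr_sumr; apply: ler_sum => l _.
    apply: (@le_trans _ _ (`|r'| ^+ N * \sum_(t <- z k l) (c k l t)%:num * t ^+ 0)).
      rewrite mulr_sumr big_seq [leRHS]big_seq; apply: ler_sum => t tz.
      have [[_ _ /(_ _ tz)[t0 /andP[_ tr] _ _] _ _] _] := zwP k l.
      rewrite expr0 mulr1 mulrC ler_wpM2r// lerXn2r ?nnegrE//.
      by move: tr; rewrite rE lee_fin => /le_trans; apply; exact: ler_norm.
    rewrite ler_wpM2l ?exprn_ge0// sumE.
    by have [[_ _ _ _ ->]] := zwP k l => //; rewrite orbT.
  under eq_eseriesr do rewrite EFinM.
  rewrite nneseriesZl; last by move=> k _; rewrite lee_fin.
  rewrite lte_mul_pinfty ?lee_fin ?exprn_ge0//.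
  apply: le_lt_trans mu_summable; apply: lee_nneseries => [k _ _|k _]; first by rewrite lee_fin.
  rewrite lee_fin; apply: ler_sum => l _; rewrite le_eqVlt; apply/orP; left; apply/eqP.
  by congr cintegral; apply/funext => x; rewrite expr0 mul1r.
have [sigma [sigma0 sigma_int sigmaE]] := orthonormal_shell_charge Y_basis z_ge0 summable.
have {}sigmaE k (l : 'I_(a k)) (h : R -> R) : measurable_fun setT h -> polynomially_bounded h ->
     cintegral sigma (fun x => h (enorm x) * peval (Y l) x) =
     \sum_(t <- z k l) w k l t * h t.
  move=> mh hh; rewrite sigmaE// big_seq [RHS]big_seq; apply: eq_bigr => t tz.
  congr (_ * _); rewrite cE//.
  have [[_ _ /(_ _ tz)[_ _ _ w0] _ _] _] := zwP k l.
  (* At [t = 0] the product of [t^-k] and [t^k] is 0 instead of 1 when k > 0, but then the weight is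
     0. *)
  have [t0|t0] := eqVneq t 0; last by rewrite -mulrA -exprMn mulVf// expr1n mulr1.
  have [k0|k0] := posnP k; last by rewrite w0// !mul0r.
  have e0 (x : R) : x ^+ k = 1 by rewrite k0.
  by rewrite !e0 !mulr1.
exists sigma; split.
- move=> h hc h0 hK k l.
  have hb := compact_support_bounded hc hK.
  have mh : measurable_fun setT (fun t : R => h (Num.max 0 t)).
    by apply: continuous_measurable_fun; exact: continuous_half_line.
  have := sigmaE k l _ mh (polynomially_bounded_half_line hb).
  under [X in cintegral _ X]eq_fun do rewrite max_enorm.
  move=> ->; rewrite big_seq; apply: sumr_ge0 => t tz.
  have [[_ _ /(_ _ tz)[t0 _ w0 _] _ _] _] := zwP k l.
  by rewrite mulr_ge0// (max_idPr t0) h0.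
- move=> P; apply: sigma_int; [exact: measurable_peval|exact: polynomial_growth_peval].
- apply: measure_support_subset; first exact: closed_annulus.
  apply: sigma0; first by apply: measurableC; exact: measurable_annulus.
  move=> k l t tz x x1; apply; rewrite /annulus /= enormZ x1 mulr1.
  have [[_ _ /(_ _ tz)[t0 tr _ _] _ _] _] := zwP k l.
  by rewrite ger0_norm.
- move=> k l.
  pose wn t : {nonneg R} := NngNum (normr_ge0 (w k l t)).
  exists (atomic_measure (z k l) wn); last first.
    apply: (card_le_trans (subset_card_le (@measure_support_atomic _ _ _))).
    by apply: card_seq_le; have [[]] := zwP k l.
  have m0 : atomic_measure (z k l) wn `]-oo, 0[%classic = 0%E.
    apply: atomic_measure_null => t /z_ge0 t0.
    by rewrite /= in_itv /= ltNge t0.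
  split=> // [n|h hc hb].
    apply: (integrable_lty (measurable_itv _)).
    apply: (integrableS measurableT) => //.
    by apply: atomic_measure_integrable; exact: exprn_measurable.
  have mh : measurable_fun setT (fun t : R => h (Num.max 0 t)).
    by apply: continuous_measurable_fun; exact: continuous_half_line.
  rewrite Rintegral_half_line// Rintegral_atomic_measure//.
  have := sigmaE k l _ mh (polynomially_bounded_half_line hb).
  under [X in cintegral _ X]eq_fun do rewrite max_enorm.
  move=> ->; rewrite big_seq [RHS]big_seq; apply: eq_bigr => t tz.
  have [[_ _ /(_ _ tz)[t0 _ w0 _] _ _] _] := zwP k l.
  by rewrite /= ger0_norm.
pose S (P : mpoly d R) := cintegral mu (peval P) = cintegral sigma (peval P).
have S0 : S 0.
  have E : peval (0 : mpoly d R) = cst 0 by apply/funext => x; rewrite peval0.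
  by rewrite /S E /cintegral !Rintegral_cst// !mul0r subrr.
have SD e P Q : S P -> S Q -> S (e *: P + Q).
  rewrite /S => SP SQ; have cmu (p : mpoly d R) : cintegrable mu (peval p) by exact: mu_moment.
  have csigma (p : mpoly d R) : cintegrable sigma (peval p).
    by apply: sigma_int; [exact: measurable_peval|exact: polynomial_growth_peval].
  have -> : peval (e *: P + Q) = fun x => e * peval P x + peval Q x.
    by apply/funext => x; rewrite pevalD pevalZ.
  by rewrite !cintegralD ?cintegralZ ?SP ?SQ//; exact: cintegrableZ.
apply: (polyharmonic_ind (S := S)) => // j k H js hH.
apply: (harmonic_span Y_basis S0 SD _ hH) => l; rewrite /S.
have -> : peval (norm_sq_poly ^+ j * Y l) = fun x => enorm x ^+ (2 * j) * peval (Y l) x.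
  by apply/funext => x; rewrite peval_norm_sq_powM.
rewrite (sigmaE k l (fun t => t ^+ (2 * j))).
- by have [[_ _ _ ->]] := zwP k l.
- exact: exprn_measurable.
- exists 1, (2 * j)%N => t t0; rewrite mul1r ger0_norm ?exprn_ge0//.
  by rewrite lerDr.
Qed.

End existence.

(** * Uniqueness *)

(** The polynomial in [t ^+ 2] vanishing at all points of [z] but one has size at most n, so the
    matching moments give both measures the same mass at that point. Squaring separates the points
    because they are nonnegative. *)
Lemma finite_support_moments_eq {R : realType} (m1 m2 : {measure set R -> \bar R})
    (z : seq R) n : uniq z -> (size z <= n)%N -> {in z, forall t : R, 0 <= t} ->
  (m1 setT < +oo)%E -> (m2 setT < +oo)%E ->
  m1 (~` [set` z]) = 0%E -> m2 (~` [set` z]) = 0%E ->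
  (forall j, (j < n)%N -> \int[m1]_t t ^+ (2 * j) = \int[m2]_t t ^+ (2 * j)) ->
  forall F : R -> R, measurable_fun setT F -> \int[m1]_t F t = \int[m2]_t F t.
Proof.
move=> uz zn z0 fin1 fin2 m1z m2z mE F mF.
have sumE (G : R -> R) : measurable_fun setT G ->
    \int[m1]_t G t - \int[m2]_t G t =
    \sum_(t <- z) (fine (m1 [set t]) - fine (m2 [set t])) * G t.
  move=> mG; rewrite (finite_support_Rintegral fin1 uz m1z mG).
  rewrite (finite_support_Rintegral fin2 uz m2z mG) -sumrB.
  by apply: eq_bigr => t _; rewrite mulrBl.
have polyE (p : {poly R}) : (size p <= n)%N ->
    \sum_(t <- z) (fine (m1 [set t]) - fine (m2 [set t])) * p.[t ^+ 2] = 0.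
  move=> pn; under eq_bigr do rewrite horner_coef mulr_sumr.
  rewrite exchange_big /=; apply: big1 => j _.
  have mX : measurable_fun setT (fun t : R => t ^+ (2 * j)) by exact: exprn_measurable.
  have E : \sum_(t <- z) (fine (m1 [set t]) - fine (m2 [set t])) * t ^+ (2 * j) = 0.
    by rewrite -sumE// mE ?subrr//; exact: leq_trans pn.
  transitivity (p`_j * \sum_(t <- z) (fine (m1 [set t]) - fine (m2 [set t])) * t ^+ (2 * j)).
    by rewrite mulr_sumr; apply: eq_bigr => t _; rewrite exprM mulrCA.
  by rewrite E mulr0.
apply/eqP; rewrite -subr_eq0 sumE// big_seq big1// => t tz.
pose p : {poly R} := \prod_(v <- map (fun u => u ^+ 2) (rem t z)) ('X - v%:P).
have /polyE : (size p <= n)%N.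
  rewrite size_prod_XsubC size_map size_rem// prednK//.
  by case: (z) tz.
rewrite (bigD1_seq t)//= big_seq_cond big1 ?addr0; last first.
  move=> u /andP[uz' ut]; apply/eqP; rewrite mulf_eq0; apply/orP; right.
  suff : root p (u ^+ 2) by [].
  by rewrite root_prod_XsubC; apply: map_f; rewrite mem_rem_uniq// inE ut.
move=> /eqP; rewrite mulf_eq0 => /orP[/eqP -> |]; first by rewrite mul0r.
move=> pt; exfalso.
have : t ^+ 2 \in map (fun u => u ^+ 2) (rem t z).
  by rewrite -root_prod_XsubC.
move=> /mapP[u uz' /eqP]; rewrite eqrXn2 ?z0//; last exact: mem_rem uz'.
by move=> /eqP tu; move: uz'; rewrite -tu mem_rem_uniqF.
Qed.

Section component_uniqueness.
Context {R : realType} {d : nat} {a : nat -> nat}.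
Variable Y : forall k, 'I_(a k) -> mpoly d R.

Lemma component_measure_nodes sigma k (l : 'I_(a k)) (m : {measure set R -> \bar R}) s :
  component_measure Y sigma l m -> (measure_support m #<= `I_s)%card ->
  exists z : seq R, [/\ (size z <= s)%N, {in z, forall t : R, 0 <= t},
    m (~` [set` z]) = 0%E & (m setT < +oo)%E].
Proof.
move=> [m0 m_mom _] m_card.
have /finite_seqP[z' z'E] : finite_set (measure_support m).
  exact: card_le_finite m_card (finite_II s).
pose z := undup z'.
have zE : measure_support m = [set` z].
  by rewrite z'E; apply/seteqP; split=> t /=; rewrite mem_undup.
have mz : measurable ([set` z] : set R) by exact: measurable_seq.
exists z; split.
- have : (`I_(size z) #<= `I_s)%card.
    apply: card_le_trans m_card; rewrite zE.
    have -> : [set` z] = nth 0 z @` `I_(size z).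
      apply/seteqP; split=> [t tz|_ [i /= iz <-]]; last exact: mem_nth.
      by exists (index t z); [rewrite /= index_mem|exact: nth_index].
    have nth_inj : {in `I_(size z) &, injective (nth 0 z)}.
      move=> i j; rewrite !inE /= => iz jz /eqP.
      by rewrite nth_uniq ?undup_uniq// => /eqP.
    by have /card_eqPle[] := inj_card_eq nth_inj.
  by rewrite card_le_II.
- move=> t tz; have : measure_support m t by rewrite zE.
  have cl : closed (`[0, +oo[%classic : set R) by exact: interval_closed.
  have clC : m (~` `[0, +oo[) = 0%E by rewrite setCitvr.
  by move=> /(measure_support_subset cl clC) /=; rewrite in_itv /= andbT.
- by apply: measure_supportC; [exact: measurableC|move=> t; rewrite zE].
have -> : [set: R] = `]-oo, 0[ `|` `[0, +oo[.
  by apply/seteqP; split=> // t _ /=; rewrite !in_itv /= andbT; case: (ltP t 0); [left|right].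
apply: (@le_lt_trans _ _ (m `]-oo, 0%R[%classic + m `[0%R, +oo[%classic)%E).
  by apply: measureU2.
rewrite m0 add0e; have := m_mom 0%N.
under eq_integral do rewrite expr0.
by rewrite integral_cst//= mul1e.
Qed.

Hypotheses (Y_basis : orthonormal_harmonic_basis Y) (d_gt0 : (0 < d)%N).
Variables (rho : R) (r : \bar R) (mu sigma1 sigma2 : {charge set 'rV[R]_d -> \bar R}) (s : nat).
Hypotheses (sol1 : quadrature_solution Y rho r mu s sigma1)
           (sol2 : quadrature_solution Y rho r mu s sigma2).

(** For j < 2s the polynomial |x|^(2j) Y_l is annihilated by the 2s-th Laplacian, so both charges
    share its integral with [mu]; these integrals are the even moments of their components. *)
Let radial_basis_eq k (l : 'I_(a k)) (h : R -> R) : continuous h ->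
  polynomially_bounded h ->
  cintegral sigma1 (fun x => h (enorm x) * peval (Y l) x) =
  cintegral sigma2 (fun x => h (enorm x) * peval (Y l) x).
Proof.
move=> hc hb.
have [_ _ _ comp1 exact1] := sol1; have [_ _ _ comp2 exact2] := sol2.
have [m1 c1 card1] := comp1 k l; have [m2 c2 card2] := comp2 k l.
have [z1 [zs1 z1_ge0 m1z fin1]] := component_measure_nodes c1 card1.
have [z2 [zs2 z2_ge0 m2z fin2]] := component_measure_nodes c2 card2.
have hcomp (sigma : {charge set 'rV[R]_d -> \bar R}) m (g : R -> R) :
    component_measure Y sigma l m -> continuous g -> polynomially_bounded g ->
    \int[m]_t g (Num.max 0 t) = cintegral sigma (fun x => g (enorm x) * peval (Y l) x).
  move=> [m0 _ mE] gc gb; rewrite -mE//; last exact: continuous_subspaceT.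
  rewrite Rintegral_half_line//; apply: continuous_measurable_fun.
  by apply: continuous_half_line; exact: continuous_subspaceT.
rewrite -(hcomp _ _ _ c1 hc hb) -(hcomp _ _ _ c2 hc hb).
pose z := undup (z1 ++ z2).
have mz (m : {measure set R -> \bar R}) (z' : seq R) : m (~` [set` z']) = 0%E ->
    {subset z' <= z} -> m (~` [set` z]) = 0%E.
  move=> mz' sub; apply: (subset_measure0 _ _ _ mz') => //.
  - exact: measurableC (measurable_seq z).
  - exact: measurableC (measurable_seq z').
  - by move=> t /= tz /sub.
apply: (@finite_support_moments_eq _ m1 m2 z (2 * s)) => //.
- exact: undup_uniq.
- rewrite (leq_trans (size_undup _))// size_cat mul2n -addnn leq_add//.
- by move=> t; rewrite mem_undup mem_cat => /orP[/z1_ge0|/z2_ge0].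
- by apply: mz m1z _ => t tz; rewrite mem_undup mem_cat tz.
- by apply: mz m2z _ => t tz; rewrite mem_undup mem_cat tz orbT.
- move=> j js.
  have gc : continuous (fun t : R => t ^+ (2 * j)) by exact: exprn_continuous.
  have gb : polynomially_bounded (fun t : R => t ^+ (2 * j)).
    exists 1, (2 * j)%N => t t0; rewrite mul1r ger0_norm ?exprn_ge0//.
    by rewrite lerDr.
  have even sigma m : component_measure Y sigma l m ->
      \int[m]_t t ^+ (2 * j) =
      cintegral sigma (peval (norm_sq_poly ^+ j * Y l)).
    move=> c.
    have -> : peval (norm_sq_poly ^+ j * Y l) = fun x => enorm x ^+ (2 * j) * peval (Y l) x.
      by apply/funext => x; rewrite peval_norm_sq_powM.
    rewrite -(hcomp _ _ _ c gc gb); have [m0 _ _] := c.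
    apply: (negligible_Rintegral (measurable_itv `]-oo, 0[) m0).
    - exact: exprn_measurable.
    - by apply: (measurableT_comp (exprn_measurable _)); exact: measurable_maxr.
    - move=> t /=; rewrite in_itv /= => /negP; rewrite -leNgt => t0.
      by rewrite (max_idPr t0).
  rewrite (even _ _ c1) (even _ _ c2) -exact1 -?exact2//;
    have [/(_ l) hl _ _] := Y_basis k; exact: (iter_laplacian_norm_sq_pow d_gt0 hl js).
- by apply: continuous_measurable_fun; apply: continuous_half_line; exact: continuous_subspaceT.
Qed.

(** An arbitrary [P] need not be annihilated by the 2s-th Laplacian, but the powers |x|^(2j) of its
    Almansi expansion can be absorbed into [h], which leaves basis polynomials. *)
Lemma quadrature_radial_poly_eq (P : mpoly d R) (h : R -> R) : continuous h ->
  polynomially_bounded h ->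
  cintegral sigma1 (fun x => h (enorm x) * peval P x) =
  cintegral sigma2 (fun x => h (enorm x) * peval P x).
Proof.
pose S (P : mpoly d R) := forall h : R -> R, continuous h -> polynomially_bounded h ->
  cintegral sigma1 (fun x => h (enorm x) * peval P x) =
  cintegral sigma2 (fun x => h (enorm x) * peval P x).
have [_ mom1 _ _ _] := sol1; have [_ mom2 _ _ _] := sol2.
have S0 : S 0.
  move=> g gc gb; under [X in cintegral _ X]eq_fun do rewrite peval0 mulr0.
  under [X in _ = cintegral _ X]eq_fun do rewrite peval0 mulr0.
  by rewrite /cintegral !Rintegral_cst// !mul0r !subrr.
have SD e p q : S p -> S q -> S (e *: p + q).
  move=> Sp Sq g gc gb.
  have gi (nu : {charge set 'rV[R]_d -> \bar R}) (p' : mpoly d R) :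
      moment_measure nu -> cintegrable nu (fun x => g (enorm x) * peval p' x).
    move=> nu_mom; apply: polynomial_growth_cintegrable => //.
      apply: measurable_funM; last exact: measurable_peval.
      by apply: measurable_enorm_comp; exact: continuous_measurable_fun.
    by apply: polynomial_growthM;
      [exact: polynomial_growth_comp_enorm|exact: polynomial_growth_peval].
  have -> : (fun x => g (enorm x) * peval (e *: p + q) x) =
      (fun x => e * (g (enorm x) * peval p x) + g (enorm x) * peval q x).
    by apply/funext => x; rewrite pevalD pevalZ mulrDr mulrCA.
  by rewrite !cintegralD ?cintegralZ ?Sp ?Sq//; try exact: gi; apply: cintegrableZ; exact: gi.
have [N PN] := exists_iter_laplacian0 P.
move: h; rewrite -/(S P); apply: (polyharmonic_ind (S := S) d_gt0 SD _ S0 PN) => j k H _ hH.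
apply: (harmonic_span Y_basis S0 SD _ hH) => l g gc gb.
have E (nu : {charge set 'rV[R]_d -> \bar R}) :
    cintegral nu (fun x => g (enorm x) * peval (norm_sq_poly ^+ j * Y l) x) =
    cintegral nu (fun x => (g (enorm x) * enorm x ^+ (2 * j)) * peval (Y l) x).
  by congr cintegral; apply/funext => x; rewrite peval_norm_sq_powM mulrA.
rewrite !E; apply: (@radial_basis_eq k l (fun t => g t * t ^+ (2 * j))).
- by move=> t; apply: cvgM; [exact: gc|exact: exprn_continuous].
- move: gb => [C [M gC]].
  exists (3 * C), (M + 2 * j)%N => t t0.
  rewrite normrM (ger0_norm (exprn_ge0 _ t0)).
  have n1 := exprn_le1D t0 (leq_addl M (2 * j)).
  have C0 := growth_coef_ge0 (exprn_ge0 M t0) (gC _ t0).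
  apply: le_trans (ler_wpM2r (exprn_ge0 _ t0) (gC _ t0)) _.
  rewrite mulrAC mulrDl mulrDr mul1r -mulrA.
  have := exprn_ge0 (M + 2 * j) t0; move: n1; rewrite exprD; nra.
Qed.

End component_uniqueness.

Lemma dominated_cintegral d (T : measurableType d) (R : realType)
    (nu : {charge set T -> \bar R}) (f_ : nat -> T -> R) (f g : T -> R) :
  (forall n, measurable_fun setT (f_ n)) -> measurable_fun setT f ->
  (forall x, f_ ^~ x @ \oo --> f x) -> cintegrable nu g ->
  (forall n x, `|f_ n x| <= g x) ->
  (cintegral nu (f_ n) : R) @[n --> \oo] --> (cintegral nu f : R).
Proof.
move=> mf_ mf cvf /cintegrableP[gp gn] fg.
by apply: cvgB; exact: dominated_Rintegral fg.
Qed.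

Lemma cintegral_indic d (T : measurableType d) (R : realType)
    (nu : {charge set T -> \bar R}) A : measurable A ->
  cintegral nu \1_A = fine (charge_pos nu A) - fine (charge_neg nu A).
Proof. by move=> mA; rewrite /cintegral /Rintegral !integral_indic// !setIT. Qed.

(** * Polynomials tending to the indicator of y < 1/2 *)

Section half_indicator.
Context {R : realType}.
Implicit Types y : R.

Lemma bernoulli (v : R) n : -1 <= v -> 1 + n%:R * v <= (1 + v) ^+ n.
Proof.
move=> v1; elim: n => [|n IHn]; first by rewrite mul0r addr0 expr0.
have v0 : 0 <= 1 + v by lra.
rewrite exprS (le_trans _ (ler_wpM2l v0 IHn))//.
by have := sqr_ge0 v; have := ler0n R n; rewrite -natr1; nra.
Qed.

(** Bernoulli's inequality bounds the second factor by [(1 + u) ^+ n], and (1 - u)(1 + u) <= 1. *)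
Lemma expr_one_minus_le (u : R) n : 0 <= u <= 1 -> (1 - u) ^+ n * (1 + n%:R * u) <= 1.
Proof.
move=> /andP[u0 u1]; have u01 : 0 <= 1 - u by lra.
have b := bernoulli n (le_trans (lerN10 R) u0).
apply: le_trans (ler_wpM2l (exprn_ge0 n u01) b) _.
by rewrite -exprMn exprn_ile1//; nra.
Qed.

Lemma cvg_natr_expr (x : R) : 0 <= x < 1 -> (n%:R * x ^+ n : R) @[n --> \oo] --> (0 : R).
Proof.
(* [v] is at least the square root of [x], so n x^n <= (n v^n) v^n; Bernoulli's inequality for 1/v =
   1 + e bounds the first factor. *)
move=> /andP[x0 x1]; pose v := (1 + x) / 2; pose e := v^-1 - 1.
have v0 : 0 < v by rewrite /v; lra.
have v1 : v < 1 by rewrite /v; lra.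
have xv : x <= v * v by rewrite /v; nra.
have e0 : 0 < e by rewrite subr_gt0 invf_gt1.
have ve : v * (1 + e) = 1 by rewrite /e addrC subrK mulfV// gt_eqF.
have nv n : n%:R * v ^+ n <= e^-1.
  have b := bernoulli n (le_trans (lerN10 R) (ltW e0)).
  rewrite -(ler_pM2r e0) mulVf ?gt_eqF// mulrAC.
  have vn : 0 <= v ^+ n by rewrite exprn_ge0// ltW.
  have : v ^+ n * (1 + n%:R * e) <= v ^+ n * (1 + e) ^+ n by rewrite ler_wpM2l.
  by rewrite -exprMn ve expr1n; nra.
apply: (@squeeze_cvgr _ _ _ _ (fun=> 0) (fun n => e^-1 * v ^+ n)).
- apply: nearW => n; rewrite mulr_ge0 ?exprn_ge0//=.
  have vn : 0 <= v ^+ n by rewrite exprn_ge0// ltW.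
  apply: le_trans (ler_wpM2r vn (nv n)).
  by rewrite -mulrA ler_wpM2l// -exprMn lerXn2r// nnegrE// mulr_ge0// ltW.
- exact: cvg_cst.
- rewrite -(mulr0 e^-1); apply: cvgM; first exact: cvg_cst.
  by apply: cvg_expr; rewrite ger0_norm ?ltW.
Qed.

(** The polynomials (1 - y^n)^(2^n) of elementary proofs of the Stone-Weierstrass theorem; the extra
    factor n in the exponent sends the value at y = 1/2 to 0 instead of 1/e. *)
Definition half_approx n y := (1 - y ^+ n) ^+ (n * 2 ^ n).

Lemma half_approx_bound n y : 0 <= y <= 1 -> 0 <= half_approx n y <= 1.
Proof.
move=> /andP[y0 y1]; have yn0 := exprn_ge0 n y0; have yn1 := exprn_ile1 n y0 y1.
by rewrite exprn_ge0 ?exprn_ile1//; lra.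
Qed.

(* Bernoulli's inequality gives 1 - n (2y)^n <= half_approx n y, and
   half_approx n y <= 1 / (1 + n) as soon as 1 <= 2 y. *)
Lemma cvg_half_approx y : 0 <= y <= 1 ->
  (half_approx n y : R) @[n --> \oo] --> ((y < 2^-1)%R%:R : R).
Proof.
move=> y01; have /andP[y0 y1] := y01; have [yh|yh] := ltP y 2^-1.
  apply: (@squeeze_cvgr _ _ _ _ (fun n => 1 - n%:R * (2 * y) ^+ n) (fun=> 1)).
  - apply: nearW => n; have /andP[_ ->] := half_approx_bound n y01; rewrite andbT.
    have yn1 : -1 <= - (y ^+ n) by rewrite lerN2 exprn_ile1.
    apply: le_trans (bernoulli (n * 2 ^ n) yn1).
    by rewrite mulrN natrM natrX exprMn mulrA.
  - rewrite -[X in _ --> X]subr0; apply: cvgB; first exact: cvg_cst.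
    by apply: cvg_natr_expr; apply/andP; split; lra.
  - exact: cvg_cst.
apply: (@squeeze_cvgr _ _ _ _ (fun=> 0) (fun n => n.+1%:R^-1)).
- apply: nearW => n; have /andP[-> _] := half_approx_bound n y01 => /=.
  have un : 0 <= y ^+ n <= 1 by rewrite exprn_ge0//= exprn_ile1.
  have := expr_one_minus_le (n * 2 ^ n) un; have /andP[h0 _] := half_approx_bound n y01.
  rewrite -/(half_approx n y) => hle.
  rewrite -[leRHS]mul1r ler_pdivlMr ?ltr0n//.
  apply: le_trans hle; rewrite ler_wpM2l// -natr1 addrC lerD2l natrM -mulrA ler_peMr//.
  by rewrite natrX -exprMn exprn_ege1//; lra.
- exact: cvg_cst.
- exact: cvg_harmonic.
Qed.

End half_indicator.

Section boxes.
Context {R : realType} {d : nat}.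
Implicit Types a x : 'rV[R]_d.

Definition box a : set 'rV[R]_d := [set x | forall i, x ord0 i < a ord0 i].

Lemma measurable_coord_lt (i : 'I_d) (c : R) : measurable [set x : 'rV[R]_d | x ord0 i < c].
Proof.
rewrite (_ : mkset _ = setT `&` (fun x : 'rV[R]_d => x ord0 i) @^-1` `]-oo, c[%classic).
  by apply: measurable_coord => //; exact: measurable_itv.
by apply/seteqP; split=> x /=; rewrite in_itv/=; [|case].
Qed.

Lemma measurable_box a : measurable (box a).
Proof.
rewrite (_ : box a = \bigcap_(i in [set: 'I_d]) [set x | x ord0 i < a ord0 i]).
  by apply: fin_bigcap_measurable => // i _; exact: measurable_coord_lt.
by apply/seteqP; split=> [x xa i _|x xa i]; [exact: xa|exact: (xa i)].
Qed.

Lemma indic_box a x : \1_(box a) x = \prod_i ((x ord0 i < a ord0 i)%R%:R : R).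
Proof.
rewrite indicE; have [xa|xa] := pselect (box a x).
  by rewrite mem_set//= big1// => i _; rewrite (xa i).
have /existsNP[i /negP/negbTE xi] := xa.
by rewrite memNset// (bigD1 i)//= xi mul0r.
Qed.

(** Each half-space [x_j < c] is the union over n of boxes whose other coordinates are bounded by n,
    so the boxes make all coordinates measurable. *)
Lemma measurable_rV_boxes : @measurable _ 'rV[R]_d = <<s range box >>.
Proof.
apply/seteqP; split=> [A mA|].
  have mid : measurable_fun setT (idfun : g_sigma_algebraType (range box) -> 'rV[R]_d).
    apply: measurable_fun_rVP => j; apply: (measurability _ (RGenInftyO.measurableE R)).
    move=> _ [_ [c ->] <-]; rewrite setTI.
    rewrite (_ : _ @^-1` _ = \bigcup_n box (\row_i if i == j then c else n%:R)).
      by apply: bigcup_measurable => n _; apply: sub_sigma_algebra; eexists.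
    apply/seteqP; split=> x /=.
      rewrite in_itv /= => xc; exists (Num.bound (enorm x)) => // i; rewrite mxE.
      case: eqVneq => [->//|_]; apply: le_lt_trans (archi_boundP (enorm_ge0 x)).
      exact: le_trans (ler_norm _) (coord_le_enorm x i).
    by move=> [n _ /(_ j)]; rewrite mxE eqxx in_itv.
  by have := mid measurableT A mA; rewrite setTI.
apply: smallest_sub; first exact: sigma_algebra_measurable.
by move=> _ [b _ <-]; exact: measurable_box.
Qed.

End boxes.

Lemma cvg_prod_seq {R : realType} (I : Type) (s : seq I) (u : I -> nat -> R) (l : I -> R) :
  (forall i, u i n @[n --> \oo] --> l i) ->
  (\prod_(i <- s) u i n : R) @[n --> \oo] --> (\prod_(i <- s) l i : R).
Proof.
move=> ul; elim: s => [|i s IHs].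
  by under eq_cvg do rewrite big_nil; rewrite big_nil; exact: cvg_cst.
by under eq_cvg do rewrite big_cons; rewrite big_cons; exact: cvgM.
Qed.

Lemma exists_peval_affine {R : realType} {d : nat} (i : 'I_d) (u v : R) n m :
  exists P : mpoly d R, forall x, peval P x = (1 - (u + v * x ord0 i) ^+ n) ^+ m.
Proof.
pose L : mpoly d R := u *: 1 + v *: mpolyX R (mnm1 i).
exists ((1 + (-1) *: L ^+ n) ^+ m) => x.
rewrite pevalXn pevalD pevalZ pevalXn /L pevalD !pevalZ.
have -> : peval 1 x = 1 by rewrite /peval meval1.
by rewrite [peval (mpolyX _ _) x]mevalXU mulr1 mulN1r.
Qed.

(** * Charges are determined by radial functions times polynomials *)

Section determination.
Context {R : realType} {d : nat}.
Variables sigma1 sigma2 : {charge set 'rV[R]_d -> \bar R}.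
Hypothesis radial_poly_eq : forall (P : mpoly d R) (h : R -> R), continuous h ->
  polynomially_bounded h ->
  cintegral sigma1 (fun x => h (enorm x) * peval P x) =
  cintegral sigma2 (fun x => h (enorm x) * peval P x).

Let cutoff_at (M : nat) (t : R) := clip (M.+1%:R - t).

Let cutoff_at_continuous M : continuous (cutoff_at M).
Proof.
move=> t; apply: (@continuous_comp _ _ _ (fun t : R => M.+1%:R - t) clip).
  by apply: cvgB; [exact: cvg_cst|exact: cvg_id].
exact: clip_continuous.
Qed.

Let measurable_cutoff_at M : measurable_fun setT (fun x : 'rV[R]_d => cutoff_at M (enorm x)).
Proof.
by apply: measurable_enorm_comp; exact: continuous_measurable_fun (@cutoff_at_continuous M).
Qed.

Let cutoff_at_norm M t : `|cutoff_at M t| <= 1.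
Proof. by rewrite ger0_norm ?clip_ge0 ?clip_le1. Qed.

Let cintegrable1 (sigma : {charge set 'rV[R]_d -> \bar R}) : cintegrable sigma (fun=> 1).
Proof. by apply: (bounded_cintegrable _ (M := 1)) => // x; rewrite normr1. Qed.

(** The polynomial approximations of the box are controlled on the ball of radius M + 1 only; the
    cutoff vanishes outside it, so dominated convergence applies. *)
Let cutoff_box_eq M (a : 'rV[R]_d) :
  cintegral sigma1 (fun x => cutoff_at M (enorm x) * \1_(box a) x) =
  cintegral sigma2 (fun x => cutoff_at M (enorm x) * \1_(box a) x).
Proof.
(* For |x| <= M + 1 the coordinates of x and a differ by at most [L]; the affine map [y] then takes
   values in [0, 1] and turns [x_i < a_i] into [y_i < 1/2]. *)
pose L : R := M.+1%:R + enorm a.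
have L0 : 0 < L by rewrite ltr_pwDl ?ltr0n// enorm_ge0.
pose y (x : 'rV[R]_d) i : R := (2^-1 - (4 * L)^-1 * a ord0 i) + (4 * L)^-1 * x ord0 i.
have yE x i : y x i = 2^-1 + (x ord0 i - a ord0 i) / (4 * L) by rewrite /y; ring.
have y01 x i : enorm x <= M.+1%:R -> 0 <= y x i <= 1.
  move=> xM; have xi := coord_le_enorm x i; have ai := coord_le_enorm a i.
  have : `|(x ord0 i - a ord0 i) / (4 * L)| <= 2^-1.
    rewrite normrM normfV (gtr0_norm (mulr_gt0 _ L0)) ?ltr0n//.
    rewrite ler_pdivrMr ?mulr_gt0 ?ltr0n// (le_trans (ler_normB _ _))//.
    rewrite (le_trans (lerD xi ai))// /L; have := enorm_ge0 a; have := enorm_ge0 x; lra.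
  by rewrite ler_norml yE => /andP[]; lra.
have yh x i : (y x i < 2^-1) = (x ord0 i < a ord0 i).
  by rewrite yE gtrDl pmulr_llt0 ?invr_gt0 ?mulr_gt0 ?ltr0n// subr_lt0.
pose f n x : R := cutoff_at M (enorm x) * \prod_i half_approx n (y x i).
have fP n : exists P : mpoly d R, forall x, peval P x = \prod_i half_approx n (y x i).
  have /choice[p pE] : forall i, exists P : mpoly d R, forall x,
      peval P x = half_approx n (y x i).
    by move=> i; exact: exists_peval_affine.
  exists (\prod_i p i) => x; rewrite /peval rmorph_prod.
  by apply: eq_bigr => i _; exact: pE.
have f_eq n : cintegral sigma1 (f n) = cintegral sigma2 (f n).
  have [P PE] := fP n.
  have -> : f n = fun x => cutoff_at M (enorm x) * peval P x.
    by apply/funext => x; rewrite PE.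
  apply: radial_poly_eq; first exact: cutoff_at_continuous.
  exists 1, 0%N => t _; rewrite expr0 mul1r (le_trans (cutoff_at_norm _ _))//.
  by rewrite lerDl.
have mf n : measurable_fun setT (f n).
  have [P PE] := fP n; apply: measurable_funM => //.
  rewrite (_ : (fun _ => _) = peval P); first exact: measurable_peval.
  by apply/funext => x; rewrite PE.
have far x : ~ enorm x <= M.+1%:R -> cutoff_at M (enorm x) = 0.
  by move=> /negP; rewrite -ltNge => xM; rewrite /cutoff_at clip_le0// subr_le0 ltW.
have lim (sigma : {charge set 'rV[R]_d -> \bar R}) :
    (cintegral sigma (f n) : R) @[n --> \oo] -->
    (cintegral sigma (fun x => (cutoff_at M (enorm x) * \1_(box a) x)%R) : R).
  apply: (dominated_cintegral mf _ _ (cintegrable1 sigma)).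
  - by apply: measurable_funM => //; apply: measurable_indic; exact: measurable_box.
  - move=> x; have [xM|xM] := pselect (enorm x <= M.+1%:R); last first.
      by rewrite far// mul0r; under eq_cvg do rewrite /f far// mul0r; exact: cvg_cst.
    apply: cvgM; first exact: cvg_cst.
    rewrite indic_box; apply: cvg_prod_seq => i.
    by rewrite -yh; apply: cvg_half_approx; exact: y01.
  - move=> n x; have [xM|xM] := pselect (enorm x <= M.+1%:R); last first.
      by rewrite /f far// mul0r normr0.
    rewrite normrM -[leRHS]mulr1 ler_pM// ger0_norm.
      by apply: prodr_ile1 => i _; exact: half_approx_bound (y01 x i xM).
    by apply: prodr_ge0 => i _; have /andP[] := half_approx_bound n (y01 x i xM).
apply: (cvg_unique _ (lim sigma1)) => //.
rewrite (_ : (fun n => cintegral sigma1 (f n)) = (fun n => cintegral sigma2 (f n))).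
  exact: lim.
exact/funext.
Qed.

Let box_eq a : cintegral sigma1 \1_(box a) = cintegral sigma2 \1_(box a).
Proof.
have lim (sigma : {charge set 'rV[R]_d -> \bar R}) :
    (cintegral sigma (fun x => (cutoff_at M (enorm x) * \1_(box a) x)%R) : R) @[M --> \oo] -->
    (cintegral sigma \1_(box a) : R).
  have m1 : measurable_fun setT (\1_(box a) : 'rV[R]_d -> R).
    by apply: measurable_indic; exact: measurable_box.
  apply: (dominated_cintegral _ m1 _ (cintegrable1 sigma)).
  - by move=> M; exact: measurable_funM.
  - move=> x; apply: cvg_near_cst; near=> M.
    suff : enorm x <= M%:R.
      by move=> xM; rewrite /cutoff_at clip_ge1 ?mul1r// -natr1; lra.
    apply: le_trans (ltW (archi_boundP (enorm_ge0 x))) _; rewrite ler_nat.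
    by near: M; exact: nbhs_infty_ge.
  - move=> M x; rewrite normrM mulr_ile1//.
    by rewrite indicE; case: (_ \in _); rewrite ?normr1 ?normr0.
apply: (cvg_unique _ (lim sigma1)) => //.
rewrite (_ : (fun M => _) = (fun M =>
  cintegral sigma2 (fun x => (cutoff_at M (enorm x) * \1_(box a) x)%R))).
  exact: lim.
by apply/funext => M; exact: cutoff_box_eq.
Unshelve. all: by end_near. Qed.

(** Uniqueness on a generating family closed under intersection is a statement on measures, so each
    positive part is added to the negative part of the other charge; the two sums agree on boxes. *)
Lemma charge_eq_of_radial_poly A : measurable A -> sigma1 A = sigma2 A.
Proof.
move=> mA; pose p := measure_add (charge_pos sigma1) (charge_neg sigma2).
pose n := measure_add (charge_pos sigma2) (charge_neg sigma1).
have fin (q : {finite_measure set 'rV[R]_d -> \bar R}) B : measurable B -> q B \is a fin_num.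
  exact: fin_num_measure.
have pE B : p B = (charge_pos sigma1 B + charge_neg sigma2 B)%E by exact: measure_addE'.
have nE B : n B = (charge_pos sigma2 B + charge_neg sigma1 B)%E by exact: measure_addE'.
have pn B : measurable B -> p B = n B.
  apply: (@measure_unique _ R 'rV[R]_d (range box)
    (fun k : nat => box (const_mx k%:R)) measurable_rV_boxes).
  - move=> _ _ [u _ <-] [v _ <-]; exists (\row_i Num.min (u ord0 i) (v ord0 i)) => //.
    apply/seteqP; split=> x /=.
      by move=> xuv; split=> i; have := xuv i; rewrite mxE lt_min => /andP[].
    by move=> [xu xv] i; rewrite mxE lt_min xu xv.
  - by move=> k; eexists.
  - apply/seteqP; split=> // x _; exists (Num.bound (enorm x)) => // i; rewrite mxE.
    apply: le_lt_trans (archi_boundP (enorm_ge0 x)).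
    exact: le_trans (ler_norm _) (coord_le_enorm x i).
  - move=> _ [b _ <-]; have mb := measurable_box b.
    have := box_eq b; rewrite !cintegral_indic// => E.
    rewrite [LHS]pE [RHS]nE -[charge_pos sigma1 _]fineK ?fin// -[charge_neg sigma2 _]fineK ?fin//.
    rewrite -[charge_pos sigma2 _]fineK ?fin// -[charge_neg sigma1 _]fineK ?fin//.
    by rewrite -!EFinD; congr EFin; lra.
  - move=> k; rewrite [ltLHS]pE lte_add_pinfty// ltey_eq fin//; exact: measurable_box.
have := pn A mA; rewrite pE nE (charge_decomp sigma1 mA) (charge_decomp sigma2 mA).
rewrite -[charge_pos sigma1 _]fineK ?fin// -[charge_neg sigma2 _]fineK ?fin//.
rewrite -[charge_pos sigma2 _]fineK ?fin// -[charge_neg sigma1 _]fineK ?fin//.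
by rewrite -!EFinD => -[E]; congr EFin; lra.
Qed.

End determination.

Theorem theorem20 (R : realType) (d : nat) (d_ge2 : (2 <= d)%N)
  (a : nat -> nat) (Y : forall k, 'I_(a k) -> mpoly d R)
  (Y_basis : orthonormal_harmonic_basis Y)
  (rho : R) (r : \bar R) (rho_ge0 : 0 <= rho) (rho_lt_r : (rho%:E < r)%E)
  (mu : {charge set 'rV[R]_d -> \bar R})
  (mu_pseudo_positive : pseudo_positive Y mu)
  (mu_moment : moment_measure mu)
  (mu_support :
    measure_support (charge_total_variation mu) `<=` annulus rho r)
  (mu_summable :
    (\sum_(k <oo) (\sum_(l < a k)
       cintegral mu (fun x => peval (Y k l) (radial x)))%:E < +oo)%E)
  (mu_summable_infty : r = +oo%E -> forall N : nat,
    (\sum_(k <oo) (\sum_(l < a k)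
       cintegral mu (fun x => enorm x ^+ N * peval (Y k l) (radial x)))%:E
     < +oo)%E)
  (s : nat) (s_ge1 : (1 <= s)%N) :
  let solution (sigma : {charge set 'rV[R]_d -> \bar R}) :=
    [/\ pseudo_positive Y sigma,
        moment_measure sigma,
        measure_support (charge_total_variation sigma) `<=` annulus rho r,
        forall k (l : 'I_(a k)),
          exists2 m : {measure set R -> \bar R},
            component_measure Y sigma l m & (measure_support m #<= `I_s)%card
      & forall P : mpoly d R, iter (2 * s) laplacian P = 0 ->
          cintegral mu (peval P) = cintegral sigma (peval P)] in
  exists sigma, solution sigma /\
    (* charges are only constrained on measurable sets *)
    forall sigma', solution sigma' ->
      forall A, measurable A -> sigma' A = sigma A.
Proof.
move=> solution; have d_gt0 : (0 < d)%N by exact: ltnW.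
have [sigma sigmaP] := exists_quadrature_solution d_gt0 Y_basis rho_lt_r
  mu_pseudo_positive mu_moment mu_support mu_summable mu_summable_infty s_ge1.
exists sigma; split=> // sigma' sigma'P.
apply: charge_eq_of_radial_poly => P h.
exact: (quadrature_radial_poly_eq Y_basis d_gt0 sigma'P sigmaP).
Qed.
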